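(* Let $\Gamma$ be a countable group which has the local lifting property (LLP) and is residually finite-dimensional (RFD). Let $(\phi_n\colon \Gamma\to U_{k_n})_{n=1}^\infty$ be an asymptotic representation of $\Gamma$, i.e. a sequence of maps into unitary groups $U_{k_n}$ of $\mathbb{C}^{k_n}$ such that $\|\phi_n(gh)-\phi_n(g)\phi_n(h)\|\to 0$ as $n\to\infty$ for all $g,h\in\Gamma$, where $\|\cdot\|$ is the operator norm. Then there exist a sequence of finite-dimensional Hilbert spaces $H_n$, unitary representations $\pi_n\colon \Gamma\to U(H_n)$, and isometric inclusions $v_n\colon \mathbb{C}^{k_n}\to H_n$ such that $\|v_n^*\pi_n(g)v_n-\phi_n(g)\|\to 0$ as $n\to\infty$ for all $g\in\Gamma$.
   Context: Groups are discrete. $C^*\Gamma$ denotes the full (maximal) group $C^*$-algebra: the completion of $\mathbb{C}[\Gamma]$ in the norm $\|a\|=\sup\|\pi(a)\|$, the supremum being over all unitary representations $\pi$ of $\Gamma$ (extended linearly). An operator system is a self-adjoint subspace of a unital $C^*$-algebra containing the unit. A linear map $\phi\colon E\to A$ from an operator system or $C^*$-algebra $E$ to a $C^*$-algebra $A$ is contractive completely positive (ccp) if for all $n$ the entrywise map $M_n(E)\to M_n(A)$ takes positive elements to positive elements and has norm at most one. A unital $C^*$-algebra $A$ has the local lifting property (LLP) if for every $C^*$-algebra $B$ with closed two-sided ideal $J$ and quotient map $\pi\colon B\to B/J$, every ccp map $\phi\colon A\to B/J$, and every finite-dimensional operator system $E\subseteq A$, there is a ccp map $\psi\colon E\to B$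 with $\pi\circ\psi=\phi|_E$. A group $\Gamma$ has the LLP if $C^*\Gamma$ does. A group $\Gamma$ is residually finite-dimensional (RFD) if for every nonzero $a\in C^*\Gamma$ there is a finite-dimensional unitary representation $\sigma$ of $\Gamma$ with $\sigma(a)\neq 0$ (equivalently, the finite-dimensional representations are dense in the Fell topology). *)

(* Defs.v *)
From HB Require Import structures.
From mathcomp Require Import all_boot all_order all_algebra finmap.
From mathcomp Require Import all_classical all_reals all_analysis.
From mathcomp Require Export complex.

Set Implicit Arguments.
Unset Strict Implicit.
Unset Printing Implicit Defensive.

Import Order.TTheory GRing.Theory Num.Theory.
Import numFieldNormedType.Exports.

Local Open Scope classical_set_scope.
Local Open Scope ring_scope.
Local Open Scope sesquilinear_scope.

(* The norm of a normed space over R[i] takes its values in R[i]; this is the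
   same norm, valued in R. *)
Definition rnorm (R : realType) (V : normedModType R[i]) (x : V) : R :=
  complex.Re `|x|.

(* MathComp-Analysis norms matrices by the maximum of the entries, so the
   Euclidean norm and the operator norm on C^n are defined here. *)
Definition l2norm (R : realType) (n : nat) (x : 'cV[R[i]]_n) : R :=
  Num.sqrt (\sum_i complex.Re (`|x i 0| ^+ 2)).

Definition mx_opnorm (R : realType) (n : nat) (M : 'M[R[i]]_n) : R :=
  sup [set l2norm (M *m x) | x in [set x : 'cV[R[i]]_n | l2norm x <= 1]].

Definition mx_unitary_rep (R : realType) (G : groupType) (n : nat)
    (s : G -> 'M[R[i]]_n) : Prop :=
  (forall g, s g \is unitarymx) /\ (forall g h, s (g * h)%g = s g *m s h).

Record hilbert_space (R : realType) := HilbertSpace {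
  hs_carrier :> completeNormedModType R[i];
  inner : hs_carrier -> hs_carrier -> R[i];
  inner_linearl : forall a x y z,
    inner (a *: x + y) z = a * inner x z + inner y z;
  inner_conj : forall x y, inner y x = (inner x y)^*;
  inner_norm : forall x, inner x x = `|x| ^+ 2
}.

Definition op_norm (R : realType) (V W : normedModType R[i]) (T : V -> W) : R :=
  sup [set rnorm (T x) | x in [set x : V | rnorm x <= 1]].

Definition unitary_op (R : realType) (H : hilbert_space R) (T : H -> H) : Prop :=
  [/\ linear T,
      forall x y, inner (T x) (T y) = inner x y &
      forall y, exists x, T x = y].

Definition unitary_rep (R : realType) (G : groupType) (H : hilbert_space R)
    (rho : G -> H -> H) : Prop :=
  (forall g, unitary_op (rho g)) /\
  (forall g h x, rho (g * h)%g x = rho g (rho h x)).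

(* Not necessarily unital. *)
Record cstar_algebra (R : realType) := CStarAlgebra {
  cs_carrier :> completeNormedModType R[i];
  cmul : cs_carrier -> cs_carrier -> cs_carrier;
  cstar : cs_carrier -> cs_carrier;
  cmulA : forall x y z, cmul x (cmul y z) = cmul (cmul x y) z;
  cmul_linearl : forall a x y z,
    cmul (a *: x + y) z = a *: cmul x z + cmul y z;
  cmul_linearr : forall a x y z,
    cmul z (a *: x + y) = a *: cmul z x + cmul z y;
  cstar_antilinear : forall a x y,
    cstar (a *: x + y) = a^* *: cstar x + cstar y;
  cstarK : forall x, cstar (cstar x) = x;
  cstarM : forall x y, cstar (cmul x y) = cmul (cstar y) (cstar x);
  cnormM : forall x y, `|cmul x y| <= `|x| * `|y|;
  cstar_identity : forall x, `|cmul (cstar x) x| = `|x| ^+ 2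
}.

Record unital_cstar_algebra (R : realType) := UnitalCStarAlgebra {
  ucs_base :> cstar_algebra R;
  cone : ucs_base;
  cmul1x : forall x, cmul cone x = x;
  cmulx1 : forall x, cmul x cone = x
}.

(* The *-algebra M_n(A).  MathComp's matrix product needs a ring of
   coefficients with a unit, which A may lack. *)
Definition mx_cmul (R : realType) (A : cstar_algebra R) (m n p : nat)
    (X : 'M[A]_(m, n)) (Y : 'M[A]_(n, p)) : 'M[A]_(m, p) :=
  \matrix_(i, j) \sum_k cmul (X i k) (Y k j).

Definition mx_cstar (R : realType) (A : cstar_algebra R) (m n : nat)
    (X : 'M[A]_(m, n)) : 'M[A]_(n, m) :=
  \matrix_(i, j) cstar (X j i).

Definition mx_positive (R : realType) (A : cstar_algebra R) (n : nat)
    (X : 'M[A]_n) : Prop :=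
  exists Y : 'M[A]_n, X = mx_cmul (mx_cstar Y) Y.

(* The C*-norm of M_n(A): the norm of X as an operator on the Hilbert
   A-module A^n, whose norm is |a| = | sum_i a_i^* a_i | ^ (1/2). *)
Definition col_cnorm (R : realType) (A : cstar_algebra R) (n : nat)
    (a : 'cV[A]_n) : R :=
  Num.sqrt (rnorm (\sum_i cmul (cstar (a i 0)) (a i 0))).

Definition mx_cnorm (R : realType) (A : cstar_algebra R) (n : nat)
    (X : 'M[A]_n) : R :=
  sup [set col_cnorm (mx_cmul X a) | a in [set a : 'cV[A]_n | col_cnorm a <= 1]].

(* f is ccp on the subspace E of A; the values of f outside E are irrelevant.
   Matrices over E are positive when they are so over A. *)
Definition ccp_on (R : realType) (A B : cstar_algebra R) (E : set A)
    (f : A -> B) : Prop :=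
  (forall (a : R[i]) x y, E x -> E y -> f (a *: x + y) = a *: f x + f y) /\
  (forall (n : nat) (X : 'M[A]_n), (forall i j, E (X i j)) ->
     (mx_positive X -> mx_positive (map_mx f X)) /\
     mx_cnorm (map_mx f X) <= mx_cnorm X).

Definition subspace (R : realType) (V : lmodType R[i]) (E : set V) : Prop :=
  E 0 /\ forall (a : R[i]) x y, E x -> E y -> E (a *: x + y).

Definition fin_dim (R : realType) (V : lmodType R[i]) (E : set V) : Prop :=
  exists (n : nat) (b : 'I_n -> V),
    forall x, E x -> exists c : 'I_n -> R[i], x = \sum_i c i *: b i.

Definition operator_system (R : realType) (A : unital_cstar_algebra R)
    (E : set A) : Prop :=
  [/\ subspace E, forall x, E x -> E (cstar x) & E (cone A)].

Definition closed_ideal (R : realType) (B : cstar_algebra R) (J : set B) : Prop :=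
  [/\ closed J, subspace J &
      forall x y, J y -> J (cmul x y) /\ J (cmul y x)].

Definition star_morphism (R : realType) (A B : cstar_algebra R)
    (f : A -> B) : Prop :=
  [/\ linear f,
      forall x y, f (cmul x y) = cmul (f x) (f y) &
      forall x, f (cstar x) = cstar (f x)].

(* (Q, q) is the quotient of B by J, equipped with the quotient norm. *)
Definition is_quotient (R : realType) (B : cstar_algebra R) (J : set B)
    (Q : cstar_algebra R) (q : B -> Q) : Prop :=
  [/\ star_morphism q,
      forall y, exists x, q x = y,
      forall x, q x = 0 <-> J x &
      forall x, rnorm (q x) = inf [set rnorm (x - j) | j in J]].

Definition LLP (R : realType) (A : unital_cstar_algebra R) : Prop :=
  forall (B : cstar_algebra R) (J : set B) (Q : cstar_algebra R) (q : B -> Q),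
    closed_ideal J -> is_quotient J q ->
  forall phi : A -> Q, ccp_on setT phi ->
  forall E : set A, operator_system E -> fin_dim E ->
  exists psi : A -> B,
    ccp_on E psi /\ (forall x, E x -> q (psi x) = phi x).

Definition group_algebra (R : realType) (G : groupType) : Type :=
  {fsfun G -> R[i] with 0}.

Definition lin_ext (R : realType) (G : groupType) (V : lmodType R[i])
    (f : G -> V) (a : group_algebra R G) : V :=
  \sum_(g <- finsupp a) a g *: f g.

Definition max_norm (R : realType) (G : groupType) (a : group_algebra R G) : R :=
  sup [set r : R | exists (H : hilbert_space R) (rho : G -> H -> H),
         unitary_rep rho /\ r = op_norm (fun x => lin_ext (rho^~ x) a)].

(* A is the completion of C[G] for the maximal norm, u being the restriction
   to G of the canonical *-homomorphism from C[G] to A.  This determines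
   (A, u) up to a unique *-isomorphism. *)
Definition is_full_group_cstar (R : realType) (G : groupType)
    (A : unital_cstar_algebra R) (u : G -> A) : Prop :=
  [/\ u 1%g = cone A,
      forall g h, u (g * h)%g = cmul (u g) (u h),
      forall g, u (g^-1)%g = cstar (u g),
      forall a : group_algebra R G, rnorm (lin_ext u a) = max_norm a &
      dense (range (lin_ext u))].

Definition group_LLP (R : realType) (G : groupType) : Prop :=
  exists (A : unital_cstar_algebra R) (u : G -> A),
    is_full_group_cstar u /\ LLP A.

(* s is the extension of the representation sigma of G, by linearity and
   continuity, to the full group C*-algebra (A, u). *)
Definition rep_extension (R : realType) (G : groupType)
    (A : unital_cstar_algebra R) (u : G -> A) (n : nat)
    (sigma : G -> 'M[R[i]]_n) (s : A -> 'M[R[i]]_n) : Prop :=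
  [/\ linear s,
      forall x, mx_opnorm (s x) <= rnorm x &
      forall g, s (u g) = sigma g].

Definition group_RFD (R : realType) (G : groupType) : Prop :=
  exists (A : unital_cstar_algebra R) (u : G -> A),
    is_full_group_cstar u /\
    forall a : A, a <> 0 ->
      exists (n : nat) (sigma : G -> 'M[R[i]]_n) (s : A -> 'M[R[i]]_n),
        [/\ mx_unitary_rep sigma, rep_extension u sigma s & s a <> 0].

Definition asymptotic_rep (R : realType) (G : groupType) (k : nat -> nat)
    (phi : forall n, G -> 'M[R[i]]_(k n)) : Prop :=
  (forall n g, phi n g \is unitarymx) /\
  (forall g h, (fun n => mx_opnorm (phi n (g * h)%g - phi n g *m phi n h))
     @ \oo --> (0 : R)).

(* Main.v *)
Require Import Defs.
From HB Require Import structures.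
From mathcomp Require Import all_boot all_order all_algebra finmap.
From mathcomp Require Import all_classical all_reals all_analysis.
From mathcomp Require Import ring lra.

Set Implicit Arguments.
Unset Strict Implicit.
Unset Printing Implicit Defensive.

Import Order.TTheory GRing.Theory Num.Theory.
Import numFieldNormedType.Exports.

Local Open Scope classical_set_scope.
Local Open Scope ring_scope.
Local Open Scope sesquilinear_scope.

(** The values [phi n] define a unitary representation of [G] in the bounded
    sequences of matrices modulo the null ones, hence a morphism from the full
    group C*-algebra [A].  The lifting property lifts it, on the span of
    finitely many group elements, to a completely positive map into bounded
    sequences; its [n]-th coordinate is a completely positive map close to
    [phi n].  Residual finite-dimensionality then makes every completely
    positive map on finitely many group elements a limit of compressions
    [g |-> v^* pi(g) v] of finite-dimensional representations, and [v] can be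
    corrected to an isometry.  A diagonal choice over growing finite sets and
    shrinking errors ends the proof.

    Lifting.  Instead of the quotient by null sequences, the pullback
    [pb_algebra] is used: the pairs [(a, x)] such that the sequence [x]
    represents [a] up to null sequences.  It maps onto [A] with kernel the null
    sequences, and the map to be lifted is the identity of [A], which is
    trivially completely positive ([asymptotic_cp_lift]).  What has to be shown
    is that [limsup |sum_g a_g phi n g|] is at most the maximal norm of
    [sum_g a_g g] ([asymptotic_norm_le]): the ultraproduct of the spaces [C^(k n)]
    is a Hilbert space on which [G] acts by [phi].

    Positivity.  A self-adjoint matrix [X] over [A] whose images in all
    finite-dimensional representations are positive is of the form [S^* S]
    ([rfd_positive]).  Square roots of [1 - T] are limits of polynomials in a power bounded [T] ([sqrt_exists]),
    and they give an absolute value [|X| = S^2] ([abs_value]) commuting with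
    [X].  In each representation the images of [|X|] and [X] are positive with
    the same square, hence equal, and the representations separate points.

    Compressions.  The maps [g |-> v^* pi(g) v] form a convex cone.  If a
    completely positive map were far from it, a separating functional would be
    nonnegative on the cone, that is, a matrix over the group algebra positive
    in all finite-dimensional representations; by the previous step it is
    positive over [A], and so the functional is nonnegative at the given map
    ([cp_compression_approx]).  Near-minimizers of the distance replace the
    separation theorem ([cone_approx]). *)

(** * Real inequalities and complex moduli *)

Lemma le_split2 (R : realType) (a b c e : R) :
  c <= a + b -> a <= e / 2 -> b <= e / 2 -> c <= e.
Proof. lra. Qed.

Lemma le_sqr (R : realType) (x y : R) : 0 <= x -> x <= y -> x ^+ 2 <= y ^+ 2.
Proof. by move=> x0 xy; rewrite ler_pXn2r // nnegrE // (le_trans x0 xy). Qed.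

Lemma le_of_sqr_le (R : realType) (x y : R) : 0 <= x -> 0 <= y -> x ^+ 2 <= y * x -> x <= y.
Proof.
move=> x0 y0; have [->//|xn0] := eqVneq x 0.
by rewrite expr2 ler_pM2r // lt_def xn0.
Qed.

Section Modulus.
Variable R : realType.
Local Notation C := R[i].

Definition toC (r : R) : C := Complex r 0.

Definition cabs (z : C) : R := complex.Re `|z|.

Lemma toCK r : complex.Re (toC r) = r. Proof. by []. Qed.

Lemma ge0_toC (z : C) : 0 <= z -> z = toC (complex.Re z).
Proof. by case: z => a b; rewrite lecE /= => /andP[/eqP -> _]. Qed.

Lemma le_toC (a b : R) : (toC a <= toC b) = (a <= b).
Proof. by rewrite lecE /= eqxx. Qed.

Lemma lt_toC (a b : R) : (toC a < toC b) = (a < b).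
Proof. by rewrite ltcE /= eqxx. Qed.

Lemma toCD a b : toC (a + b) = toC a + toC b.
Proof. by rewrite /toC; simpc. Qed.

Lemma toCN a : toC (- a) = - toC a.
Proof. by rewrite /toC; simpc. Qed.

Lemma toCB a b : toC (a - b) = toC a - toC b.
Proof. by rewrite toCD toCN. Qed.

Lemma toCM a b : toC (a * b) = toC a * toC b.
Proof. by rewrite /toC; simpc. Qed.

Lemma toC0 : toC 0 = 0. Proof. by []. Qed.

Lemma toCX a n : toC (a ^+ n) = toC a ^+ n.
Proof. by elim: n => [|n IH]; rewrite ?expr0 // !exprS toCM IH. Qed.

Lemma toC_inj : injective toC. Proof. by move=> a b []. Qed.

Lemma conj_toC a : (toC a)^* = toC a.
Proof. by rewrite conj_Creal // complex_real. Qed.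

Lemma ReD (x y : C) : complex.Re (x + y) = complex.Re x + complex.Re y.
Proof. by case: x y => [a b] [c d]. Qed.

Lemma ReN (x : C) : complex.Re (- x) = - complex.Re x.
Proof. by case: x. Qed.

Lemma ReB (x y : C) : complex.Re (x - y) = complex.Re x - complex.Re y.
Proof. by rewrite ReD ReN. Qed.

Lemma Re_toCM a (x : C) : complex.Re (toC a * x) = a * complex.Re x.
Proof. by case: x => u v; rewrite /toC; simpc. Qed.

Lemma ReJ (x : C) : complex.Re x^* = complex.Re x.
Proof. by case: x. Qed.

Lemma Re_sum (I : Type) (r : seq I) (P : pred I) (F : I -> C) :
  complex.Re (\sum_(i <- r | P i) F i) = \sum_(i <- r | P i) complex.Re (F i).
Proof.
elim/big_rec2: _ => [|i a b _ <-]; first by [].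
by rewrite ReD.
Qed.

Lemma Re_ge0 (z : C) : 0 <= z -> 0 <= complex.Re z.
Proof. by case: z => a b; rewrite lecE /= => /andP[_]. Qed.

Lemma normE (z : C) : `|z| = toC (cabs z).
Proof. exact: ge0_toC. Qed.

Lemma cabs_ge0 z : 0 <= cabs z.
Proof. by rewrite Re_ge0. Qed.

Lemma cabs0 : cabs 0 = 0. Proof. by rewrite /cabs normr0. Qed.
Lemma cabs1 : cabs 1 = 1. Proof. by rewrite /cabs normr1. Qed.

Lemma cabsN z : cabs (- z) = cabs z. Proof. by rewrite /cabs normrN. Qed.

Lemma cabs_dist x y : cabs (x - y) = cabs (y - x).
Proof. by rewrite -cabsN opprB. Qed.

Lemma cabsM x y : cabs (x * y) = cabs x * cabs y.
Proof. by apply: toC_inj; rewrite toCM -!normE normrM. Qed.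

Lemma cabsJ x : cabs x^* = cabs x.
Proof. by apply: toC_inj; rewrite -!normE norm_conjC. Qed.

Lemma cabs_toC r : cabs (toC r) = `|r|.
Proof. by rewrite /cabs normc_def /= expr0n addr0 sqrtr_sqr. Qed.

Lemma cabs_eq0 z : (cabs z == 0) = (z == 0).
Proof. by rewrite -(inj_eq toC_inj) -normE toC0 normr_eq0. Qed.

Lemma cabsD x y : cabs (x + y) <= cabs x + cabs y.
Proof. by rewrite -le_toC toCD -!normE ler_normD. Qed.

Lemma cabs_sum (I : Type) (r : seq I) (P : pred I) (F : I -> C) :
  cabs (\sum_(i <- r | P i) F i) <= \sum_(i <- r | P i) cabs (F i).
Proof.
elim/big_rec2: _ => [|i a b _ H]; first by rewrite cabs0.
by apply: le_trans (cabsD _ _) _; rewrite lerD2l.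
Qed.

Lemma cabs_sqr z : cabs z ^+ 2 = complex.Re (z * z^*).
Proof. by apply: toC_inj; rewrite toCX -normE normCK -ge0_toC // mul_conjC_ge0. Qed.

Lemma mul_conj_toC z : z * z^* = toC (cabs z ^+ 2).
Proof. by rewrite cabs_sqr -ge0_toC // mul_conjC_ge0. Qed.

Lemma Re_le_cabs z : complex.Re z <= cabs z.
Proof. by rewrite -lecR; have := normc_ge_Re z; rewrite normE; apply: le_trans; rewrite lecR ler_norm. Qed.

Lemma absRe_le_cabs z : `|complex.Re z| <= cabs z.
Proof. by rewrite -lecR; have := normc_ge_Re z; rewrite normE. Qed.

Lemma absIm_le_cabs z : `|complex.Im z| <= cabs z.
Proof.
have -> : complex.Im z = - complex.Re ('i * z) by case: z => a b /=; rewrite mul0r mul1r sub0r opprK.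
rewrite normrN; apply: le_trans (absRe_le_cabs _) _.
by rewrite cabsM /cabs normCi /= mul1r.
Qed.

Lemma cabs_le_ReIm z : cabs z <= `|complex.Re z| + `|complex.Im z|.
Proof.
case: z => a b; have {1}-> : Complex a b = toC a + 'i * toC b.
  by rewrite -complexiE; apply/eqP; rewrite eq_complex /=; apply/andP; split; apply/eqP; ring.
apply: le_trans (cabsD _ _) _.
by rewrite cabsM !cabs_toC /cabs normCi /= mul1r.
Qed.

End Modulus.

(** * Semi-inner products *)

(** Three of them are needed: the standard one on column vectors, the one of
    a Hilbert space, and the limit of inner products along an ultrafilter. *)
Record sip (R : realType) (V : lmodType R[i]) := Sip {
  ip :> V -> V -> R[i];
  ip_linear : forall a x y z, ip (a *: x + y) z = a * ip x z + ip y z;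
  ip_conj : forall x y, ip y x = (ip x y)^*;
  ip_ge0 : forall x, 0 <= ip x x
}.

Section SipTheory.
Variables (R : realType) (V : lmodType R[i]) (B : sip V).
Local Notation C := R[i].

Definition snorm (x : V) : R := Num.sqrt (complex.Re (B x x)).

Lemma ip0l z : B 0 z = 0.
Proof. by have := ip_linear B (-1) 0 0 z; rewrite scaler0 addr0 mulN1r addNr. Qed.

Lemma ipDl x y z : B (x + y) z = B x z + B y z.
Proof. by have := ip_linear B 1 x y z; rewrite scale1r mul1r. Qed.

Lemma ipZl a x z : B (a *: x) z = a * B x z.
Proof. by have := ip_linear B a x 0 z; rewrite addr0 ip0l addr0. Qed.

Lemma ipNl x z : B (- x) z = - B x z.
Proof. by rewrite -scaleN1r ipZl mulN1r. Qed.

Lemma ipBl x y z : B (x - y) z = B x z - B y z.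
Proof. by rewrite ipDl ipNl. Qed.

Lemma ip0r z : B z 0 = 0.
Proof. by rewrite ip_conj ip0l conjC0. Qed.

Lemma ipDr x y z : B z (x + y) = B z x + B z y.
Proof. by rewrite ip_conj ipDl rmorphD /= -!ip_conj. Qed.

Lemma ipZr a x z : B z (a *: x) = a^* * B z x.
Proof. by rewrite ip_conj ipZl rmorphM /= -!ip_conj. Qed.

Lemma ipNr x z : B z (- x) = - B z x.
Proof. by rewrite -scaleN1r ipZr rmorphN rmorph1 mulN1r. Qed.

Lemma ipBr x y z : B z (x - y) = B z x - B z y.
Proof. by rewrite ipDr ipNr. Qed.

Lemma ip_suml (I : Type) (r : seq I) (P : pred I) (F : I -> V) z :
  B (\sum_(i <- r | P i) F i) z = \sum_(i <- r | P i) B (F i) z.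
Proof. by elim/big_rec2: _ => [|i a b _ <-]; rewrite ?ip0l ?ipDl. Qed.

Lemma ip_sumr (I : Type) (r : seq I) (P : pred I) (F : I -> V) z :
  B z (\sum_(i <- r | P i) F i) = \sum_(i <- r | P i) B z (F i).
Proof. by elim/big_rec2: _ => [|i a b _ <-]; rewrite ?ip0r ?ipDr. Qed.

Lemma snorm_ge0 x : 0 <= snorm x. Proof. exact: sqrtr_ge0. Qed.

Lemma snorm_sqr x : snorm x ^+ 2 = complex.Re (B x x).
Proof. by rewrite sqr_sqrtr // Re_ge0 // ip_ge0. Qed.

Lemma ip_snorm x : B x x = toC (snorm x ^+ 2).
Proof. by rewrite snorm_sqr -ge0_toC // ip_ge0. Qed.

(** Expand the square of [b x - z y], where [a, b] are the two squared norms
    and [z] the inner product: it is [b (a b - |z|^2)], which settles the case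
    [b > 0]; by symmetry only [a = b = 0] is left, where [x - z y] works. *)
Lemma cauchy_schwarz x y : cabs (B x y) <= snorm x * snorm y.
Proof.
set a := snorm x; set b := snorm y; set z := B x y.
have Byx : B y x = z^* by rewrite ip_conj.
have key (s t : C) : 0 <= s * s^* * toC (a ^+ 2) - s * t^* * z - t * s^* * z^* +
    t * t^* * toC (b ^+ 2).
  have := ip_ge0 B (s *: x - t *: y).
  rewrite ipBl !ipBr !ipZl !ipZr Byx -/z !ip_snorm -/a -/b.
  by congr (_ <= _); ring.
have kz (c : R) : z * z^* * toC c = toC (cabs z ^+ 2 * c).
  by rewrite mul_conj_toC -toCM.
have nonneg (r : R) : 0 <= toC r -> 0 <= r by rewrite -toC0 le_toC.
have Hb : 0 <= b ^+ 2 * (a ^+ 2 * b ^+ 2 - cabs z ^+ 2).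
  apply: nonneg; rewrite toCM toCB -mul_conj_toC.
  have := key (toC (b ^+ 2)) z; rewrite conj_toC toCM.
  by congr (_ <= _); ring.
have Ha : 0 <= a ^+ 2 * (a ^+ 2 * b ^+ 2 - cabs z ^+ 2).
  apply: nonneg; rewrite toCM toCB -mul_conj_toC.
  have := key z^* (toC (a ^+ 2)); rewrite conj_toC conjCK toCM.
  by congr (_ <= _); ring.
have H1 : 0 <= a ^+ 2 - cabs z ^+ 2 - cabs z ^+ 2 + cabs z ^+ 2 * b ^+ 2.
  apply: nonneg; rewrite toCD !toCB (toCM _ (b ^+ 2)) -mul_conj_toC.
  have := key 1 z; rewrite conjC1.
  by congr (_ <= _); ring.
have a0 : 0 <= a := snorm_ge0 x; have b0 : 0 <= b := snorm_ge0 y.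
have z0 := cabs_ge0 z.
have [lt|//] := ltP (a * b) (cabs z).
have {}lt : a ^+ 2 * b ^+ 2 - cabs z ^+ 2 < 0.
  by rewrite -exprMn subr_lt0 ltr_pXn2r // nnegrE mulr_ge0.
move: Hb Ha; rewrite !nmulr_lge0 // !exprn_even_le0 //= => /eqP b00 /eqP a00.
move: H1 lt; rewrite a00 b00; nra.
Qed.

Lemma snormD x y : snorm (x + y) <= snorm x + snorm y.
Proof.
rewrite -(@ler_pXn2r _ 2) // ?nnegrE ?addr_ge0 ?snorm_ge0 //.
rewrite snorm_sqr ipDl !ipDr !ReD sqrrD -!snorm_sqr.
have -> : complex.Re (B y x) = complex.Re (B x y) by rewrite ip_conj ReJ.
have := cauchy_schwarz x y; have := Re_le_cabs (B x y); lra.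
Qed.

Lemma snormZ a x : snorm (a *: x) = cabs a * snorm x.
Proof.
apply/eqP; rewrite -(@eqrXn2 _ 2) ?mulr_ge0 ?cabs_ge0 ?snorm_ge0 //.
rewrite snorm_sqr ipZl ipZr mulrA mul_conj_toC ip_snorm -toCM.
by rewrite toCK exprMn.
Qed.

Lemma snormN x : snorm (- x) = snorm x.
Proof. by rewrite -scaleN1r snormZ cabsN cabs1 mul1r. Qed.

Lemma snorm_dist x y : snorm (x - y) = snorm (y - x).
Proof. by rewrite -snormN opprB. Qed.

Lemma snorm0 : snorm 0 = 0.
Proof. by rewrite /snorm ip0l sqrtr0. Qed.

Lemma snormB x y : snorm (x - y) <= snorm x + snorm y.
Proof. by rewrite -(snormN y) snormD. Qed.

Lemma snorm_sum (I : Type) (r : seq I) (P : pred I) (F : I -> V) :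
  snorm (\sum_(i <- r | P i) F i) <= \sum_(i <- r | P i) snorm (F i).
Proof.
elim/big_rec2: _ => [|i a b _ H]; first by rewrite snorm0.
by apply: le_trans (snormD _ _) _; rewrite lerD2l.
Qed.

End SipTheory.

(** * The operator norm on matrices *)

Section L2.
Variables (R : realType).
Local Notation C := R[i].

Definition l2ip_fun n (x y : 'cV[C]_n) : C := \sum_i x i 0 * (y i 0)^*.

Definition l2ip n : sip 'cV[C]_n.
Proof.
apply: (@Sip _ _ (@l2ip_fun n)).
- move=> a x y z; rewrite /l2ip_fun mulr_sumr -big_split /=.
  by apply: eq_bigr => i _; rewrite !mxE mulrDl mulrA.
- move=> x y; rewrite /l2ip_fun rmorph_sum /=.
  by apply: eq_bigr => i _; rewrite rmorphM /= conjCK mulrC.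
- by move=> x; apply: sumr_ge0 => i _; rewrite mul_conjC_ge0.
Defined.

Lemma l2normE n (x : 'cV[C]_n) : l2norm x = snorm (l2ip n) x.
Proof.
rewrite /l2norm /snorm [l2ip _ _ _]/(l2ip_fun x x) /l2ip_fun Re_sum; congr Num.sqrt.
by apply: eq_bigr => i _; rewrite normCK.
Qed.

Lemma l2ip_adj m n (M : 'M[C]_(m, n)) x y :
  l2ip m (M *m x) y = l2ip n x (M^t* *m y).
Proof.
rewrite /= /l2ip_fun.
under eq_bigr => i _ do rewrite mxE mulr_suml.
rewrite exchange_big /=; apply: eq_bigr => j _.
rewrite mxE rmorph_sum /= mulr_sumr; apply: eq_bigr => i _.
by rewrite !mxE rmorphM /= conjCK; ring.
Qed.

Lemma adjmxK m n (M : 'M[C]_(m, n)) : M^t*^t* = M.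
Proof. by apply/matrixP => i j; rewrite !mxE conjCK. Qed.

Lemma adjmxM m n p (M : 'M[C]_(m, n)) (N : 'M[C]_(n, p)) :
  (M *m N)^t* = N^t* *m M^t*.
Proof. by rewrite trmx_mul map_mxM. Qed.

Lemma adjmxD m n (M N : 'M[C]_(m, n)) : (M + N)^t* = M^t* + N^t*.
Proof. by apply/matrixP => i j; rewrite !mxE rmorphD. Qed.

Lemma adjmxZ m n a (M : 'M[C]_(m, n)) : (a *: M)^t* = a^* *: M^t*.
Proof. by apply/matrixP => i j; rewrite !mxE rmorphM. Qed.

Lemma adjmxN m n (M : 'M[C]_(m, n)) : (- M)^t* = - M^t*.
Proof. by apply/matrixP => i j; rewrite !mxE rmorphN. Qed.

Lemma adjmxB m n (M N : 'M[C]_(m, n)) : (M - N)^t* = M^t* - N^t*.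
Proof. by rewrite adjmxD adjmxN. Qed.

Lemma adjmx1 n : (1%:M : 'M[C]_n)^t* = 1%:M.
Proof. by rewrite trmx1 map_mx1. Qed.

Lemma adjmx0 m n : (0 : 'M[C]_(m, n))^t* = 0.
Proof. by rewrite trmx0 map_mx0. Qed.

Lemma l2norm_entry n (x : 'cV[C]_n) i : cabs (x i 0) <= l2norm x.
Proof.
rewrite -(@ler_pXn2r _ 2) // ?nnegrE ?cabs_ge0 ?l2normE ?snorm_ge0 //.
rewrite snorm_sqr Re_sum (bigD1 i) //= -cabs_sqr lerDl.
by apply: sumr_ge0 => j _; rewrite Re_ge0 // mul_conjC_ge0.
Qed.

Lemma l2norm_delta n (i : 'I_n) : l2norm (delta_mx i 0 : 'cV[C]_n) = 1.
Proof.
rewrite l2normE /snorm /= /l2ip_fun (bigD1 i) //= big1 => [|j ji].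
  by rewrite !mxE !eqxx andbb mulr1n conjC1 mulr1 addr0; apply: sqrtr1.
by rewrite !mxE (negbTE ji) mul0r.
Qed.

Lemma l2norm_le_sum n (x : 'cV[C]_n) : l2norm x <= \sum_i cabs (x i 0).
Proof.
have -> : x = \sum_i x i 0 *: delta_mx i 0.
  apply/matrixP => a b; rewrite ord1 summxE (bigD1 a) //= big1 => [|j ja].
    by rewrite !mxE !eqxx mulr1 addr0.
  by rewrite !mxE eq_sym (negbTE ja) mulr0.
rewrite l2normE; apply: le_trans (snorm_sum _ _ _ _) _.
apply: ler_sum => i _; rewrite snormZ -l2normE l2norm_delta mulr1.
rewrite summxE (bigD1 i) //= big1 => [|j ja].
  by rewrite !mxE !eqxx mulr1 addr0.
by rewrite !mxE eq_sym (negbTE ja) mulr0.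
Qed.

Lemma l2norm_ge0 n (x : 'cV[C]_n) : 0 <= l2norm x.
Proof. by rewrite l2normE snorm_ge0. Qed.

Lemma l2normZ n a (x : 'cV[C]_n) : l2norm (a *: x) = cabs a * l2norm x.
Proof. by rewrite !l2normE snormZ. Qed.

Lemma l2normD n (x y : 'cV[C]_n) : l2norm (x + y) <= l2norm x + l2norm y.
Proof. by rewrite !l2normE snormD. Qed.

Lemma l2norm0 n : l2norm (0 : 'cV[C]_n) = 0.
Proof. by rewrite l2normE snorm0. Qed.

Lemma l2norm_eq0 n (x : 'cV[C]_n) : l2norm x = 0 -> x = 0.
Proof.
move=> x0; apply/matrixP => i j; rewrite ord1 mxE; apply/eqP.
by rewrite -cabs_eq0 eq_le cabs_ge0 andbT -x0 l2norm_entry.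
Qed.

Lemma l2norm_mulmx_sum n (M : 'M[C]_n) x :
  l2norm (M *m x) <= (\sum_i \sum_j cabs (M i j)) * l2norm x.
Proof.
apply: le_trans (l2norm_le_sum _) _; rewrite mulr_suml; apply: ler_sum => i _.
rewrite mxE; apply: le_trans (cabs_sum _ _ _) _.
rewrite mulr_suml; apply: ler_sum => j _.
by rewrite cabsM ler_wpM2l ?cabs_ge0 ?l2norm_entry.
Qed.

Lemma opnorm_has_sup n (M : 'M[C]_n) :
  has_sup [set l2norm (M *m x) | x in [set x : 'cV[C]_n | l2norm x <= 1]].
Proof.
split; first by exists (l2norm (M *m 0)), 0 => //=; rewrite l2norm0.
exists (\sum_i \sum_j cabs (M i j)) => _ [x /= x1 <-].
apply: le_trans (l2norm_mulmx_sum _ _) _.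
apply: ler_piMr => //.
by apply: sumr_ge0 => i _; apply: sumr_ge0 => j _; apply: cabs_ge0.
Qed.

Lemma opnorm_le n (M : 'M[C]_n) (c : R) : 0 <= c ->
  (forall x, l2norm (M *m x) <= c * l2norm x) -> mx_opnorm M <= c.
Proof.
move=> c0 H; apply: ge_sup; first exact: (opnorm_has_sup M).1.
move=> _ [x /= x1 <-]; apply: le_trans (H x) _.
exact: ler_piMr.
Qed.

Lemma opnorm_le_ball n (M : 'M[C]_n) (c : R) :
  (forall x, l2norm x <= 1 -> l2norm (M *m x) <= c) -> mx_opnorm M <= c.
Proof.
move=> H; apply: ge_sup; first exact: (opnorm_has_sup M).1.
by move=> _ [x /= x1 <-]; apply: H.
Qed.

Lemma opnorm_unit_ball n (M : 'M[C]_n) x : l2norm x <= 1 ->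
  l2norm (M *m x) <= mx_opnorm M.
Proof.
by move=> x1; apply: ub_le_sup; [exact: (opnorm_has_sup M).2|exists x].
Qed.

Lemma l2norm_mulmx n (M : 'M[C]_n) x : l2norm (M *m x) <= mx_opnorm M * l2norm x.
Proof.
have [x0|xn0] := eqVneq (l2norm x) 0.
  by rewrite (l2norm_eq0 x0) mulmx0 l2norm0 mulr0.
have x0 : 0 < l2norm x by rewrite lt_def xn0 l2norm_ge0.
have e : cabs (toC (l2norm x)^-1) = (l2norm x)^-1.
  by rewrite cabs_toC ger0_norm // invr_ge0 ltW.
have := @opnorm_unit_ball _ M (toC (l2norm x)^-1 *: x).
rewrite -scalemxAr !l2normZ e mulVf // => /(_ (lexx _)).
by rewrite mulrC ler_pdivrMr.
Qed.

Lemma opnorm_ge0 n (M : 'M[C]_n) : 0 <= mx_opnorm M.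
Proof.
apply: le_trans (@opnorm_unit_ball _ M 0 _); rewrite ?l2norm_ge0 //.
by rewrite l2norm0.
Qed.

Lemma opnormD n (M N : 'M[C]_n) : mx_opnorm (M + N) <= mx_opnorm M + mx_opnorm N.
Proof.
apply: opnorm_le => [|x]; first by rewrite addr_ge0 ?opnorm_ge0.
rewrite mulmxDl mulrDl; apply: le_trans (l2normD _ _) _.
by rewrite lerD // l2norm_mulmx.
Qed.

Lemma opnorm0 n : mx_opnorm (0 : 'M[C]_n) = 0.
Proof.
apply/eqP; rewrite eq_le opnorm_ge0 andbT; apply: opnorm_le => // x.
by rewrite mul0mx l2norm0 mul0r.
Qed.

Lemma opnormZ_le n a (M : 'M[C]_n) : mx_opnorm (a *: M) <= cabs a * mx_opnorm M.
Proof.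
apply: opnorm_le => [|x]; first by rewrite mulr_ge0 ?cabs_ge0 ?opnorm_ge0.
by rewrite -scalemxAl l2normZ -mulrA ler_wpM2l ?cabs_ge0 ?l2norm_mulmx.
Qed.

Lemma opnormZ n a (M : 'M[C]_n) : mx_opnorm (a *: M) = cabs a * mx_opnorm M.
Proof.
have [->|a0] := eqVneq a 0; first by rewrite scale0r opnorm0 cabs0 mul0r.
apply/eqP; rewrite eq_le opnormZ_le /=.
have ca : cabs a != 0 by rewrite cabs_eq0.
have := opnormZ_le a^-1 (a *: M); rewrite scalerA mulVf // scale1r => H.
have -> : mx_opnorm (a *: M) = cabs a * (cabs a^-1 * mx_opnorm (a *: M)).
  by rewrite mulrA -cabsM divff // cabs1 mul1r.
by rewrite ler_wpM2l ?cabs_ge0.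
Qed.

Lemma opnormN n (M : 'M[C]_n) : mx_opnorm (- M) = mx_opnorm M.
Proof. by rewrite -scaleN1r opnormZ cabsN cabs1 mul1r. Qed.

Lemma opnormB n (M N : 'M[C]_n) : mx_opnorm (M - N) <= mx_opnorm M + mx_opnorm N.
Proof. by rewrite -(opnormN N) opnormD. Qed.

Lemma opnorm_dist n (M N : 'M[C]_n) : mx_opnorm (M - N) = mx_opnorm (N - M).
Proof. by rewrite -opnormN opprB. Qed.

Lemma opnormM n (M N : 'M[C]_n) : mx_opnorm (M *m N) <= mx_opnorm M * mx_opnorm N.
Proof.
apply: opnorm_le => [|x]; first by rewrite mulr_ge0 ?opnorm_ge0.
rewrite -mulmxA; apply: le_trans (l2norm_mulmx _ _) _.
by rewrite -mulrA ler_wpM2l ?opnorm_ge0 ?l2norm_mulmx.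
Qed.

Lemma l2norm_sqr n (x : 'cV[C]_n) : l2norm x ^+ 2 = complex.Re (l2ip n x x).
Proof. by rewrite l2normE snorm_sqr. Qed.

Lemma Re_l2ip n (x y : 'cV[C]_n) : complex.Re (l2ip n x y) <= l2norm x * l2norm y.
Proof.
by rewrite !l2normE; apply: le_trans (cauchy_schwarz _ _ _); apply: Re_le_cabs.
Qed.

(** [|M x|^2 = <M^* M x, x>] *)
Lemma opnorm_sqr_le n (M : 'M[C]_n) : mx_opnorm M ^+ 2 <= mx_opnorm (M^t* *m M).
Proof.
set c := mx_opnorm (_ *m _); have c0 : 0 <= c := opnorm_ge0 _.
have H : mx_opnorm M <= Num.sqrt c.
  apply: opnorm_le => [|x]; first exact: sqrtr_ge0.
  rewrite -(@ler_pXn2r _ 2) // ?nnegrE ?mulr_ge0 ?sqrtr_ge0 ?l2norm_ge0 //.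
  rewrite l2norm_sqr l2ip_adj mulmxA exprMn sqr_sqrtr //.
  apply: le_trans (Re_l2ip _ _) _.
  rewrite expr2 mulrCA ler_wpM2l ?l2norm_ge0 //; exact: l2norm_mulmx.
by rewrite -(sqr_sqrtr c0); apply: le_sqr (opnorm_ge0 M) H.
Qed.

Lemma opnorm_adj_le n (M : 'M[C]_n) : mx_opnorm M <= mx_opnorm (M^t* ).
Proof.
apply: le_of_sqr_le (opnorm_ge0 _) (opnorm_ge0 _) _.
exact: le_trans (opnorm_sqr_le _) (opnormM _ _).
Qed.

Lemma opnorm_adj n (M : 'M[C]_n) : mx_opnorm (M^t* ) = mx_opnorm M.
Proof.
apply: le_anti; apply/andP; split; last exact: opnorm_adj_le.
by have := opnorm_adj_le (M^t* ); rewrite adjmxK.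
Qed.

Lemma opnorm_cstar n (M : 'M[C]_n) : mx_opnorm (M^t* *m M) = mx_opnorm M ^+ 2.
Proof.
apply/eqP; rewrite eq_le opnorm_sqr_le andbT.
by apply: le_trans (opnormM _ _) _; rewrite opnorm_adj -expr2.
Qed.

Lemma opnorm_entry n (M : 'M[C]_n) i j : cabs (M i j) <= mx_opnorm M.
Proof.
have -> : M i j = (M *m delta_mx j 0 : 'cV_n) i 0 by rewrite -colE mxE.
apply: le_trans (l2norm_entry _ _) _.
by apply: opnorm_unit_ball; rewrite l2norm_delta.
Qed.

Lemma opnorm_le_sum n (M : 'M[C]_n) : mx_opnorm M <= \sum_i \sum_j cabs (M i j).
Proof.
apply: opnorm_le; last exact: l2norm_mulmx_sum.
by apply: sumr_ge0 => i _; apply: sumr_ge0 => j _; apply: cabs_ge0.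
Qed.

Lemma opnorm_eq0 n (M : 'M[C]_n) : mx_opnorm M = 0 -> M = 0.
Proof.
move=> M0; apply/matrixP => i j; rewrite mxE; apply/eqP.
by rewrite -cabs_eq0 eq_le cabs_ge0 andbT -M0 opnorm_entry.
Qed.

Lemma opnorm1_le n : mx_opnorm (1%:M : 'M[C]_n) <= 1.
Proof. by apply: opnorm_le => // x; rewrite mul1mx mul1r. Qed.

Lemma unitarymx_adjl n (U : 'M[C]_n) : U \is unitarymx -> U^t* *m U = 1%:M.
Proof. by move=> /unitarymxP /mulmx1C. Qed.

Lemma unitary_l2ip n (U : 'M[C]_n) x y : U \is unitarymx ->
  l2ip n (U *m x) (U *m y) = l2ip n x y.
Proof. by move=> HU; rewrite l2ip_adj mulmxA unitarymx_adjl // mul1mx. Qed.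

Lemma unitary_l2norm n (U : 'M[C]_n) x : U \is unitarymx ->
  l2norm (U *m x) = l2norm x.
Proof. by move=> HU; rewrite !l2normE /snorm unitary_l2ip. Qed.

Lemma opnorm_unitary n (U : 'M[C]_n) : U \is unitarymx -> mx_opnorm U <= 1.
Proof. by move=> HU; apply: opnorm_le => // x; rewrite unitary_l2norm // mul1r. Qed.

Lemma opnorm_sum n (I : Type) (r : seq I) (P : pred I) (F : I -> 'M[C]_n) :
  mx_opnorm (\sum_(i <- r | P i) F i) <= \sum_(i <- r | P i) mx_opnorm (F i).
Proof.
elim/big_rec2: _ => [|i a b _ H]; first by rewrite opnorm0.
by apply: le_trans (opnormD _ _) _; rewrite lerD2l.
Qed.

End L2.

(** * Norms and C*-algebras *)

Section Rnorm.
Variables (R : realType) (V : normedModType R[i]).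
Implicit Types x y : V.

Lemma rnormE x : `|x| = toC (rnorm x).
Proof. exact: ge0_toC. Qed.

Lemma rnorm_ge0 x : 0 <= rnorm x.
Proof. by rewrite Re_ge0. Qed.

Lemma rnorm0 : rnorm (0 : V) = 0.
Proof. by rewrite /rnorm normr0. Qed.

Lemma rnorm_eq0 x : rnorm x = 0 -> x = 0.
Proof. by move=> x0; apply/eqP; rewrite -normr_eq0 rnormE x0 toC0. Qed.

Lemma rnormD x y : rnorm (x + y) <= rnorm x + rnorm y.
Proof. by rewrite -le_toC toCD -!rnormE ler_normD. Qed.

Lemma rnormN x : rnorm (- x) = rnorm x.
Proof. by rewrite /rnorm normrN. Qed.

Lemma rnorm_dist x y : rnorm (x - y) = rnorm (y - x).
Proof. by rewrite -rnormN opprB. Qed.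

Lemma rnormZ a x : rnorm (a *: x) = cabs a * rnorm x.
Proof. by apply: toC_inj; rewrite toCM -!rnormE normrZ -normE. Qed.

Lemma rnorm_sum (I : Type) (r : seq I) (P : pred I) (F : I -> V) :
  rnorm (\sum_(i <- r | P i) F i) <= \sum_(i <- r | P i) rnorm (F i).
Proof.
elim/big_rec2: _ => [|i a b _ H]; first by rewrite rnorm0.
by apply: le_trans (rnormD _ _) _; rewrite lerD2l.
Qed.

Lemma rnorm_le_dist x y : rnorm x <= rnorm y + rnorm (x - y).
Proof. by have := rnormD y (x - y); rewrite addrC subrK. Qed.

Lemma rnorm_small_eq0 x : (forall e, 0 < e -> rnorm x <= e) -> x = 0.
Proof.
move=> H; apply: rnorm_eq0; apply/eqP; rewrite eq_le rnorm_ge0 andbT.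
by apply/ler_addgt0Pl => e e0; rewrite addr0 H.
Qed.

End Rnorm.

Section CstarTheory.
Variables (R : realType) (A : cstar_algebra R).
Implicit Types x y z : A.

Lemma cmul0l z : cmul 0 z = 0 :> A.
Proof. by have := cmul_linearl (-1) 0 0 z; rewrite scaler0 addr0 scaleN1r addNr. Qed.

Lemma cmul0r z : cmul z 0 = 0 :> A.
Proof. by have := cmul_linearr (-1) 0 0 z; rewrite scaler0 addr0 scaleN1r addNr. Qed.

Lemma cmulDl x y z : cmul (x + y) z = cmul x z + cmul y z.
Proof. by have := cmul_linearl 1 x y z; rewrite !scale1r. Qed.

Lemma cmulDr x y z : cmul z (x + y) = cmul z x + cmul z y.
Proof. by have := cmul_linearr 1 x y z; rewrite !scale1r. Qed.

Lemma cmulZl a x z : cmul (a *: x) z = a *: cmul x z.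
Proof. by have := cmul_linearl a x 0 z; rewrite !addr0 cmul0l addr0. Qed.

Lemma cmulZr a x z : cmul z (a *: x) = a *: cmul z x.
Proof. by have := cmul_linearr a x 0 z; rewrite !addr0 cmul0r addr0. Qed.

Lemma cmulNl x z : cmul (- x) z = - cmul x z.
Proof. by rewrite -scaleN1r cmulZl scaleN1r. Qed.

Lemma cmulNr x z : cmul z (- x) = - cmul z x.
Proof. by rewrite -scaleN1r cmulZr scaleN1r. Qed.

Lemma cmulBl x y z : cmul (x - y) z = cmul x z - cmul y z.
Proof. by rewrite cmulDl cmulNl. Qed.

Lemma cmulBr x y z : cmul z (x - y) = cmul z x - cmul z y.
Proof. by rewrite cmulDr cmulNr. Qed.

Lemma cmul_suml (I : Type) (r : seq I) (P : pred I) (F : I -> A) z :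
  cmul (\sum_(i <- r | P i) F i) z = \sum_(i <- r | P i) cmul (F i) z.
Proof. by elim/big_rec2: _ => [|i a b _ <-]; rewrite ?cmul0l ?cmulDl. Qed.

Lemma cmul_sumr (I : Type) (r : seq I) (P : pred I) (F : I -> A) z :
  cmul z (\sum_(i <- r | P i) F i) = \sum_(i <- r | P i) cmul z (F i).
Proof. by elim/big_rec2: _ => [|i a b _ <-]; rewrite ?cmul0r ?cmulDr. Qed.

Lemma cstar0 : cstar 0 = 0 :> A.
Proof.
have := cstar_antilinear (-1) (0 : A) 0.
by rewrite scaler0 addr0 rmorphN rmorph1 scaleN1r addNr.
Qed.

Lemma cstarD x y : cstar (x + y) = cstar x + cstar y.
Proof. by have := cstar_antilinear 1 x y; rewrite rmorph1 !scale1r. Qed.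

Lemma cstarZ a x : cstar (a *: x) = a^* *: cstar x.
Proof. by have := cstar_antilinear a x 0; rewrite !addr0 cstar0 addr0. Qed.

Lemma cstarN x : cstar (- x) = - cstar x.
Proof. by rewrite -scaleN1r cstarZ rmorphN rmorph1 scaleN1r. Qed.

Lemma cstarB x y : cstar (x - y) = cstar x - cstar y.
Proof. by rewrite cstarD cstarN. Qed.

Lemma cstar_sum (I : Type) (r : seq I) (P : pred I) (F : I -> A) :
  cstar (\sum_(i <- r | P i) F i) = \sum_(i <- r | P i) cstar (F i).
Proof. by elim/big_rec2: _ => [|i a b _ <-]; rewrite ?cstar0 ?cstarD. Qed.

Lemma rnormM x y : rnorm (cmul x y) <= rnorm x * rnorm y.
Proof. by rewrite -le_toC toCM -!rnormE cnormM. Qed.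

Lemma rnorm_cstar x : rnorm (cmul (cstar x) x) = rnorm x ^+ 2.
Proof. by apply: toC_inj; rewrite toCX -!rnormE cstar_identity. Qed.

Lemma rnorm_star x : rnorm (cstar x) = rnorm x.
Proof.
have le y : rnorm y <= rnorm (cstar y).
  apply: le_of_sqr_le (rnorm_ge0 _) (rnorm_ge0 _) _.
  by rewrite -rnorm_cstar rnormM.
by apply/eqP; rewrite eq_le le andbT -[in leRHS](cstarK x) le.
Qed.

End CstarTheory.

Lemma cstar1 (R : realType) (A : unital_cstar_algebra R) : cstar (cone A) = cone A.
Proof. by rewrite -[LHS]cmul1x -[in RHS](cstarK (cone A)) -[in RHS](cmul1x (cstar (cone A))) cstarM cstarK. Qed.

(** * Formal sums *)

(** Convolution and involution are easier on lists of coefficients and group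
    elements than on finitely supported functions: with repetitions allowed,
    nothing has to be collected. *)
Section FormalSums.
Variables (R : realType) (G : groupType).
Local Notation C := R[i].
Local Notation fsum := (seq (C * G)).

Definition lc (V : lmodType C) (f : G -> V) (s : fsum) : V :=
  \sum_(p <- s) p.1 *: f p.2.

Definition fs_scale (c : C) (s : fsum) : fsum := [seq (c * p.1, p.2) | p <- s].
Definition fs_star (s : fsum) : fsum := [seq (p.1^*, p.2^-1%g) | p <- s].
Definition fs_mul (s t : fsum) : fsum :=
  [seq (p.1 * q.1, (p.2 * q.2)%g) | p <- s, q <- t].
Definition fs_l1 (s : fsum) : R := \sum_(p <- s) cabs p.1.

Lemma fsfun_lc (a : group_algebra R G) : exists s : fsum,
  forall (V : lmodType C) (f : G -> V), lin_ext f a = lc f s.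
Proof.
by exists [seq (a g, g) | g <- finsupp a] => V f; rewrite /lc big_map.
Qed.

Lemma lc_fsfun (s : fsum) : exists a : group_algebra R G,
  forall (V : lmodType C) (f : G -> V), lin_ext f a = lc f s.
Proof.
pose S := [fset p.2 | p in s]%fset.
pose c (g : G) : C := \sum_(p <- s | p.2 == g) p.1.
pose a : group_algebra R G := [fsfun g in S => c g | 0].
exists a => V f.
have aE g : g \in S -> a g = c g by move=> gS; rewrite /a fsfunE gS.
rewrite /lin_ext.
have -> : \sum_(g <- finsupp a) a g *: f g = \sum_(g <- S) a g *: f g.
  apply: big_fset_incl.
    by apply/fsubsetP => g; rewrite mem_finsupp /a fsfunE; case: ifP; rewrite ?eqxx.
  by move=> g _; rewrite memNfinsupp => /eqP ->; rewrite scale0r.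
transitivity (\sum_(g <- S) \sum_(p <- s | p.2 == g) p.1 *: f p.2).
  apply: eq_big_seq => g gS; rewrite aE // /c scaler_suml.
  by apply: eq_bigr => p /eqP ->.
rewrite /lc (exchange_big_dep xpredT) //=.
apply: eq_big_seq => p ps; rewrite big_mkcond (bigD1_seq p.2) ?fset_uniq //=; last first.
  by apply/imfsetP; exists p.
rewrite eqxx /= big1 ?addr0 // => g; rewrite eq_sym.
by case: eqP => //= _ _.
Qed.

Lemma lc_nil (V : lmodType C) (f : G -> V) : lc f [::] = 0.
Proof. by rewrite /lc big_nil. Qed.

Lemma lc_cons (V : lmodType C) (f : G -> V) p s : lc f (p :: s) = p.1 *: f p.2 + lc f s.
Proof. by rewrite /lc big_cons. Qed.

Lemma lc1 (V : lmodType C) (f : G -> V) g : lc f [:: (1, g)] = f g.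
Proof. by rewrite lc_cons lc_nil scale1r addr0. Qed.

Lemma lc_cat (V : lmodType C) (f : G -> V) s t : lc f (s ++ t) = lc f s + lc f t.
Proof. by rewrite /lc big_cat. Qed.

Lemma lc_scale (V : lmodType C) (f : G -> V) c s : lc f (fs_scale c s) = c *: lc f s.
Proof.
by rewrite /lc big_map scaler_sumr; apply: eq_bigr => p _; rewrite scalerA.
Qed.

Lemma lc_sub (V : lmodType C) (f : G -> V) s t : lc f (s ++ fs_scale (-1) t) = lc f s - lc f t.
Proof. by rewrite lc_cat lc_scale scaleN1r. Qed.

Lemma lc_mul (V : lmodType C) (f : G -> V) s t :
  lc f (fs_mul s t) = \sum_(p <- s) \sum_(q <- t) (p.1 * q.1) *: f (p.2 * q.2)%g.
Proof. by rewrite /lc big_allpairs_dep. Qed.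

Lemma fs_l1_ge0 s : 0 <= fs_l1 s.
Proof. by apply: sumr_ge0 => p _; apply: cabs_ge0. Qed.

Section InCstar.
Variables (A : unital_cstar_algebra R) (u : G -> A).
Hypothesis uM : forall g h, u (g * h)%g = cmul (u g) (u h).
Hypothesis uV : forall g, u (g^-1)%g = cstar (u g).

Lemma lc_cmul s t : lc u (fs_mul s t) = cmul (lc u s) (lc u t).
Proof.
rewrite lc_mul /lc cmul_suml; apply: eq_bigr => p _.
rewrite cmul_sumr; apply: eq_bigr => q _.
by rewrite cmulZl cmulZr scalerA uM.
Qed.

Lemma lc_cstar s : lc u (fs_star s) = cstar (lc u s).
Proof.
rewrite /lc big_map cstar_sum; apply: eq_bigr => p _.
by rewrite cstarZ uV.
Qed.

End InCstar.

(** * Unitary representations on Hilbert spaces *)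

Definition hsip (H : hilbert_space R) : sip H.
Proof.
apply: (@Sip _ _ (@inner R H)).
- exact: inner_linearl.
- exact: inner_conj.
- by move=> x; rewrite inner_norm exprn_ge0.
Defined.

Lemma hs_rnorm (H : hilbert_space R) (x : H) : rnorm x = snorm (hsip H) x.
Proof.
rewrite /snorm /= inner_norm rnormE -toCX toCK sqrtr_sqr ger0_norm //.
exact: rnorm_ge0.
Qed.

Section Rep.
Variables (H : hilbert_space R) (rho : G -> H -> H).
Hypothesis rhoU : unitary_rep rho.

Lemma rep_linear g : linear (rho g).
Proof. by case: rhoU => /(_ g) []. Qed.

Lemma rep_inner g x y : inner (rho g x) (rho g y) = inner x y.
Proof. by case: rhoU => /(_ g) []. Qed.

Lemma repM g h x : rho (g * h)%g x = rho g (rho h x).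
Proof. by case: rhoU. Qed.

Lemma rep0 g : rho g 0 = 0.
Proof.
have := rep_linear g (-1) 0 0.
by rewrite scaler0 addr0 scaleN1r addNr.
Qed.

Lemma repD g x y : rho g (x + y) = rho g x + rho g y.
Proof. by have := rep_linear g 1 x y; rewrite !scale1r. Qed.

Lemma repZ g a x : rho g (a *: x) = a *: rho g x.
Proof. by have := rep_linear g a x 0; rewrite !addr0 rep0 addr0. Qed.

Lemma rep_sum g (I : Type) (r : seq I) (P : pred I) (F : I -> H) :
  rho g (\sum_(i <- r | P i) F i) = \sum_(i <- r | P i) rho g (F i).
Proof. by elim/big_rec2: _ => [|i a b _ <-]; rewrite ?rep0 ?repD. Qed.

Lemma rep_rnorm g x : rnorm (rho g x) = rnorm x.
Proof. by rewrite !hs_rnorm /snorm /= rep_inner. Qed.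

Lemma rep1 x : rho 1%g x = x.
Proof.
apply/eqP; rewrite -subr_eq0; apply/eqP; apply: rnorm_eq0.
have <- : rnorm (rho 1%g (rho 1%g x - x)) = rnorm (rho 1%g x - x) by rewrite rep_rnorm.
by rewrite repD -scaleN1r repZ scaleN1r -repM mulg1 subrr rnorm0.
Qed.

Lemma rep_adj g x y : inner (rho g x) y = inner x (rho g^-1%g y).
Proof. by rewrite -(rep_inner g x) -repM mulgV rep1. Qed.

Lemma lc_rep_mul s t x :
  lc (rho^~ x) (fs_mul s t) = lc (rho^~ (lc (rho^~ x) t)) s.
Proof.
rewrite lc_mul /lc; apply: eq_bigr => p _.
rewrite rep_sum scaler_sumr; apply: eq_bigr => q _.
by rewrite repZ scalerA repM.
Qed.

Lemma lc_rep_adj s x y : inner (lc (rho^~ x) s) y = inner x (lc (rho^~ y) (fs_star s)).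
Proof.
rewrite /lc big_map -[LHS]/(hsip H _ _) -[RHS]/(hsip H _ _) ip_suml ip_sumr.
by apply: eq_bigr => p _; rewrite ipZl ipZr conjCK; congr (_ * _); apply: rep_adj.
Qed.

Lemma lc_rep_linear s : linear (fun x => lc (rho^~ x) s).
Proof.
move=> a x y; rewrite /lc scaler_sumr -big_split /=; apply: eq_bigr => p _.
by rewrite repD repZ scalerDr !scalerA mulrC.
Qed.

Lemma rnorm_lc_rep s x : rnorm (lc (rho^~ x) s) <= fs_l1 s * rnorm x.
Proof.
apply: le_trans (rnorm_sum _ _ _) _; rewrite /fs_l1 mulr_suml.
by apply: ler_sum => p _; rewrite rnormZ rep_rnorm.
Qed.

Lemma op_norm_has_sup s :
  has_sup [set rnorm (lc (rho^~ x) s) | x in [set x : H | rnorm x <= 1]].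
Proof.
split; first by exists (rnorm (lc (rho^~ 0) s)), 0 => //=; rewrite rnorm0.
exists (fs_l1 s) => _ [x /= x1 <-].
apply: le_trans (rnorm_lc_rep _ _) _.
exact: ler_piMr (fs_l1_ge0 _) x1.
Qed.

Lemma rnorm_lc_rep_op s x :
  rnorm (lc (rho^~ x) s) <= op_norm (fun x => lc (rho^~ x) s) * rnorm x.
Proof.
have L := lc_rep_linear s.
have [x0|xn0] := eqVneq (rnorm x) 0.
  rewrite (rnorm_eq0 x0) /lc big1 ?rnorm0 ?mulr0 // => p _.
  by rewrite rep0 scaler0.
have x0 : 0 < rnorm x by rewrite lt_def xn0 rnorm_ge0.
have e : cabs (toC (rnorm x)^-1) = (rnorm x)^-1.
  by rewrite cabs_toC ger0_norm // invr_ge0 ltW.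
rewrite -ler_pdivrMr // mulrC; pose y := toC (rnorm x)^-1 *: x.
apply: ub_le_sup; first exact: (op_norm_has_sup s).2.
exists y => /=; first by rewrite rnormZ e mulVf.
have := L (toC (rnorm x)^-1) x 0; rewrite addr0 -/y /= => ->.
have -> : lc (rho^~ 0) s = 0.
  by rewrite /lc big1 // => p _; rewrite rep0 scaler0.
by rewrite addr0 rnormZ e.
Qed.

End Rep.

(** * The full group C*-algebra *)

Section FullCstar.
Variables (A : unital_cstar_algebra R) (u : G -> A).
Hypothesis fullA : is_full_group_cstar u.

Lemma full_u1 : u 1%g = cone A. Proof. by case: fullA. Qed.
Lemma full_uM g h : u (g * h)%g = cmul (u g) (u h). Proof. by case: fullA. Qed.
Lemma full_uV g : u (g^-1)%g = cstar (u g). Proof. by case: fullA. Qed.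

Lemma full_rep_le (H : hilbert_space R) (rho : G -> H -> H) s x : unitary_rep rho ->
  rnorm (lc (rho^~ x) s) <= rnorm (lc u s) * rnorm x.
Proof.
move=> rhoU; apply: le_trans (rnorm_lc_rep_op rhoU s x) _.
apply: ler_wpM2r; first exact: rnorm_ge0.
have [a aE] := lc_fsfun s.
case: fullA => _ _ _ /(_ a) + _; rewrite aE => ->.
apply: ub_le_sup; last first.
  exists H, rho; split => //; congr op_norm; apply/funext => y.
  by rewrite aE.
exists (fs_l1 s) => _ [K [tau [tauU ->]]].
apply: ge_sup.
  by exists (rnorm (lin_ext (tau^~ 0) a)), 0 => //=; rewrite rnorm0.
move=> _ [y /= y1 <-]; rewrite aE.
apply: le_trans (rnorm_lc_rep tauU _ _) _.
exact: ler_piMr (fs_l1_ge0 _) y1.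
Qed.

Lemma full_norm_le s (c : R) : 0 <= c ->
  (forall (H : hilbert_space R) (rho : G -> H -> H), unitary_rep rho ->
     forall x, rnorm (lc (rho^~ x) s) <= c * rnorm x) ->
  rnorm (lc u s) <= c.
Proof.
move=> c0 Hc; have [a aE] := lc_fsfun s.
case: fullA => _ _ _ /(_ a) + _; rewrite aE => ->.
rewrite /max_norm; set S := [set r | _].
have [->|/set0P S0] := eqVneq S set0; first by rewrite sup0.
apply: ge_sup => // _ [K [tau [tauU ->]]].
apply: ge_sup.
  by exists (rnorm (lin_ext (tau^~ 0) a)), 0 => //=; rewrite rnorm0.
move=> _ [y /= y1 <-]; rewrite aE.
apply: le_trans (Hc _ _ tauU _) _.
exact: ler_piMr.
Qed.

Lemma full_dense (a : A) (e : R) : 0 < e -> exists s, rnorm (a - lc u s) < e.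
Proof.
move=> e0; case: fullA => _ _ _ _ dA.
have e0' : 0 < toC e by rewrite -toC0 lt_toC.
have [|b [ab [c _ cb]]] := dA (ball a (toC e))^° _ (open_interior _).
  exists a; apply: nbhsx_ballx => //.
have [s sE] := fsfun_lc c; exists s.
have := interior_subset ab; rewrite -ball_normE /= -cb sE.
by rewrite rnormE lt_toC.
Qed.

(** In a Hilbert space representation
    [|a_j x|^2 <= \sum_i |a_i x|^2 = <\sum_i a_i^* a_i x, x>], and such
    representations compute the norm. *)
Lemma full_lc_norm_sum_sqr k (s : 'I_k -> fsum) j :
  rnorm (lc u (s j)) ^+ 2 <= rnorm (\sum_i cmul (cstar (lc u (s i))) (lc u (s i))).
Proof.
pose t := flatten [seq fs_mul (fs_star (s i)) (s i) | i <- index_enum 'I_k].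
have tE (V : lmodType C) (f : G -> V) :
    lc f t = \sum_i lc f (fs_mul (fs_star (s i)) (s i)).
  by rewrite /t /lc big_flatten big_map.
have -> : \sum_i cmul (cstar (lc u (s i))) (lc u (s i)) = lc u t.
  rewrite tE; apply: eq_bigr => i _.
  by rewrite (lc_cmul full_uM) (lc_cstar full_uV).
set c := rnorm (lc u t); have c0 : 0 <= c by apply: rnorm_ge0.
rewrite -[leRHS]sqr_sqrtr // ler_pXn2r // ?nnegrE ?rnorm_ge0 ?sqrtr_ge0 //.
apply: full_norm_le => [|H rho rhoU x]; first exact: sqrtr_ge0.
rewrite -(@ler_pXn2r _ 2) // ?nnegrE ?mulr_ge0 ?sqrtr_ge0 ?rnorm_ge0 //.
rewrite exprMn sqr_sqrtr //.
have E i : complex.Re (inner (lc (rho^~ x) (fs_mul (fs_star (s i)) (s i))) x) =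
           rnorm (lc (rho^~ x) (s i)) ^+ 2.
  rewrite (lc_rep_mul rhoU) hs_rnorm snorm_sqr /= inner_conj ReJ.
  by rewrite -(lc_rep_adj rhoU).
have : complex.Re (inner (lc (rho^~ x) t) x) <= c * rnorm x ^+ 2.
  apply: le_trans (Re_le_cabs _) _.
  apply: le_trans (cauchy_schwarz (hsip H) _ _) _.
  rewrite -!hs_rnorm expr2 mulrA ler_wpM2r ?rnorm_ge0 //.
  exact: full_rep_le.
apply: le_trans.
rewrite tE -[inner _ _]/(hsip H _ _) ip_suml Re_sum (bigD1 j) //= E lerDl.
by apply: sumr_ge0 => i _; rewrite E exprn_ge0 // rnorm_ge0.
Qed.

End FullCstar.

End FormalSums.

(** * Completeness and diagonal sequences *)

Section SeqLimits.
Variable R : realType.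
Local Notation C := R[i].

Definition half_pow (m : nat) : R := 2^-1 ^+ m.

Lemma half_pow_gt0 m : 0 < half_pow m.
Proof. by rewrite exprn_gt0 // invr_gt0 ltr0n. Qed.

Lemma half_powS m : half_pow m.+1 + half_pow m.+1 = half_pow m.
Proof. by rewrite /half_pow exprS; field. Qed.

Lemma half_pow_small (e : R) : 0 < e -> exists m, half_pow m <= e.
Proof.
move=> e0; have : half_pow @ \oo --> (0 : R).
  by apply: cvg_expr; rewrite ger0_norm ?invr_ge0 // invf_lt1 // ltr1n.
move/cvgrPdist_le => /(_ e e0) [M _ /(_ M (leqnn _))].
rewrite /= sub0r normrN ger0_norm; first by exists M.
exact: ltW (half_pow_gt0 M).
Qed.

Lemma half_pow_le m n : (m <= n)%N -> half_pow n <= half_pow m.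
Proof.
move=> mn; apply: ler_wiXn2l => //; rewrite ?invr_ge0 //.
by rewrite invf_le1 // ler1n.
Qed.

Definition seq_conv (V : lmodType C) (N : V -> R) (x : nat -> V) (l : V) :=
  forall e, 0 < e -> exists M, forall m, (M <= m)%N -> N (x m - l) <= e.

Definition seq_cauchy (V : lmodType C) (N : V -> R) (x : nat -> V) :=
  forall e, 0 < e -> exists M, forall m, (M <= m)%N -> N (x m - x M) <= e.

Lemma complete_seq_conv (V : completeNormedModType C) (x : nat -> V) :
  seq_cauchy (@rnorm R V) x -> exists l, seq_conv (@rnorm R V) x l.
Proof.
move=> cx; have /cauchy_cvg /cvg_ex [l xl] : cauchy (x @ \oo).
  apply: cauchy_exP => e e0; have eE := ge0_toC (ltW e0).
  have {}e0 : 0 < complex.Re e by rewrite -lt_toC -eE toC0.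
  have [|M xM] := cx (complex.Re e / 2); first by rewrite divr_gt0.
  exists (x M), M => // m /= Mm.
  rewrite -ball_normE /= distrC rnormE eE lt_toC.
  by apply: le_lt_trans (xM m Mm) _; rewrite ltr_pdivrMr // ltr_pMr // ltr1n.
exists l => e e0; move/cvgrPdist_le: xl => /(_ (toC e)).
rewrite -toC0 lt_toC => /(_ e0) [M _ HM]; exists M => m /HM /=.
by rewrite rnormE le_toC rnorm_dist.
Qed.

(** A norm on [V] for which the sequences moving by at most [2^-m] at step [m]
    converge.  The prescribed rate provides explicit error bounds, with which
    limits can be built coordinatewise. *)
Record bnorm (V : lmodType C) := Bnorm {
  bn :> V -> R;
  bnD : forall x y, bn (x + y) <= bn x + bn y;
  bnZ : forall a x, bn (a *: x) = cabs a * bn x;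
  bn_eq0 : forall x, bn x = 0 -> x = 0;
  bn_complete : forall x : nat -> V,
    (forall m, bn (x m.+1 - x m) <= half_pow m) -> exists l, seq_conv bn x l
}.

Definition banach (V : lmodType C) (b : bnorm V) : Type := V.

Section BanachInstances.
Variables (V : lmodType C) (b : bnorm V).

HB.instance Definition _ := GRing.Lmodule.on (banach b).

Let norm (x : banach b) : C := toC (b x).

Let normD x y : norm (x + y) <= norm x + norm y.
Proof. by rewrite -toCD le_toC; apply: bnD. Qed.

Let normZ (a : C) x : norm (a *: x) = `|a| * norm x.
Proof. by rewrite normE -toCM /norm; congr toC; apply: bnZ. Qed.

Let norm_eq0 x : norm x = 0 -> x = 0.
Proof. by rewrite -toC0 => /toC_inj; apply: bn_eq0. Qed.

HB.instance Definition _ := Lmodule_isNormed.Build C (banach b) normD normZ norm_eq0.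

Lemma banach_rnorm (x : banach b) : rnorm x = b x. Proof. by []. Qed.

Let complete (F : set_system (banach b)) : ProperFilter F -> cauchy F -> cvg F.
Proof.
move=> FF /cauchyP Fc.
have /choice [x xF] m : exists x : banach b, F (ball x (toC (half_pow m.+1))).
  by apply: Fc; rewrite -toC0 lt_toC half_pow_gt0.
have ballP (y : banach b) e z : ball y (toC e) z -> rnorm (y - z) < e.
  by rewrite -ball_normE /= rnormE lt_toC.
have [m|l xl] := @bn_complete _ b x.
  have [z [z1 z2]] := filter_ex (filterI (xF m) (xF m.+1)).
  rewrite -banach_rnorm -[x m.+1 - x m](subrKA z).
  apply: le_trans (rnormD _ _) _.
  rewrite (rnorm_dist z) -(half_powS m) lerD //.
    apply: ltW; apply: lt_le_trans (ballP _ _ _ z2) _; exact: half_pow_le.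
  exact: ltW (ballP _ _ _ z1).
apply/cvg_ex; exists l; apply/cvgrPdist_le => e e0.
have eE := ge0_toC (ltW e0).
have {}e0 : 0 < complex.Re e by rewrite -lt_toC -eE toC0.
have e2 : 0 < complex.Re e / 2 by rewrite divr_gt0.
have [M HM] := xl _ e2; have [K HK] := half_pow_small e2.
apply: filterS (xF (maxn M K)) => z /ballP xz.
rewrite rnormE eE le_toC -[l - z](subrKA (x (maxn M K))).
apply: le_trans (rnormD _ _) _.
rewrite rnorm_dist (splitr (complex.Re e)) lerD //.
  exact: HM (leq_maxl _ _).
apply: ltW; apply: lt_le_trans xz _; apply: le_trans HK.
by apply: half_pow_le; rewrite leqW // leq_maxr.
Qed.

HB.instance Definition _ := Uniform_isComplete.Build (banach b) complete.

End BanachInstances.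

(** If for each [j] the condition [Q j n] can be met for most [n], a single
    sequence eventually meets all of them: among the [j <= n] for
    which some [x] satisfies [Q j n x], take a witness for the largest one. *)
Lemma diagonal_choice (F : set_system nat) (FF : Filter F)
    (Foo : forall N, F [set n | (N <= n)%N])
    (T : nat -> Type) (d : forall n, T n) (Q : nat -> forall n, T n -> Prop) :
  (forall j n x, Q j.+1 n x -> Q j n x) ->
  (forall j, F [set n | exists x, Q j n x]) ->
  exists x : forall n, T n, forall j, F [set n | Q j n (x n)].
Proof.
move=> Qanti HQ.
have anti i j n x : (i <= j)%N -> Q j n x -> Q i n x.
  by move=> /subnK <-; elim: (j - i)%N => // k IH /Qanti.
have ex n b : exists x : T n, forall j, (j <= b)%N -> (exists y, Q j n y) -> Q j n x.
  elim: b => [|b [x IH]].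
    have [[y Qy]|nQ] := pselect (exists y, Q 0%N n y).
      by exists y => j; rewrite leqn0 => /eqP ->.
    by exists (d n) => j; rewrite leqn0 => /eqP -> /nQ.
  have [[y Qy]|nQ] := pselect (exists y, Q b.+1 n y).
    by exists y => j jb _; apply: anti Qy.
  exists x => j; rewrite leq_eqVlt => /orP[/eqP -> /nQ //|]; exact: IH.
exists (fun n => sval (cid (ex n n))) => j.
apply: filterS2 (Foo j) (HQ j) => n jn Qn.
exact: (svalP (cid (ex n n))).
Qed.

End SeqLimits.

(** * Subspaces and products as vector spaces *)

Section Subspaces.
Variables (R : realType) (V : lmodType R[i]).

Record linsub := Linsub { ls_set :> V -> Prop; ls_subspace : Defs.subspace ls_set }.

Definition ls_pred (S : linsub) : {pred V} := fun x => `[< S x >].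

Lemma ls_predP (S : linsub) x : reflect (S x) (x \in ls_pred S).
Proof. exact: asboolP. Qed.

Lemma ls_pred_closed (S : linsub) : GRing.submod_closed (ls_pred S).
Proof.
case: S => S [S0 SD]; split; first exact/ls_predP.
by move=> a x y /ls_predP Sx /ls_predP Sy; apply/ls_predP/SD.
Qed.

HB.instance Definition _ (S : linsub) :=
  GRing.isSubmodClosed.Build R[i] V (ls_pred S) (GRing.submod_closed_semi (ls_pred_closed S)).

Record subsp (S : linsub) := Subsp { sub_val : V; sub_valP : sub_val \in ls_pred S }.

HB.instance Definition _ (S : linsub) := [isSub for @sub_val S].
HB.instance Definition _ (S : linsub) := [Choice of subsp S by <:].
HB.instance Definition _ (S : linsub) := [SubChoice_isSubLmodule of subsp S by <:].

Definition to_sub (S : linsub) x (Sx : S x) : subsp S :=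
  Subsp (introT (ls_predP S x) Sx).

Lemma in_sub (S : linsub) (x : subsp S) : S (sub_val x).
Proof. exact/ls_predP/sub_valP. Qed.

Lemma sub_ext (S : linsub) (x y : subsp S) : sub_val x = sub_val y -> x = y.
Proof. exact: val_inj. Qed.

Lemma sub_valD (S : linsub) (x y : subsp S) : sub_val (x + y) = sub_val x + sub_val y.
Proof. exact: (raddfD (val : subsp S -> V)). Qed.

Lemma sub_valZ (S : linsub) a (x : subsp S) : sub_val (a *: x) = a *: sub_val x.
Proof. exact: (linearZZ (val : subsp S -> V)). Qed.

Lemma sub_valN (S : linsub) (x : subsp S) : sub_val (- x) = - sub_val x.
Proof. exact: (raddfN (val : subsp S -> V)). Qed.

Lemma sub_valB (S : linsub) (x y : subsp S) : sub_val (x - y) = sub_val x - sub_val y.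
Proof. by rewrite sub_valD sub_valN. Qed.

Lemma sub_val0 (S : linsub) : sub_val (0 : subsp S) = 0.
Proof. exact: (raddf0 (val : subsp S -> V)). Qed.

End Subspaces.

Definition dseq (R : realType) (V : nat -> lmodType R[i]) : Type := forall n, V n.

Section Products.
Variables (R : realType) (V : nat -> lmodType R[i]).

HB.instance Definition _ := gen_eqMixin (dseq V).
HB.instance Definition _ := gen_choiceMixin (dseq V).

Let add (x y : dseq V) : dseq V := fun n => x n + y n.
Let opp (x : dseq V) : dseq V := fun n => - x n.
Let scale (a : R[i]) (x : dseq V) : dseq V := fun n => a *: x n.
Let zero : dseq V := fun n => 0.

Let ext (x y : dseq V) : (forall n, x n = y n) -> x = y.
Proof. exact: functional_extensionality_dep. Qed.

Let addA : associative add.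
Proof. by move=> x y z; apply: ext => n; apply: addrA. Qed.
Let addC : commutative add.
Proof. by move=> x y; apply: ext => n; apply: addrC. Qed.
Let add0 : left_id zero add.
Proof. by move=> x; apply: ext => n; apply: add0r. Qed.
Let addN : left_inverse zero opp add.
Proof. by move=> x; apply: ext => n; apply: addNr. Qed.

HB.instance Definition _ := GRing.isZmodule.Build (dseq V) addA addC add0 addN.

Let scaleA a b x : scale a (scale b x) = scale (a * b) x.
Proof. by apply: ext => n; apply: scalerA. Qed.
Let scale1 : left_id 1 scale.
Proof. by move=> x; apply: ext => n; apply: scale1r. Qed.
Let scaleDr : right_distributive scale +%R.
Proof. by move=> a x y; apply: ext => n; apply: scalerDr. Qed.
Let scaleDl x : {morph scale^~ x : a b / a + b}.
Proof. by move=> a b; apply: ext => n; apply: scalerDl. Qed.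

HB.instance Definition _ :=
  GRing.Zmodule_isLmodule.Build R[i] (dseq V) scaleA scale1 scaleDr scaleDl.

Lemma dseqD (x y : dseq V) n : (x + y) n = x n + y n. Proof. by []. Qed.
Lemma dseqZ a (x : dseq V) n : (a *: x) n = a *: x n. Proof. by []. Qed.
Lemma dseq0 n : (0 : dseq V) n = 0. Proof. by []. Qed.

End Products.

(** * Limits along an ultrafilter *)

Section Ultralimits.
Variables (R : realType) (U : set_system nat).
Context {UU : UltraFilter U}.
Local Notation C := R[i].

Definition ucv (f : nat -> C) (l : C) :=
  forall e, 0 < e -> U [set n | cabs (f n - l) <= e].

Lemma ucv_unique f l m : ucv f l -> ucv f m -> l = m.
Proof.
move=> fl fm; apply/eqP; rewrite -subr_eq0 -cabs_eq0 eq_le cabs_ge0 andbT.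
apply/ler_addgt0Pl => e e0; rewrite addr0.
have e2 : 0 < e / 2 by rewrite divr_gt0.
have [n [/= n1 n2]] := filter_ex (filterI (fl _ e2) (fm _ e2)).
rewrite -[l - m](subrKA (f n)) (splitr e); apply: le_trans (cabsD _ _) _.
by rewrite lerD // cabs_dist.
Qed.

Lemma ucvD f g l m : ucv f l -> ucv g m -> ucv (fun n => f n + g n) (l + m).
Proof.
move=> fl gm e e0; have e2 : 0 < e / 2 by rewrite divr_gt0.
apply: filterS2 (fl _ e2) (gm _ e2) => n /= H1 H2.
rewrite opprD addrACA (splitr e); apply: le_trans (cabsD _ _) _.
exact: lerD.
Qed.

Lemma ucvZ a f l : ucv f l -> ucv (fun n => a * f n) (a * l).
Proof.
move=> fl e e0; have a1 : 0 < cabs a + 1 by rewrite ltr_wpDl // cabs_ge0.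
apply: filterS (fl (e / (cabs a + 1)) _); last by rewrite divr_gt0.
move=> n /=; rewrite -mulrBr cabsM ler_pdivlMr // => H.
apply: le_trans H; rewrite mulrC ler_wpM2l ?cabs_ge0 //.
by rewrite lerDl.
Qed.

Lemma ucvJ f l : ucv f l -> ucv (fun n => (f n)^*) l^*.
Proof.
move=> fl e e0; apply: filterS (fl _ e0) => n /=.
by rewrite -rmorphB /= cabsJ.
Qed.

Lemma ucv_real (f : nat -> R) (l : R) : f @ U --> l -> 
  forall e, 0 < e -> U [set n | `|f n - l| <= e].
Proof.
move=> /cvgrPdist_le fl e e0; have := fl e e0.
by apply: filterS => n /=; rewrite distrC.
Qed.

Lemma bounded_ultra_cvg (f : nat -> R) (c : R) : (forall n, `|f n| <= c) ->
  exists l : R, f @ U --> l.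
Proof.
move=> fc; have := @segment_compact R (- c) c.
rewrite compact_ultra => /(_ (f @ U) _) [].
- split; first exact: fmap_proper_filter.
  move=> G GF fUG; apply/seteqP; split => // A GA.
  have [//|nA] := in_ultra_setVsetC (f @^-1` A) UU.
  have [x [Ax nAx]] := filter_ex (filterI GA (fUG (~` A) nA)).
  by [].
- by apply: (@filterE _ U) => n; rewrite /preimage /= in_itv /= -ler_norml.
- by move=> l [_ fl]; exists l.
Qed.

Lemma bounded_ucv (f : nat -> C) (c : R) : (forall n, cabs (f n) <= c) ->
  exists l, ucv f l.
Proof.
move=> fc.
have [|a Ha] := @bounded_ultra_cvg (fun n => complex.Re (f n)) c.
  by move=> n; apply: le_trans (absRe_le_cabs _) _.
have [|b Hb] := @bounded_ultra_cvg (fun n => complex.Im (f n)) c.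
  by move=> n; apply: le_trans (absIm_le_cabs _) _.
exists (Complex a b) => e e0; have e2 : 0 < e / 2 by rewrite divr_gt0.
apply: filterS2 (ucv_real Ha e2) (ucv_real Hb e2) => n /=.
case: (f n) => x y /= H1 H2; rewrite (splitr e).
by apply: le_trans (cabs_le_ReIm _) _; rewrite lerD.
Qed.

Definition ulim (f : nat -> C) : C := xget 0 [set l | ucv f l].

Lemma ulimP f : (exists l, ucv f l) -> ucv f (ulim f).
Proof. exact: (@xgetPex _ 0 [set l | ucv f l]). Qed.

Lemma ulimE f l : ucv f l -> ulim f = l.
Proof.
move=> fl; have H : ucv f (ulim f) by apply: ulimP; exists l.
exact: ucv_unique H fl.
Qed.

Lemma ucv_ge0 f l : ucv f l -> (forall n, 0 <= f n) -> 0 <= l.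
Proof.
move=> fl f0.
have Hre n e : cabs (f n - l) <= e -> - e <= complex.Re l.
  move=> H; have := le_trans (absRe_le_cabs _) H; rewrite ReB ler_norml => /andP[_].
  have := Re_ge0 (f0 n); lra.
have Him n e : cabs (f n - l) <= e -> `|complex.Im l| <= e.
  move=> H; have := le_trans (absIm_le_cabs _) H.
  by have := ge0_toC (f0 n); case: (f n) => x y -> ; case: (l) => a b /=; rewrite sub0r normrN.
rewrite lecE /=; apply/andP; split.
  rewrite -normr_eq0 eq_le normr_ge0 andbT; apply/ler_addgt0Pl => e e0.
  rewrite addr0; have [n /= Hn] := filter_ex (fl e e0); exact: Him Hn.
apply/ler_addgt0Pl => e e0; rewrite -lerBlDl sub0r.
have [n /= Hn] := filter_ex (fl e e0); exact: Hre Hn.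
Qed.

End Ultralimits.

(** * The ultraproduct Hilbert space *)

Section Ultraproduct.
Variables (R : realType) (k : nat -> nat) (U : set_system nat).
Context {UU : UltraFilter U}.
Hypothesis Uoo : forall N, U [set n | (N <= n)%N].
Local Notation C := R[i].

Local Notation vecs := (dseq (fun n => 'cV[C]_(k n))).

Definition l2_bounded : set vecs := [set x | exists c, forall n, l2norm (x n) <= c].

Lemma l2_bounded_subspace : Defs.subspace l2_bounded.
Proof.
split; first by exists 0 => n; rewrite dseq0 l2norm0.
move=> a x y [c xc] [d yd]; exists (cabs a * c + d) => n.
rewrite dseqD dseqZ; apply: le_trans (l2normD _ _) _.
by rewrite lerD // l2normZ ler_wpM2l ?cabs_ge0.
Qed.

Definition bvec := subsp (Linsub l2_bounded_subspace).

Definition bfun (x : bvec) : forall n, 'cV[C]_(k n) := sub_val x.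
Arguments bfun : simpl never.

Lemma bfun_bounded x : exists c, forall n, l2norm (bfun x n) <= c.
Proof. exact: in_sub x. Qed.

Definition mkb (x : forall n, 'cV[C]_(k n)) (xb : exists c, forall n, l2norm (x n) <= c)
  : bvec := @to_sub _ _ (Linsub l2_bounded_subspace) x xb.

Lemma bfunD x y n : bfun (x + y) n = bfun x n + bfun y n.
Proof. by rewrite /bfun sub_valD. Qed.

Lemma bfunZ a x n : bfun (a *: x) n = a *: bfun x n.
Proof. by rewrite /bfun sub_valZ. Qed.

Lemma bfunB x y n : bfun (x - y) n = bfun x n - bfun y n.
Proof. by rewrite /bfun sub_valB. Qed.

Definition uip_seq (x y : bvec) n : C := l2ip R (k n) (bfun x n) (bfun y n).

Lemma uip_ucv x y : ucv U (uip_seq x y) (ulim U (uip_seq x y)).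
Proof.
apply: ulimP; have [c xc] := bfun_bounded x; have [d yd] := bfun_bounded y.
apply: (@bounded_ucv _ _ _ _ (c * d)) => n.
apply: le_trans (cauchy_schwarz _ _ _) _; rewrite -!l2normE.
by apply: ler_pM => //; apply: l2norm_ge0.
Qed.

Definition uip : sip bvec.
Proof.
apply: (@Sip _ _ (fun x y => ulim U (uip_seq x y))).
- move=> a x y z; apply: ulimE.
  have -> : uip_seq (a *: x + y) z = fun n => a * uip_seq x z n + uip_seq y z n.
    by apply/funext => n; rewrite /uip_seq -ipZl -ipDl bfunD bfunZ.
  exact: ucvD (ucvZ a (uip_ucv x z)) (uip_ucv y z).
- move=> x y; apply: ulimE.
  have -> : uip_seq y x = fun n => (uip_seq x y n)^*.
    by apply/funext => n; rewrite /uip_seq -ip_conj.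
  exact: ucvJ (uip_ucv x y).
- by move=> x; apply: ucv_ge0 (uip_ucv x x) _ => n; apply: ip_ge0.
Defined.

Lemma uip_limit x y : ucv U (uip_seq x y) (uip x y).
Proof. exact: uip_ucv. Qed.

Lemma usnorm_le x c : 0 <= c -> U [set n | l2norm (bfun x n) <= c] ->
  snorm uip x <= c.
Proof.
move=> c0 Ux; rewrite -(@ler_pXn2r _ 2) // ?nnegrE ?snorm_ge0 // snorm_sqr.
apply/ler_addgt0Pl => e e0.
have [n [/= H1 H2]] := filter_ex (filterI Ux (uip_limit x x e0)).
have := le_trans (absRe_le_cabs _) H2; rewrite ReB ler_norml /uip_seq -l2norm_sqr.
have : l2norm (bfun x n) ^+ 2 <= c ^+ 2 by rewrite ler_pXn2r // ?nnegrE ?l2norm_ge0.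
lra.
Qed.

Lemma usnorm_ge x c : 0 <= c -> U [set n | c <= l2norm (bfun x n)] ->
  c <= snorm uip x.
Proof.
move=> c0 Ux; rewrite -(@ler_pXn2r _ 2) // ?nnegrE ?snorm_ge0 // snorm_sqr.
apply/ler_addgt0Pl => e e0.
have [n [/= H1 H2]] := filter_ex (filterI Ux (uip_limit x x e0)).
have := le_trans (absRe_le_cabs _) H2; rewrite ReB ler_norml /uip_seq -l2norm_sqr.
have : c ^+ 2 <= l2norm (bfun x n) ^+ 2 by rewrite ler_pXn2r // ?nnegrE ?l2norm_ge0.
lra.
Qed.

Lemma usnorm_lt x c : snorm uip x < c -> U [set n | l2norm (bfun x n) < c].
Proof.
move=> xc; have [//|nU] := in_ultra_setVsetC [set n | l2norm (bfun x n) < c] UU.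
have c0 : 0 <= c by apply: ltW; apply: le_lt_trans xc; apply: snorm_ge0.
have := @usnorm_ge x c c0; rewrite leNgt xc => H.
suff: false by []. apply: H.
by apply: filterS nU => n /=; rewrite leNgt => /negP.
Qed.

(** The quotient of the bounded sequences by the null ones is realized as the
    range of [x |-> <x, .>], which has exactly the null sequences as kernel. *)
Definition functionals : set (bvec -> C) := [set f | exists x, f = uip x].

Lemma functionals_subspace : @Defs.subspace R (bvec -> C) functionals.
Proof.
split; first by exists 0; apply/funext => y; rewrite ip0l.
move=> a f g [x ->] [y ->]; exists (a *: x + y); apply/funext => z.
by rewrite ip_linear.
Qed.

Definition ucls_space := subsp (Linsub functionals_subspace).

Definition ucls (x : bvec) : ucls_space :=
  @to_sub _ _ (Linsub functionals_subspace) (uip x) (ex_intro _ x erefl).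

Definition urep (f : ucls_space) : bvec := sval (cid (in_sub f)).

Lemma urepK f : ucls (urep f) = f.
Proof. exact/sub_ext/esym/(svalP (cid (in_sub f))). Qed.

Lemma ucls_eq x y z : ucls x = ucls y -> uip x z = uip y z.
Proof. exact: (congr1 (fun f => sub_val f z)). Qed.

Lemma ucls_linear a x y : ucls (a *: x + y) = a *: ucls x + ucls y.
Proof.
apply: sub_ext; rewrite sub_valD sub_valZ.
by apply/funext => z; apply: ip_linear.
Qed.

Lemma uclsD x y : ucls (x + y) = ucls x + ucls y.
Proof. by have := ucls_linear 1 x y; rewrite !scale1r. Qed.

Lemma uclsB x y : ucls (x - y) = ucls x - ucls y.
Proof. by have := ucls_linear (-1) y x; rewrite !scaleN1r !(addrC (- _)). Qed.

Lemma uip_urep x y : uip (urep (ucls x)) (urep (ucls y)) = uip x y.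
Proof.
rewrite (ucls_eq _ (urepK (ucls x))) ip_conj (ucls_eq _ (urepK (ucls y))).
by rewrite -ip_conj.
Qed.

Definition unorm (f : ucls_space) : R := snorm uip (urep f).

Lemma unorm_ucls x : unorm (ucls x) = snorm uip x.
Proof. by rewrite /unorm /snorm uip_urep. Qed.

Lemma unormD f g : unorm (f + g) <= unorm f + unorm g.
Proof. by rewrite -{1}(urepK f) -{1}(urepK g) -uclsD unorm_ucls snormD. Qed.

Lemma unormZ a f : unorm (a *: f) = cabs a * unorm f.
Proof.
have -> : a *: f = ucls (a *: urep f).
  have := ucls_linear a (urep f) 0; rewrite addr0 urepK => ->.
  suff -> : ucls 0 = 0 by rewrite addr0.
  by have := uclsB 0 0; rewrite !subrr.
by rewrite unorm_ucls snormZ.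
Qed.

Lemma unorm_eq0 f : unorm f = 0 -> f = 0.
Proof.
move=> f0; rewrite -(urepK f); apply: sub_ext; rewrite sub_val0.
apply/funext => y; apply/eqP; rewrite -cabs_eq0 eq_le cabs_ge0 andbT.
by apply: le_trans (cauchy_schwarz uip (urep f) y) _; rewrite -/(unorm f) f0 mul0r.
Qed.

(** Given sequences [x_m] with [|x_{m+1} - x_m| <= 2^-m] in the limit, choose
    for each [n] a vector close to the first few of the [x_m n]. *)
Lemma unorm_complete (f : nat -> ucls_space) :
  (forall m, unorm (f m.+1 - f m) <= half_pow R m) -> exists l, seq_conv unorm f l.
Proof.
move=> Hf; pose x m := urep (f m).
have close m : U [set n | l2norm (bfun (x m.+1) n - bfun (x m) n) <= 2 * half_pow R m].
  have : snorm uip (x m.+1 - x m) < 2 * half_pow R m.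
    rewrite -unorm_ucls uclsB !urepK; apply: le_lt_trans (Hf m) _.
    by rewrite ltr_pMl ?half_pow_gt0 // ltr1n.
  by move/usnorm_lt; apply: filterS => n /= /ltW; rewrite bfunB.
pose Q j n (y : 'cV[C]_(k n)) :=
  forall i, (i <= j)%N -> l2norm (y - bfun (x i) n) <= 4 * half_pow R i.
have [||y Hy] := diagonal_choice _ Uoo (fun n => 0 : 'cV[C]_(k n)) (Q := Q).
- by move=> j n y Hy i ij; apply: Hy; rewrite leqW.
- elim=> [|j IH].
    apply: filterE => n; exists (bfun (x 0%N) n) => i; rewrite leqn0 => /eqP ->.
    by rewrite subrr l2norm0 mulr_ge0 // ltW // half_pow_gt0.
  have : U [set n | forall i, (i <= j)%N ->
      l2norm (bfun (x j.+1) n - bfun (x i) n) <= 4 * half_pow R i - 4 * half_pow R j.+1].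
    elim: j {IH} => [|j IH].
      apply: filterS (close 0%N) => n /= H i; rewrite leqn0 => /eqP ->.
      have := half_powS R 0; move: H; lra.
    apply: filterS2 IH (close j.+1) => n /= H1 H2 i; rewrite leq_eqVlt => /orP[/eqP ->|].
      have := half_powS R j.+1; move: H2; lra.
    move=> /H1 {H1} ij.
    have := l2normD (bfun (x j.+2) n - bfun (x j.+1) n) (bfun (x j.+1) n - bfun (x i) n).
    rewrite subrKA; have := half_powS R j.+1; move: H2 ij; lra.
  apply: filterS => n Hn; exists (bfun (x j.+1) n) => i.
  rewrite leq_eqVlt => /orP[/eqP ->|/Hn]; last by have := half_pow_gt0 R j.+1; lra.
  by rewrite subrr l2norm0 mulr_ge0 // ltW // half_pow_gt0.
have [c xc] := bfun_bounded (x 0%N).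
pose z n := if l2norm (y n) <= c + 4 then y n else 0.
have zb : exists d, forall n, l2norm (z n) <= d.
  exists (c + 4) => n; rewrite /z; case: ifP => // _; rewrite l2norm0.
  by rewrite addr_ge0 //; apply: le_trans (xc 0%N); apply: l2norm_ge0.
have zy : U [set n | z n = y n].
  apply: filterS (Hy 0%N) => n /= /(_ 0%N (leqnn _)) H.
  rewrite /z ifT //; have := l2normD (y n - bfun (x 0%N) n) (bfun (x 0%N) n).
  have := xc n; move: H; rewrite subrK {1}/half_pow expr0; lra.
exists (ucls (mkb zb)) => e e0.
have [M HM] := half_pow_small (divr_gt0 e0 (ltr0n R 4)); exists M => m Mm.
rewrite -(urepK (f m)) -uclsB unorm_ucls; apply: usnorm_le; first exact: ltW.
apply: filterS2 (Hy m) zy => n /= /(_ m (leqnn _)) H zn.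
have E : bfun (mkb zb) n = y n := zn.
rewrite bfunB E l2normE snorm_dist -l2normE.
apply: le_trans H _; rewrite mulrC -ler_pdivlMr //.
by apply: le_trans HM; apply: half_pow_le.
Qed.

Definition ubnorm : bnorm ucls_space := Bnorm unormD unormZ unorm_eq0 unorm_complete.

Definition uspace : hilbert_space R.
Proof.
apply: (@HilbertSpace R (banach ubnorm) (fun f g => uip (urep f) (urep g))).
- move=> a f g h; rewrite -ip_linear.
  have -> : a *: f + g = ucls (a *: urep f + urep g) by rewrite ucls_linear !urepK.
  exact: (ucls_eq _ (urepK _)).
- by move=> f g; rewrite ip_conj.
- by move=> f; rewrite ip_snorm rnormE -toCX.
Defined.

End Ultraproduct.

(** * Asymptotic representations are dominated by the maximal norm *)

Section NormLimsup.
Variables (R : realType) (G : groupType) (k : nat -> nat).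
Variable phi : forall n, G -> 'M[R[i]]_(k n).
Arguments phi : clear implicits.
Hypothesis phi_asymp : asymptotic_rep phi.
Local Notation C := R[i].

Lemma phi_unitary n g : phi n g \is unitarymx.
Proof. by case: phi_asymp. Qed.

Lemma phi_asympM g h (e : R) : 0 < e ->
  exists N, forall n, (N <= n)%N ->
    mx_opnorm (phi n (g * h)%g - phi n g *m phi n h) <= e.
Proof.
move=> e0; case: phi_asymp => _ /(_ g h) /cvgrPdist_le /(_ e e0) [N _ HN].
by exists N => n /HN /=; rewrite sub0r normrN ger0_norm ?opnorm_ge0.
Qed.

Section WithUltrafilter.
Variable U : set_system nat.
Context {UU : UltraFilter U}.
Hypothesis Uoo : forall N, U [set n | (N <= n)%N].
Local Notation bvec := (bvec R k).
Local Notation ucls := (@ucls R k U UU).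
Local Notation urep := (@urep R k U UU).
Local Notation uip := (@uip R k U UU).

Lemma mact_bounded (M : forall n, 'M[C]_(k n)) (x : bvec) :
  (exists c, forall n, mx_opnorm (M n) <= c) ->
  exists c, forall n, l2norm (M n *m bfun x n) <= c.
Proof.
move=> [d Md]; have [c xc] := bfun_bounded x; exists (d * c) => n.
apply: le_trans (l2norm_mulmx _ _) _.
by apply: ler_pM => //; rewrite ?opnorm_ge0 ?l2norm_ge0.
Qed.

Definition mact (M : forall n, 'M[C]_(k n))
  (Mb : exists c, forall n, mx_opnorm (M n) <= c) (x : bvec) : bvec :=
  mkb (mact_bounded x Mb).

Lemma bfun_mact M Mb x n : bfun (@mact M Mb x) n = M n *m bfun x n.
Proof. by []. Qed.

Lemma bvec_ext (x y : bvec) : (forall n, bfun x n = bfun y n) -> x = y.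
Proof. by move=> H; apply: sub_ext; apply: functional_extensionality_dep. Qed.

Lemma ucls_near (x y : bvec) :
  (forall e, 0 < e -> U [set n | l2norm (bfun x n - bfun y n) <= e]) ->
  ucls x = ucls y.
Proof.
move=> H; apply/eqP; rewrite -subr_eq0 -uclsB; apply/eqP; apply: unorm_eq0.
rewrite unorm_ucls; apply/eqP; rewrite eq_le snorm_ge0 andbT.
apply/ler_addgt0Pl => e e0; rewrite addr0; apply: usnorm_le; first exact: ltW.
by apply: filterS (H e e0) => n; rewrite /mkset bfunB.
Qed.

Lemma uip_ext (x y x' y' : bvec) :
  (forall n, l2ip R (k n) (bfun x n) (bfun y n) =
             l2ip R (k n) (bfun x' n) (bfun y' n)) ->
  uip x y = uip x' y'.
Proof.
move=> H; rewrite -[LHS]/(ulim U (uip_seq x y)) -[RHS]/(ulim U (uip_seq x' y')).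
by congr ulim; apply/funext => n; apply: H.
Qed.

Lemma adj_bounded (M : forall n, 'M[C]_(k n)) :
  (exists c, forall n, mx_opnorm (M n) <= c) ->
  exists c, forall n, mx_opnorm ((M n)^t* ) <= c.
Proof. by move=> [c Mc]; exists c => n; rewrite opnorm_adj. Qed.

Lemma ucls_mact_congr M Mb x y : ucls x = ucls y ->
  ucls (@mact M Mb x) = ucls (@mact M Mb y).
Proof.
move=> xy; apply: sub_ext; apply/funext => z.
have E w : uip (mact Mb w) z = uip w (mact (adj_bounded Mb) z).
  by apply: uip_ext => n; rewrite !bfun_mact l2ip_adj.
by rewrite -[LHS]/(uip _ z) -[RHS]/(uip _ z) !E; apply: ucls_eq.
Qed.

Lemma phi_bounded g : exists c, forall n, mx_opnorm (phi n g) <= c.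
Proof. by exists 1 => n; rewrite opnorm_unitary // phi_unitary. Qed.

Local Notation H := (@uspace R k U UU Uoo).

(** This is multiplicative because [phi] is so up to a null sequence, which
    vanishes in the ultraproduct. *)
Definition urho (g : G) (f : H) : H := ucls (mact (phi_bounded g) (urep f)).

Lemma urho_ucls g x : urho g (ucls x) = ucls (mact (phi_bounded g) x).
Proof. exact/ucls_mact_congr/urepK. Qed.

Lemma uinner x y : inner (ucls x : H) (ucls y) = uip x y.
Proof. exact: uip_urep. Qed.

Lemma ucls_surj (f : H) : exists x, f = ucls x.
Proof. by exists (urep f); rewrite urepK. Qed.

Lemma ucls_lin a x y : (ucls (a *: x + y) : H) = a *: (ucls x : H) + ucls y.
Proof. exact: ucls_linear. Qed.

Lemma urho_unitary : unitary_rep urho.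
Proof.
split=> [g|g h f].
  split.
  - move=> a f f'; have [x ->] := ucls_surj f; have [y ->] := ucls_surj f'.
    rewrite -ucls_lin !urho_ucls -ucls_lin; congr ucls; apply: bvec_ext => n.
    by rewrite bfunD bfunZ !bfun_mact bfunD bfunZ mulmxDr scalemxAr.
  - move=> f f'; have [x ->] := ucls_surj f; have [y ->] := ucls_surj f'.
    rewrite !urho_ucls !uinner; apply: uip_ext => n.
    by rewrite !bfun_mact unitary_l2ip // phi_unitary.
  - move=> f; have [x ->] := ucls_surj f.
    exists (ucls (mact (adj_bounded (phi_bounded g)) x)).
    rewrite urho_ucls; congr ucls; apply: bvec_ext => n.
    by rewrite !bfun_mact mulmxA (unitarymxP _) ?mul1mx // phi_unitary.
have [x ->] := ucls_surj f; rewrite !urho_ucls; apply: ucls_near => e e0.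
have [c xc] := bfun_bounded x.
have c0 : 0 <= c by apply: le_trans (xc 0%N); apply: l2norm_ge0.
have c1 : 0 < c + 1 by rewrite ltr_wpDl.
have [N HN] := phi_asympM g h (divr_gt0 e0 c1).
apply: filterS (Uoo N) => n /HN {}HN.
rewrite /mkset !bfun_mact mulmxA -mulmxBl; apply: le_trans (l2norm_mulmx _ _) _.
apply: (@le_trans _ _ (e / (c + 1) * (c + 1))); last by rewrite divfK // gt_eqF.
apply: ler_pM; rewrite ?opnorm_ge0 ?l2norm_ge0 //.
by apply: le_trans (xc n) _; rewrite lerDl.
Qed.

Lemma lc_phi_bounded s : exists c, forall n, mx_opnorm (lc (phi n) s) <= c.
Proof.
exists (fs_l1 s) => n; apply: le_trans (opnorm_sum _ _ _) _; apply: ler_sum => p _.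
by rewrite opnormZ ler_piMr ?cabs_ge0 // opnorm_unitary // phi_unitary.
Qed.

Lemma lc_urho s x :
  lc (urho^~ (ucls x : H)) s = ucls (mact (lc_phi_bounded s) x).
Proof.
transitivity (ucls (\sum_(p <- s) p.1 *: mact (phi_bounded p.2) x) : H).
  rewrite /lc; elim: s => [|p s IH].
    rewrite !big_nil; have := ucls_lin (-1) 0 0.
    by rewrite scaler0 addr0 scaleN1r addNr.
  by rewrite !big_cons ucls_lin IH -urho_ucls.
congr ucls; apply: bvec_ext => n; rewrite bfun_mact /lc.
elim: s => [|p s IH].
  rewrite !big_nil mul0mx; have := bfunB (0 : bvec) 0 n.
  by rewrite !subrr.
by rewrite !big_cons bfunD bfunZ bfun_mact IH mulmxDl scalemxAl.
Qed.

End WithUltrafilter.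

(** Otherwise some ultrafilter contains the infinite set of bad indices, and
    the unit vectors witnessing them violate the bound in the ultraproduct. *)
Lemma asymptotic_norm_le (A : unital_cstar_algebra R) (u : G -> A) s (e : R) :
  is_full_group_cstar u -> 0 < e ->
  exists N, forall n, (N <= n)%N -> mx_opnorm (lc (phi n) s) <= rnorm (lc u s) + e.
Proof.
move=> fullA e0; apply: contrapT => bad.
set c := rnorm (lc u s) in bad; have c0 : 0 <= c by apply: rnorm_ge0.
pose I := [set n | c + e < mx_opnorm (lc (phi n) s)].
have Iinf N : exists2 n, (N <= n)%N & I n.
  apply: contrapT => H; apply: bad; exists N => n Nn; rewrite leNgt; apply/negP => cn.
  by apply: H; exists n.
pose F := [set S : set nat | exists N, forall n, (N <= n)%N -> I n -> S n].
have FF : ProperFilter F.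
  split.
    by move=> [N HN]; have [n Nn In] := Iinf N; apply: HN In.
  split; first by exists 0%N.
    move=> P Q [N HN] [M HM]; exists (maxn N M) => n; rewrite geq_max => /andP[Nn Mn] In.
    by split; [apply: HN|apply: HM].
  by move=> P Q PQ [N HN]; exists N => n Nn In; apply/PQ/HN.
have [U [UU FU]] := ultraFilterLemma FF.
have Uoo N : U [set n | (N <= n)%N] by apply: FU; exists N.
have UI : U I by apply: FU; exists 0%N.
have ex n : exists x : 'cV[C]_(k n),
    l2norm x <= 1 /\ (I n -> c + e <= l2norm (lc (phi n) s *m x)).
  have [In|nI] := pselect (I n); last by exists 0; rewrite l2norm0.
  apply: contrapT => H; move: (In); rewrite /I /= ltNge => /negP; apply.
  apply: opnorm_le_ball => x x1; rewrite leNgt; apply/negP => cx; apply: H.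
  by exists x; split=> // _; apply: ltW.
pose x n := sval (cid (ex n)).
have x1 n : l2norm (x n) <= 1 by have [] := svalP (cid (ex n)).
have xI n : I n -> c + e <= l2norm (lc (phi n) s *m x n).
  by have [] := svalP (cid (ex n)).
pose y : bvec R k := mkb (ex_intro _ 1 x1).
have := @full_rep_le R G A u fullA (@uspace R k U UU Uoo) _ s (@ucls R k U UU y) (urho_unitary Uoo).
rewrite lc_urho -/c -[rnorm (@ucls R k U UU y : @uspace R k U UU Uoo)]/(unorm (@ucls R k U UU y)).
rewrite -[rnorm _]/(unorm (@ucls R k U UU (mact (lc_phi_bounded s) y))) !unorm_ucls => H.
have y1 : snorm (@uip R k U UU) y <= 1 by apply: usnorm_le => //; apply: filterE.
have : c + e <= snorm (@uip R k U UU) (mact (lc_phi_bounded s) y).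
  apply: usnorm_ge; first by rewrite addr_ge0 // ltW.
  exact: filterS UI.
by have := ler_piMr c0 y1; lra.
Qed.

End NormLimsup.

(** * Rapidly converging sequences *)

Section RapidLimits.
Variable R : realType.
Local Notation C := R[i].

Lemma rapid_dist (V : lmodType C) (N : V -> R) (x : nat -> V) :
  (forall y z, N (y + z) <= N y + N z) -> N 0 = 0 ->
  (forall m, N (x m.+1 - x m) <= half_pow R m) ->
  forall m n, (m <= n)%N -> N (x n - x m) <= 2 * half_pow R m - 2 * half_pow R n.
Proof.
move=> ND N0 Hx m n /subnK <-; elim: (n - m)%N => [|i IH].
  by rewrite add0n !subrr N0.
rewrite addSn -[x (i + m).+1 - x m](subrKA (x (i + m)%N)).
apply: le_trans (ND _ _) _.
have := Hx (i + m)%N; have := half_powS R (i + m); move: IH; lra.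
Qed.

Lemma rapid_rate (V : lmodType C) (N : V -> R) (x : nat -> V) l :
  (forall y z, N (y + z) <= N y + N z) -> N 0 = 0 -> (forall y, N (- y) = N y) ->
  (forall m, N (x m.+1 - x m) <= half_pow R m) -> seq_conv N x l ->
  forall m, N (x m - l) <= 2 * half_pow R m.
Proof.
move=> ND N0 NN Hx xl m; apply/ler_addgt0Pl => e e0; have [M HM] := xl e e0.
have := HM _ (leq_maxr m M); have := rapid_dist ND N0 Hx (leq_maxl m M).
rewrite -NN opprB; have := half_pow_gt0 R (maxn m M).
have := ND (x m - x (maxn m M)) (x (maxn m M) - l); rewrite subrKA.
lra.
Qed.

Lemma rapid_cauchy (V : lmodType C) (N : V -> R) (x : nat -> V) :
  (forall y z, N (y + z) <= N y + N z) -> N 0 = 0 ->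
  (forall m, N (x m.+1 - x m) <= half_pow R m) -> seq_cauchy N x.
Proof.
move=> ND N0 Hx e e0; have [M HM] := half_pow_small (divr_gt0 e0 (ltr0n R 2)).
exists M => m Mm; have := rapid_dist ND N0 Hx Mm.
have := half_pow_gt0 R m; move: HM; rewrite ler_pdivlMr //; lra.
Qed.

Lemma real_rapid_limit (x : nat -> R) :
  (forall m, `|x m.+1 - x m| <= half_pow R m) ->
  exists l, forall m, `|x m - l| <= 2 * half_pow R m.
Proof.
move=> Hx; have D m n : (m <= n)%N -> `|x n - x m| <= 2 * half_pow R m.
  move=> /subnK <-; apply: (@le_trans _ _ (2 * half_pow R m - 2 * half_pow R (n - m + m))); last first.
    have := half_pow_gt0 R (n - m + m); lra.
  elim: (n - m)%N => [|i IH]; first by rewrite add0n !subrr normr0.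
  rewrite addSn -[x (i + m).+1 - x m](subrKA (x (i + m)%N)).
  apply: le_trans (ler_normD _ _) _.
  have := Hx (i + m)%N; have := half_powS R (i + m); move: IH; lra.
have /cauchy_cvg /cvg_ex [l xl] : cauchy (x @ \oo).
  apply: cauchy_exP => e e0.
  have [M HM] := half_pow_small (divr_gt0 e0 (ltr0n R 3)).
  exists (x M), M => // m /= /D Mm; rewrite -ball_normE /= distrC.
  have := half_pow_gt0 R M; move: HM Mm; rewrite ler_pdivlMr //; lra.
exists l => m; apply/ler_addgt0Pl => e e0.
move/cvgrPdist_le: xl => /(_ e e0) [M _ /(_ _ (leq_maxr m M)) /=].
have := D _ _ (leq_maxl m M); rewrite !ler_norml; lra.
Qed.

Lemma mx_rapid_limit n (x : nat -> 'M[C]_n) :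
  (forall m, mx_opnorm (x m.+1 - x m) <= half_pow R m) ->
  exists l, forall m, mx_opnorm (x m - l) <= 2 * half_pow R m.
Proof.
move=> Hx.
have ent i j m : cabs (x m.+1 i j - x m i j) <= half_pow R m.
  by apply: le_trans (Hx m); rewrite -[x m.+1 i j - x m i j](_ : (x m.+1 - x m) i j = _) ?opnorm_entry // !mxE.
have /choice [a Ha] (ij : 'I_n * 'I_n) : exists a : R,
    forall m, `|complex.Re (x m ij.1 ij.2) - a| <= 2 * half_pow R m.
  apply: real_rapid_limit => m; rewrite -ReB.
  exact: le_trans (absRe_le_cabs _) (ent _ _ _).
have /choice [b Hb] (ij : 'I_n * 'I_n) : exists b : R,
    forall m, `|complex.Im (x m ij.1 ij.2) - b| <= 2 * half_pow R m.
  apply: real_rapid_limit => m.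
  have <- : complex.Im (x m.+1 ij.1 ij.2 - x m ij.1 ij.2) =
    complex.Im (x m.+1 ij.1 ij.2) - complex.Im (x m ij.1 ij.2).
    by case: (x m.+1 _ _) (x m _ _) => [? ?] [? ?].
  exact: le_trans (absIm_le_cabs _) (ent _ _ _).
pose L : 'M[C]_n := \matrix_(i, j) Complex (a (i, j)) (b (i, j)).
exists L; apply: (rapid_rate (@opnormD R n) (opnorm0 R n) (@opnormN R n)) => //.
have K0 : 0 < 4 * (n * n)%:R + 1 :> R by rewrite ltr_wpDl.
move=> e e0; have [M HM] := half_pow_small (divr_gt0 e0 K0); exists M => m Mm.
apply: le_trans (opnorm_le_sum _) _.
apply: (@le_trans _ _ (\sum_(i < n) \sum_(j < n) 4 * half_pow R m)).
  apply: ler_sum => i _; apply: ler_sum => j _.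
  have := Ha (i, j) m; have := Hb (i, j) m; rewrite !mxE /=.
  have := cabs_le_ReIm (x m i j - Complex (a (i, j)) (b (i, j))).
  by case: (x m i j) => p q /=; lra.
rewrite !sumr_const !card_ord -mulrnA -mulr_natl.
have := half_pow_le R Mm; have := half_pow_gt0 R m; move: HM; rewrite ler_pdivlMr //.
have := ler0n R (n * n); nra.
Qed.

End RapidLimits.

(** * Asymptotically negligible sequences of matrices *)

Section Negligible.
Variables (R : realType) (k : nat -> nat).
Local Notation C := R[i].
Local Notation mseq := (dseq (fun n => 'M[C]_(k n))).

Definition negl (x : forall n, 'M[C]_(k n)) :=
  forall e : R, 0 < e -> \forall n \near \oo, mx_opnorm (x n) <= e.

Lemma negl0 : negl (fun n => 0).
Proof. by move=> e e0; apply: nearW => n; rewrite opnorm0 ltW. Qed.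

Lemma neglD x y : negl x -> negl y -> negl (fun n => x n + y n).
Proof.
move=> nx ny e e0; have e2 : 0 < e / 2 by rewrite divr_gt0.
apply: filterS2 (nx _ e2) (ny _ e2) => n xn yn.
exact: le_split2 (opnormD (x n) (y n)) xn yn.
Qed.

Lemma neglMl (M x : forall n, 'M[C]_(k n)) c :
  (forall n, mx_opnorm (M n) <= c) -> negl x -> negl (fun n => M n *m x n).
Proof.
move=> Mc nx e e0; have c0 : 0 <= c by apply: le_trans (Mc 0%N); apply: opnorm_ge0.
have c1 : 0 < c + 1 by rewrite ltr_wpDl.
apply: filterS (nx _ (divr_gt0 e0 c1)) => n H; apply: le_trans (opnormM _ _) _.
rewrite -(divfK (lt0r_neq0 c1) e) mulrC.
apply: ler_pM; rewrite ?opnorm_ge0 //.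
by apply: le_trans (Mc n) _; rewrite lerDl.
Qed.

Lemma neglZ a x : negl x -> negl (fun n => a *: x n).
Proof.
move=> nx e e0; have c1 : 0 < cabs a + 1 by rewrite ltr_wpDl // cabs_ge0.
apply: filterS (nx _ (divr_gt0 e0 c1)) => n; rewrite opnormZ ler_pdivlMr // => H.
apply: le_trans H; rewrite mulrC ler_wpM2l ?opnorm_ge0 //.
by rewrite lerDl.
Qed.

Lemma negl_sum (I : Type) (s : seq I) (x : I -> forall n, 'M[C]_(k n)) :
  (forall i, negl (x i)) -> negl (fun n => \sum_(i <- s) x i n).
Proof.
move=> nx; elim: s => [|i s IH] e e0.
  by apply: filterS (negl0 e0) => n; rewrite big_nil.
by apply: filterS (neglD (nx i) IH e0) => n; rewrite big_cons.
Qed.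

Lemma negl_ext x y : (forall n, x n = y n) -> negl x -> negl y.
Proof. by move=> xy nx e e0; apply: filterS (nx e e0) => n; rewrite xy. Qed.

Variables (G : groupType) (phi : forall n, G -> 'M[C]_(k n)).
Arguments phi : clear implicits.
Hypothesis phi_asymp : asymptotic_rep phi.

Lemma phi_opnorm n g : mx_opnorm (phi n g) <= 1.
Proof. by rewrite opnorm_unitary // (phi_unitary phi_asymp). Qed.

Lemma phi_adj_opnorm n g : mx_opnorm ((phi n g)^t* ) <= 1.
Proof. by rewrite opnorm_adj phi_opnorm. Qed.

Lemma phi_mul_negl g h : negl (fun n => phi n (g * h)%g - phi n g *m phi n h).
Proof.
move=> e e0; have [N HN] := phi_asympM phi_asymp g h e0.
by exists N => // n; apply: HN.
Qed.

(** [phi 1 - phi 1 phi 1] is null, and [phi 1] can be cancelled since it is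
    unitary. *)
Lemma phi1_negl : negl (fun n => phi n 1%g - 1%:M).
Proof.
apply: negl_ext (neglZ (-1) (neglMl (phi_adj_opnorm^~ 1%g) (phi_mul_negl 1 1))) => n.
rewrite mulg1 mulmxBr mulmxA unitarymx_adjl ?(phi_unitary phi_asymp) // mul1mx.
by rewrite scaleN1r opprB.
Qed.

Lemma phi_inv_negl g : negl (fun n => phi n g^-1%g - (phi n g)^t* ).
Proof.
have H := neglD phi1_negl (neglZ (-1) (phi_mul_negl g g^-1)).
apply: negl_ext (neglMl (phi_adj_opnorm^~ g) H) => n.
rewrite mulgV scaleN1r opprB addrC subrKA mulmxBr mulmxA.
by rewrite unitarymx_adjl ?(phi_unitary phi_asymp) // mul1mx mulmx1.
Qed.

Lemma lc_mul_negl s t :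
  negl (fun n => lc (phi n) (fs_mul s t) - lc (phi n) s *m lc (phi n) t).
Proof.
pose x (p q : (C * G)%type) n := (p.1 * q.1) *:
  (phi n (p.2 * q.2)%g - phi n p.2 *m phi n q.2).
apply: (@negl_ext (fun n => \sum_(p <- s) \sum_(q <- t) x p q n)) => [n|].
  rewrite lc_mul /lc mulmx_suml -sumrB; apply: eq_bigr => p _.
  rewrite mulmx_sumr -sumrB; apply: eq_bigr => q _.
  by rewrite /x scalerBr -scalemxAl -scalemxAr scalerA.
by apply: negl_sum => p; apply: negl_sum => q; apply: neglZ; apply: phi_mul_negl.
Qed.

Lemma lc_star_negl s : negl (fun n => lc (phi n) (fs_star s) - (lc (phi n) s)^t* ).
Proof.
pose x (p : (C * G)%type) n := p.1^* *: (phi n p.2^-1%g - (phi n p.2)^t* ).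
apply: (@negl_ext (fun n => \sum_(p <- s) x p n)) => [n|]; last first.
  by apply: negl_sum => p; apply: neglZ; apply: phi_inv_negl.
rewrite /lc big_map; elim: s => [|p s IH].
  by rewrite !big_nil adjmx0 subr0.
rewrite !big_cons IH adjmxD adjmxZ /x scalerBr opprD addrACA; congr (_ + _).
Qed.

End Negligible.

(** * The algebra of sequences converging into the group C*-algebra *)

Section Pullback.
Variables (R : realType) (G : groupType) (k : nat -> nat).
Local Notation C := R[i].
Variable phi : forall n, G -> 'M[C]_(k n).
Arguments phi : clear implicits.
Hypothesis phi_asymp : asymptotic_rep phi.
Variables (A : unital_cstar_algebra R) (u : G -> A).
Hypothesis fullA : is_full_group_cstar u.

Local Notation mseq := (dseq (fun n => 'M[C]_(k n))).

Definition near_seq (a : A) (x : mseq) (e : R) := exists s,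
  rnorm (a - lc u s) <= e /\ \forall n \near \oo, mx_opnorm (x n - lc (phi n) s) <= e.

(** The sequences [x] that represent [a] up to null sequences, that is, the
    pullback of the morphism from [A] to bounded sequences modulo null ones
    along the quotient map. *)
Definition pb_set : set (A * mseq)%type := [set b |
  (exists c, forall n, mx_opnorm (b.2 n) <= c) /\
  (forall e, 0 < e -> near_seq b.1 b.2 e)].

Lemma near_seqD a b x y e : near_seq a x (e / 2) -> near_seq b y (e / 2) ->
  near_seq (a + b) (x + y) e.
Proof.
move=> [s [as_ xs]] [t [bt yt]]; exists (s ++ t); split.
  rewrite lc_cat opprD addrACA; exact: le_split2 (rnormD _ _) as_ bt.
apply: filterS2 xs yt => n xs yt; rewrite lc_cat dseqD opprD addrACA.
exact: le_split2 (opnormD _ _) xs yt.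
Qed.

Lemma near_seqZ c a x e : 0 <= e -> near_seq a x (e / (cabs c + 1)) ->
  near_seq (c *: a) (c *: x) e.
Proof.
move=> e0 [s [H1 H2]]; have c1 : 0 < cabs c + 1 by rewrite ltr_wpDl // cabs_ge0.
have le (r : R) : 0 <= r -> r <= e / (cabs c + 1) -> cabs c * r <= e.
  rewrite ler_pdivlMr // => r0; apply: le_trans.
  by rewrite mulrC ler_wpM2l // lerDl.
exists (fs_scale c s); split.
  by rewrite lc_scale -scalerBr rnormZ le // rnorm_ge0.
apply: filterS H2 => n H; rewrite lc_scale dseqZ -scalerBr opnormZ.
by apply: le H; apply: opnorm_ge0.
Qed.

Lemma pb_subspace : Defs.subspace pb_set.
Proof.
split.
  split; first by exists 0 => n; rewrite opnorm0.
  move=> e e0; exists [::]; rewrite lc_nil subrr rnorm0; split; first exact: ltW.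
  by apply: nearW => n; rewrite lc_nil subrr opnorm0 ltW.
move=> c [a x] [b y] [[d xd] /= ax] [[d' yd] /= by_]; split.
  exists (cabs c * d + d') => n; apply: le_trans (opnormD _ _) _.
  by rewrite lerD // opnormZ ler_wpM2l ?cabs_ge0.
move=> e e0; have e2 : 0 < e / 2 by rewrite divr_gt0.
apply: near_seqD; last exact: by_.
apply: near_seqZ; first exact: ltW.
by apply: ax; rewrite divr_gt0 // ltr_wpDl // cabs_ge0.
Qed.

Definition pb := subsp (Linsub pb_subspace).
Definition pbA (b : pb) : A := (sub_val b).1.
Definition pbM (b : pb) : mseq := (sub_val b).2.
Arguments pbA : simpl never.
Arguments pbM : simpl never.

Definition mk_pb (a : A) (x : mseq) (H : pb_set (a, x)) : pb :=
  @to_sub _ _ (Linsub pb_subspace) (a, x) H.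

Lemma pbA_mk a x H : pbA (@mk_pb a x H) = a. Proof. by []. Qed.
Lemma pbM_mk a x H : pbM (@mk_pb a x H) = x. Proof. by []. Qed.

Lemma pb_ext b c : pbA b = pbA c -> (forall n, pbM b n = pbM c n) -> b = c.
Proof.
move=> H1 H2; apply: sub_ext.
rewrite [sub_val b]surjective_pairing [sub_val c]surjective_pairing.
congr pair; first exact: H1.
exact: functional_extensionality_dep.
Qed.

Lemma pbA_linear c x y : pbA (c *: x + y) = c *: pbA x + pbA y.
Proof. by rewrite /pbA sub_valD sub_valZ. Qed.

Lemma pbM_linear c x y n : pbM (c *: x + y) n = c *: pbM x n + pbM y n.
Proof. by rewrite /pbM sub_valD sub_valZ. Qed.

Lemma pbAD x y : pbA (x + y) = pbA x + pbA y. Proof. by rewrite /pbA sub_valD. Qed.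
Lemma pbMD x y n : pbM (x + y) n = pbM x n + pbM y n. Proof. by rewrite /pbM sub_valD. Qed.
Lemma pbAB x y : pbA (x - y) = pbA x - pbA y. Proof. by rewrite /pbA sub_valB. Qed.
Lemma pbMB x y n : pbM (x - y) n = pbM x n - pbM y n. Proof. by rewrite /pbM sub_valB. Qed.
Lemma pbAZ c x : pbA (c *: x) = c *: pbA x. Proof. by rewrite /pbA sub_valZ. Qed.
Lemma pbMZ c x n : pbM (c *: x) n = c *: pbM x n. Proof. by rewrite /pbM sub_valZ. Qed.
Lemma pbA0 : pbA 0 = 0. Proof. by rewrite /pbA sub_val0. Qed.
Lemma pbM0 n : pbM 0 n = 0. Proof. by rewrite /pbM sub_val0. Qed.

Lemma pb_bounded b : exists c, forall n, mx_opnorm (pbM b n) <= c.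
Proof. by have [] := in_sub b. Qed.

Lemma pb_near b e : 0 < e -> near_seq (pbA b) (pbM b) e.
Proof. by have [_] := in_sub b; apply. Qed.

Definition pb_norm (b : pb) : R :=
  Num.max (rnorm (pbA b)) (sup (range (fun n => mx_opnorm (pbM b n)))).

Lemma pb_normP b c : pb_norm b <= c <->
  rnorm (pbA b) <= c /\ forall n, mx_opnorm (pbM b n) <= c.
Proof.
rewrite /pb_norm ge_max; split.
  move=> /andP[-> H]; split=> // n; apply: le_trans H; apply: ub_le_sup; last by exists n.
  by have [d xd] := pb_bounded b; exists d => _ [m _ <-].
move=> [-> H] /=; apply: ge_sup; first by exists (mx_opnorm (pbM b 0%N)), 0%N.
by move=> _ [n _ <-].
Qed.

Lemma pb_normA b : rnorm (pbA b) <= pb_norm b.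
Proof. by have /pb_normP [] := lexx (pb_norm b). Qed.

Lemma pb_normM b n : mx_opnorm (pbM b n) <= pb_norm b.
Proof. by have /pb_normP [_] := lexx (pb_norm b); apply. Qed.

Lemma pb_norm_ge0 b : 0 <= pb_norm b.
Proof. exact: le_trans (rnorm_ge0 _) (pb_normA b). Qed.

Lemma pb_normD b c : pb_norm (b + c) <= pb_norm b + pb_norm c.
Proof.
apply/pb_normP; split=> [|n]; rewrite ?pbAD ?pbMD.
  by apply: le_trans (rnormD _ _) _; rewrite lerD // pb_normA.
exact: le_trans (opnormD _ _) (lerD (pb_normM b n) (pb_normM c n)).
Qed.

Lemma pb_normZ_le a b : pb_norm (a *: b) <= cabs a * pb_norm b.
Proof.
apply/pb_normP; split=> [|n]; rewrite ?pbAZ ?pbMZ.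
  by rewrite rnormZ ler_wpM2l ?cabs_ge0 ?pb_normA.
by rewrite opnormZ ler_wpM2l ?cabs_ge0 ?pb_normM.
Qed.

Lemma pb_normZ a b : pb_norm (a *: b) = cabs a * pb_norm b.
Proof.
apply/eqP; rewrite eq_le pb_normZ_le /=.
have [->|a0] := eqVneq a 0; first by rewrite cabs0 mul0r pb_norm_ge0.
have ca : 0 < cabs a by rewrite lt_def cabs_eq0 a0 cabs_ge0.
have := pb_normZ_le a^-1 (a *: b); rewrite scalerA mulVf // scale1r.
move/(ler_wpM2l (ltW ca)); rewrite mulrA -cabsM divff // cabs1 mul1r.
exact.
Qed.

Lemma pb_norm_eq0 b : pb_norm b = 0 -> b = 0.
Proof.
move=> b0; have /pb_normP [H1 H2] : pb_norm b <= 0 by rewrite b0.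
apply: pb_ext => [|n]; rewrite ?pbA0 ?pbM0.
  by apply: rnorm_eq0; apply/eqP; rewrite eq_le H1 rnorm_ge0.
by apply: opnorm_eq0; apply/eqP; rewrite eq_le H2 opnorm_ge0.
Qed.

Lemma pb_complete (b : nat -> pb) :
  (forall m, pb_norm (b m.+1 - b m) <= half_pow R m) -> exists l, seq_conv pb_norm b l.
Proof.
move=> Hb.
have HA m : rnorm (pbA (b m.+1) - pbA (b m)) <= half_pow R m.
  by rewrite -pbAB; apply: le_trans (pb_normA _) (Hb m).
have HM n m : mx_opnorm (pbM (b m.+1) n - pbM (b m) n) <= half_pow R m.
  by rewrite -pbMB; apply: le_trans (pb_normM _ n) (Hb m).
have [a Ha] := complete_seq_conv (rapid_cauchy (@rnormD R A) (@rnorm0 R A) HA).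
have {}Ha := rapid_rate (@rnormD R A) (@rnorm0 R A) (@rnormN R A) HA Ha.
have ex n := mx_rapid_limit (HM n).
pose L : mseq := fun n => sval (cid (ex n)).
have HL n m : mx_opnorm (pbM (b m) n - L n) <= 2 * half_pow R m := svalP (cid (ex n)) m.
have Hl : pb_set (a, L).
  split=> [|e e0] /=.
    have [c bc] := pb_bounded (b 0%N); exists (2 * half_pow R 0 + c) => n.
    have -> : L n = - (pbM (b 0%N) n - L n) + pbM (b 0%N) n by rewrite opprB subrK.
    by apply: le_trans (opnormD _ _) _; rewrite opnormN lerD.
  have e4 : 0 < e / 4 by rewrite divr_gt0.
  have e2 : 0 < e / 2 by rewrite divr_gt0.
  have [m Hm] := half_pow_small e4.
  have Hm2 : 2 * half_pow R m <= e / 2 by lra.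
  have [s [as_ Ms]] := pb_near (b m) e2; exists s; split.
    have := rnormD (- (pbA (b m) - a)) (pbA (b m) - lc u s).
    rewrite rnormN opprB subrKA => H; apply: le_split2 H _ as_.
    exact: le_trans (Ha m) Hm2.
  apply: filterS Ms => n Ms.
  have := opnormD (- (pbM (b m) n - L n)) (pbM (b m) n - lc (phi n) s).
  rewrite opnormN opprB subrKA => H; apply: le_split2 H _ Ms.
  exact: le_trans (HL n m) Hm2.
exists (mk_pb Hl) => e e0.
have [M HMe] := half_pow_small (divr_gt0 e0 (ltr0n R 2)); exists M => m Mm.
have me : 2 * half_pow R m <= e.
  by have := half_pow_le R Mm; move: HMe; rewrite ler_pdivlMr //; lra.
apply/pb_normP; split=> [|n].
  by rewrite pbAB pbA_mk; apply: le_trans (Ha m) me.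
by rewrite pbMB pbM_mk; apply: le_trans (HL n m) me.
Qed.

Definition pb_bnorm : bnorm pb := Bnorm pb_normD pb_normZ pb_norm_eq0 pb_complete.

(** For the right-hand side of [|x y - s t| <= |x| |y - t| + |x - s| |t|], when
    [s] and [t] approximate [x] and [y] up to [d]. *)
Lemma pb_mul_bound (x y d e K : R) : 0 <= K -> x <= K -> y <= K ->
  0 <= d -> d <= 1 -> d * (2 * K + 1) <= e -> x * d + d * (y + d) <= e.
Proof. nra. Qed.

Lemma pb_mul_set b c :
  pb_set (cmul (pbA b) (pbA c), (fun n => pbM b n *m pbM c n) : mseq).
Proof.
have [K1 HK1] := pb_bounded b; have [K2 HK2] := pb_bounded c.
split=> [|e e0] /=.
  exists (K1 * K2) => n; apply: le_trans (opnormM _ _) _.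
  by apply: ler_pM; rewrite ?opnorm_ge0.
pose K := pb_norm b + pb_norm c; have K0 : 0 <= K by rewrite addr_ge0 // pb_norm_ge0.
have bK : pb_norm b <= K by rewrite lerDl pb_norm_ge0.
have cK : pb_norm c <= K by rewrite lerDr pb_norm_ge0.
have e2 : 0 < e / 2 by rewrite divr_gt0.
have K1' : 0 < 2 * K + 1 by rewrite ltr_wpDl // mulr_ge0.
pose d := Num.min 1 (e / 2 / (2 * K + 1)).
have d0 : 0 < d by rewrite lt_min ltr01 divr_gt0.
have d1 : d <= 1 by rewrite ge_min lexx.
have de : d * (2 * K + 1) <= e / 2 by rewrite -ler_pdivlMr // ge_min lexx orbT.
have [s [bs Ms]] := pb_near b d0; have [t [ct Mt]] := pb_near c d0.
have bnd x y (xK : x <= K) (yK : y <= K) := pb_mul_bound K0 xK yK (ltW d0) d1 de.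
exists (fs_mul s t); split.
  rewrite (lc_cmul (full_uM fullA)); apply: (@le_trans _ _ (e / 2)); last first.
    by rewrite ler_pdivrMr // ler_peMr ?ltW // ltr1n.
  apply: le_trans (bnd (rnorm (pbA b)) (rnorm (pbA c)) _ _); last 2 first.
  - exact: le_trans (pb_normA b) bK.
  - exact: le_trans (pb_normA c) cK.
  have -> : cmul (pbA b) (pbA c) - cmul (lc u s) (lc u t) =
    cmul (pbA b) (pbA c - lc u t) + cmul (pbA b - lc u s) (lc u t).
    by rewrite cmulBr cmulBl subrKA.
  apply: le_trans (rnormD _ _) _; apply: lerD.
    by apply: le_trans (rnormM _ _) _; rewrite ler_wpM2l ?rnorm_ge0.
  apply: le_trans (rnormM _ _) _; apply: ler_pM; rewrite ?rnorm_ge0 //.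
  have := rnorm_le_dist (lc u t) (pbA c); rewrite rnorm_dist => H.
  by apply: le_trans H _; rewrite lerD2l.
apply: filterS3 Ms Mt (lc_mul_negl phi_asymp s t e2) => n Ms Mt Hst.
have -> : pbM b n *m pbM c n - lc (phi n) (fs_mul s t) =
    (pbM b n *m (pbM c n - lc (phi n) t) + (pbM b n - lc (phi n) s) *m lc (phi n) t)
    - (lc (phi n) (fs_mul s t) - lc (phi n) s *m lc (phi n) t).
  by rewrite mulmxBr mulmxBl subrKA opprB addrA subrK.
apply: le_split2 (opnormB _ _) _ Hst.
apply: le_trans (bnd (mx_opnorm (pbM b n)) (mx_opnorm (pbM c n)) _ _); last 2 first.
- exact: le_trans (pb_normM b n) bK.
- exact: le_trans (pb_normM c n) cK.
apply: le_trans (opnormD _ _) _; apply: lerD.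
  exact: le_trans (opnormM _ _) (ler_wpM2l (opnorm_ge0 _) Mt).
apply: le_trans (opnormM _ _) _; apply: ler_pM (opnorm_ge0 _) (opnorm_ge0 _) Ms _.
have := opnormD (pbM c n) (lc (phi n) t - pbM c n); rewrite addrC subrK opnorm_dist => H.
exact: le_trans H (lerD (lexx _) Mt).
Qed.

Lemma pb_star_set b : pb_set (cstar (pbA b), (fun n => (pbM b n)^t* ) : mseq).
Proof.
split=> [|e e0] /=.
  by have [c bc] := pb_bounded b; exists c => n; rewrite opnorm_adj.
have e2 : 0 < e / 2 by rewrite divr_gt0.
have [s [bs Ms]] := pb_near b e2; exists (fs_star s); split.
  rewrite (lc_cstar (full_uV fullA)) -cstarB rnorm_star; apply: le_trans bs _.
  by rewrite ler_pdivrMr // ler_peMr ?ltW // ltr1n.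
apply: filterS2 Ms (lc_star_negl phi_asymp s e2) => n Ms Hs.
have -> : (pbM b n)^t* - lc (phi n) (fs_star s) =
    (pbM b n - lc (phi n) s)^t* - (lc (phi n) (fs_star s) - (lc (phi n) s)^t* ).
  by rewrite adjmxB opprB addrA subrK.
apply: le_split2 (opnormB _ _) _ Hs; by rewrite opnorm_adj.
Qed.

Definition pb_mul (b c : banach pb_bnorm) : banach pb_bnorm := mk_pb (pb_mul_set b c).
Definition pb_star (b : banach pb_bnorm) : banach pb_bnorm := mk_pb (pb_star_set b).

Definition pb_algebra : cstar_algebra R.
Proof.
apply: (@CStarAlgebra R (banach pb_bnorm) pb_mul pb_star).
- by move=> x y z; apply: pb_ext => [|n]; rewrite ?pbA_mk ?cmulA ?pbM_mk ?mulmxA.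
- move=> a x y z; apply: pb_ext => [|n].
    by rewrite pbA_linear !pbA_mk pbA_linear cmul_linearl.
  by rewrite pbM_linear !pbM_mk pbM_linear mulmxDl scalemxAl.
- move=> a x y z; apply: pb_ext => [|n].
    by rewrite pbA_linear !pbA_mk pbA_linear cmul_linearr.
  by rewrite pbM_linear !pbM_mk pbM_linear mulmxDr scalemxAr.
- move=> a x y; apply: pb_ext => [|n].
    by rewrite pbA_linear !pbA_mk pbA_linear cstar_antilinear.
  by rewrite pbM_linear !pbM_mk pbM_linear adjmxD adjmxZ.
- by move=> x; apply: pb_ext => [|n]; rewrite ?pbA_mk ?cstarK ?pbM_mk ?adjmxK.
- by move=> x y; apply: pb_ext => [|n]; rewrite ?pbA_mk ?cstarM ?pbM_mk ?adjmxM.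
- move=> x y; rewrite !rnormE -toCM le_toC; apply/pb_normP; split=> [|n].
    rewrite pbA_mk; apply: le_trans (rnormM _ _) _.
    by apply: ler_pM; rewrite ?rnorm_ge0 ?pb_normA.
  rewrite pbM_mk; apply: le_trans (opnormM _ _) _.
  by apply: ler_pM; rewrite ?opnorm_ge0 ?pb_normM.
- move=> x; rewrite !rnormE -toCX; congr toC; apply/eqP; rewrite eq_le; apply/andP.
  have x0 : 0 <= rnorm x by apply: rnorm_ge0.
  set y := pb_mul _ _; have y0 : 0 <= rnorm y by apply: rnorm_ge0.
  split.
    apply/pb_normP; split=> [|n].
      by rewrite pbA_mk rnorm_cstar ler_pXn2r // ?nnegrE ?rnorm_ge0 // pb_normA.
    by rewrite pbM_mk opnorm_cstar ler_pXn2r // ?nnegrE ?opnorm_ge0 // pb_normM.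
  rewrite -[leRHS]sqr_sqrtr // ler_pXn2r // ?nnegrE ?sqrtr_ge0 //.
  apply/pb_normP; split=> [|n].
    rewrite -(@ler_pXn2r _ 2) // ?nnegrE ?sqrtr_ge0 ?rnorm_ge0 // sqr_sqrtr //.
    by rewrite -rnorm_cstar; apply: (pb_normA y).
  rewrite -(@ler_pXn2r _ 2) // ?nnegrE ?sqrtr_ge0 ?opnorm_ge0 // sqr_sqrtr //.
  by rewrite -opnorm_cstar; apply: (pb_normM y n).
Defined.

End Pullback.

(** * Lifting the identity *)

Lemma opnorm_if (R : realType) n (M : 'M[R[i]]_n) (b : bool) (c : R) :
  (b -> mx_opnorm M <= c) -> 0 <= c -> mx_opnorm (if b then M else 0) <= c.
Proof. by case: b => [/(_ isT)|_]; rewrite ?opnorm0. Qed.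

Section Lifting.
Variables (R : realType) (G : groupType) (k : nat -> nat).
Local Notation C := R[i].
Variable phi : forall n, G -> 'M[C]_(k n).
Arguments phi : clear implicits.
Hypothesis phi_asymp : asymptotic_rep phi.
Variables (A : unital_cstar_algebra R) (u : G -> A).
Hypothesis fullA : is_full_group_cstar u.

Local Notation mseq := (dseq (fun n => 'M[C]_(k n))).
Local Notation B := (pb_algebra phi_asymp fullA).
Local Notation q := (@pbA R G k phi A u).
Local Notation M_ := (@pbM R G k phi A u).

(** This is where domination by the maximal norm enters: it makes the norm of
    [A] the quotient norm of the pullback. *)
Lemma pb_limsup (b : B) (e : R) : 0 < e ->
  \forall n \near \oo, mx_opnorm (M_ b n) <= rnorm (q b) + e.
Proof.
move=> e0; have e3 : 0 < e / 3 by rewrite divr_gt0.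
have [s [bs Ms]] := pb_near b e3.
have [N HN] := asymptotic_norm_le phi_asymp s fullA e3.
have split3 (x y z w v : R) :
  x <= y + z -> y <= v + e / 3 -> z <= e / 3 -> v <= w + e / 3 -> x <= w + e by lra.
apply: filterS2 Ms (nbhs_infty_ge N) => n Ms Nn.
have := opnormD (lc (phi n) s) (M_ b n - lc (phi n) s); rewrite addrC subrK => H.
apply: split3 H (HN n Nn) Ms _.
apply: le_trans (rnorm_le_dist _ (q b)) _; rewrite rnorm_dist.
exact: lerD.
Qed.

Definition pb_ideal : set B := [set b | q b = 0].

Lemma pb_ideal_closed : closed_ideal pb_ideal.
Proof.
split.
- move=> b Hb; apply: rnorm_small_eq0 => e e0.
  have e0' : 0 < toC e by rewrite -toC0 lt_toC.
  have [j [j0]] := Hb _ (nbhsx_ballx b _ e0').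
  rewrite -ball_normE /= rnormE lt_toC => /ltW; apply: le_trans.
  by rewrite -[q b]subr0 -j0 -pbAB; apply: pb_normA.
- split; first exact: pbA0.
  by move=> a x y; rewrite /pb_ideal /= pbA_linear => -> ->; rewrite scaler0 addr0.
- move=> x y; rewrite /pb_ideal /= => y0.
  by split; rewrite pbA_mk y0 ?cmul0l ?cmul0r.
Qed.

Lemma pb_null_set (x : mseq) : (exists c, forall n, mx_opnorm (x n) <= c) ->
  negl x -> pb_set phi u (0, x).
Proof.
move=> xb nx; split=> // e e0; exists [::]; rewrite lc_nil subrr rnorm0.
split; first exact: ltW.
by apply: filterS (nx e e0) => n; rewrite lc_nil subr0.
Qed.

(** Approximate [a] by elements [s_i] of the group algebra, and represent it by
    [phi n (s_j)] with [j] growing slowly with [n]. *)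
Lemma pb_surjective a : exists b : B, q b = a.
Proof.
have /choice [s Hs] m : exists s, rnorm (a - lc u s) <= half_pow R m.
  by have [s /ltW] := full_dense fullA a (half_pow_gt0 R m); exists s.
pose Q j n (y : 'M[C]_(k n)) :=
  forall i, (i <= j)%N -> mx_opnorm (y - lc (phi n) (s i)) <= 4 * half_pow R i.
have Foo N : (\forall n \near \oo, (N <= n)%N) by exact: nbhs_infty_ge.
have [||y Hy] := diagonal_choice _ Foo (fun n => 0 : 'M[C]_(k n)) (Q := Q).
- by move=> j n y Hy i ij; apply: Hy; rewrite leqW.
- move=> j.
  suff H b : (b <= j)%N -> \forall n \near \oo, forall i, (i <= b)%N ->
      mx_opnorm (lc (phi n) (s j) - lc (phi n) (s i)) <= 4 * half_pow R i.
    by apply: filterS (H j (leqnn j)) => n Hn; exists (lc (phi n) (s j)).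
  have base i : (i <= j)%N -> \forall n \near \oo,
      mx_opnorm (lc (phi n) (s j) - lc (phi n) (s i)) <= 4 * half_pow R i.
    move=> ij.
    have [N HN] := asymptotic_norm_le phi_asymp (s j ++ fs_scale (-1) (s i)) fullA
      (half_pow_gt0 R i).
    apply: filterS (nbhs_infty_ge N) => n /HN; rewrite !lc_sub => H.
    apply: le_trans H _.
    have := rnormD (- (a - lc u (s j))) (a - lc u (s i)).
    rewrite opprB subrKA rnorm_dist -(rnorm_dist a).
    move: (Hs i) (Hs j) (half_pow_le R ij) (half_pow_gt0 R i).
    move: (rnorm _) (rnorm _) (rnorm _) (half_pow _ _) (half_pow _ _) => r1 r2 r3 h1 h2.
    lra.
  elim: b => [|b IH] bj.
    by apply: filterS (base _ bj) => n Hn i; rewrite leqn0 => /eqP ->.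
  apply: filterS2 (IH (ltnW bj)) (base _ bj) => n H1 H2 i.
  by rewrite leq_eqVlt => /orP[/eqP -> //|]; apply: H1.
pose c := fs_l1 (s 0%N) + 4.
pose z : mseq := fun n => if mx_opnorm (y n) <= c then y n else 0.
have zy : \forall n \near \oo, z n = y n.
  apply: filterS (Hy 0%N) => n /(_ 0%N (leqnn _)) H; rewrite /z ifT //.
  have := opnormD (y n - lc (phi n) (s 0%N)) (lc (phi n) (s 0%N)).
  rewrite subrK => H'; apply: le_trans H' _; rewrite /c addrC; apply: lerD.
    apply: le_trans (opnorm_sum _ _ _) _; apply: ler_sum => p _.
    by rewrite opnormZ ler_piMr ?cabs_ge0 // phi_opnorm.
  by apply: le_trans H _; rewrite /half_pow expr0 mulr1.
have c0 : 0 <= c by rewrite addr_ge0 // fs_l1_ge0.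
suff zS : pb_set phi u (a, z) by exists (mk_pb zS).
split=> [|e e0] /=.
  by exists c => n; apply: (opnorm_if (b := mx_opnorm (y n) <= c) id c0).
have [m Hm] := half_pow_small (divr_gt0 e0 (ltr0n R 4)).
have h0 := half_pow_gt0 R m.
have h4 : 4 * half_pow R m <= e by move: Hm; rewrite ler_pdivlMr //; lra.
exists (s m); split.
  by apply: le_trans (Hs m) (le_trans _ h4); lra.
apply: filterS2 (Hy m) zy => n /(_ m (leqnn _)) H ->.
exact: le_trans H h4.
Qed.

Lemma pb_quotient : @is_quotient R B pb_ideal A q.
Proof.
split.
- split; first exact: pbA_linear.
    by move=> x y; rewrite pbA_mk.
  by move=> x; rewrite pbA_mk.
- exact: pb_surjective.
- by [].
- move=> b; apply/eqP; rewrite eq_le; apply/andP; split.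
    apply: lb_le_inf; first by exists (rnorm (b - 0 : B)), 0 => //=; apply: pbA0.
    move=> _ [j j0 <-]; rewrite -[q b]subr0 -[X in q b - X]j0 -pbAB; exact: pb_normA.
  apply/ler_addgt0Pl => e e0; rewrite addrC.
  have [N _ HN] := pb_limsup b e0.
  (* The quotient norm is almost attained by cutting off finitely many terms. *)
  pose x : mseq := fun n => if (n < N)%N then M_ b n else 0.
  have [d bd] := pb_bounded b.
  have xS : pb_set phi u (0, x).
    apply: pb_null_set.
      exists d => n; rewrite /x; case: ifP => // _; rewrite opnorm0.
      by apply: le_trans (bd 0%N); apply: opnorm_ge0.
    move=> f f0; apply: filterS (nbhs_infty_ge N) => n Nn.
    by rewrite /x ltnNge Nn /= opnorm0 ltW.
  apply: (@le_trans _ _ (rnorm (b - mk_pb xS : B))).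
    apply: ge_inf; last by exists (mk_pb xS).
    by exists 0 => _ [j _ <-]; apply: rnorm_ge0.
  apply/pb_normP; split=> [|n].
    by rewrite pbAB pbA_mk subr0 lerDl ltW.
  rewrite pbMB pbM_mk /x; case: ltnP => [_|Nn].
    by rewrite subrr opnorm0 addr_ge0 ?rnorm_ge0 // ltW.
  by rewrite subr0; apply: HN.
Qed.

Definition fs_span (L : seq G) : set A :=
  [set x | exists s : seq (C * G), all (fun p => p.2 \in L) s /\ x = lc u s].

Lemma fs_span_u L g : g \in L -> fs_span L (u g).
Proof. by move=> gL; exists [:: (1, g)]; rewrite /= gL lc1. Qed.

Lemma fs_span_subspace L : Defs.subspace (fs_span L).
Proof.
split; first by exists [::]; rewrite lc_nil.
move=> a _ _ [s [sL ->]] [t [tL ->]]; exists (fs_scale a s ++ t).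
rewrite lc_cat lc_scale all_cat tL andbT; split=> //.
by rewrite all_map; apply: sub_all sL.
Qed.

Lemma fs_span_system L : 1%g \in L -> (forall g, g \in L -> g^-1%g \in L) ->
  operator_system (fs_span L).
Proof.
move=> L1 LV; split; first exact: fs_span_subspace.
  move=> _ [s [sL ->]]; exists (fs_star s); rewrite (lc_cstar (full_uV fullA)).
  by split=> //; rewrite all_map; apply: sub_all sL => p /= /LV.
by rewrite -(full_u1 fullA); apply: fs_span_u.
Qed.

Lemma fs_span_fin_dim L : fin_dim (fs_span L).
Proof.
exists (size L), (fun i => u (nth 1%g L i)) => _ [s [sL ->]].
elim: s sL => [_|p s IH /= /andP[pL /IH [c cE]]].
  by exists (fun=> 0); rewrite lc_nil big1 // => i _; rewrite scale0r.
have iL : (index p.2 L < size L)%N by rewrite index_mem.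
exists (fun i => c i + (if i == Ordinal iL then p.1 else 0)).
under eq_bigr => i _ do rewrite scalerDl.
rewrite big_split /= -cE lc_cons addrC; congr (_ + _).
rewrite (bigD1 (Ordinal iL)) //= eqxx nth_index // big1 ?addr0 // => i.
by move=> /negbTE ->; rewrite scale0r.
Qed.

Lemma id_ccp : ccp_on setT (@id A).
Proof.
split=> // n X _; have -> : map_mx id X = X by apply/matrixP => i j; rewrite mxE.
by [].
Qed.

Lemma pbM_sum (I : Type) (r : seq I) (P : pred I) (F : I -> B) n :
  M_ (\sum_(i <- r | P i) F i) n = \sum_(i <- r | P i) M_ (F i) n.
Proof.
elim/big_rec2: _ => [|i a b _ <-]; first exact: pbM0.
exact: pbMD.
Qed.

(** Apply the lifting property to the identity of [A] and the quotient map
    [pb_algebra -> A]: the [n]-th coordinates of the lift are completely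
    positive and asymptotic to [phi n]. *)
Lemma asymptotic_cp_lift L : LLP A -> 1%g \in L -> (forall g, g \in L -> g^-1%g \in L) ->
  exists psi : A -> forall n, 'M[C]_(k n),
  [/\ forall n a x y, fs_span L x -> fs_span L y ->
        psi (a *: x + y) n = a *: psi x n + psi y n,
      forall m (X : 'M[A]_m), (forall i j, fs_span L (X i j)) -> mx_positive X ->
        forall n, exists Y : 'I_m -> 'I_m -> 'M[C]_(k n),
        forall i j, psi (X i j) n = \sum_l (Y l i)^t* *m Y l j &
      forall g, g \in L -> negl (fun n => psi (u g) n - phi n g)].
Proof.
move=> llp L1 LV.
have [psi [[lin pos] lift]] := llp B pb_ideal A q pb_ideal_closed pb_quotient id id_ccp
  _ (fs_span_system L1 LV) (fs_span_fin_dim L).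
exists (fun x => M_ (psi x)); split.
- by move=> n a x y Lx Ly; rewrite lin // pbM_linear.
- move=> m X LX Xpos n; have [/(_ Xpos) [Y YE] _] := pos m X LX.
  exists (fun i j => M_ (Y i j) n) => i j.
  have := congr1 (fun Z : 'M[B]_m => M_ (Z i j) n) YE; rewrite !mxE => ->.
  rewrite pbM_sum; apply: eq_bigr => l _; rewrite pbM_mk.
  by rewrite mxE pbM_mk.
- move=> g gL e e0; have e3 : 0 < e / 3 by rewrite divr_gt0.
  have arith (a b r : R) : b <= r + e / 3 -> r <= e / 3 -> a <= e / 3 -> a + b <= e by lra.
  have [s [us Ms]] := pb_near (psi (u g)) e3.
  have [N HN] := asymptotic_norm_le phi_asymp (s ++ fs_scale (-1) [:: (1, g)]) fullA e3.
  rewrite lift in us; last exact: fs_span_u.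
  apply: filterS2 Ms (nbhs_infty_ge N) => n Ms /HN; rewrite !lc_sub !lc1 => H.
  have := opnormD (M_ (psi (u g)) n - lc (phi n) s) (lc (phi n) s - phi n g).
  rewrite subrKA => H'; apply: le_trans H' _.
  rewrite rnorm_dist in us; exact: arith H us Ms.
Qed.

End Lifting.

(** * Matrices over a unital C*-algebra *)

(** The same carrier, as a ring, so that square matrices form a ring too. *)
Definition uca_ring (R : realType) (A : unital_cstar_algebra R) : Type := A.

Section UcaRing.
Variables (R : realType) (A : unital_cstar_algebra R).

HB.instance Definition _ := GRing.Zmodule.on (uca_ring A).

Let mul (x y : uca_ring A) : uca_ring A := cmul x y.
Let one : uca_ring A := cone A.

Let mulA : associative mul. Proof. exact: cmulA. Qed.
Let mul1 : left_id one mul. Proof. exact: cmul1x. Qed.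
Let mulr1 : right_id one mul. Proof. exact: cmulx1. Qed.
Let mulDl : left_distributive mul +%R.
Proof. by move=> x y z; apply: cmulDl. Qed.
Let mulDr : right_distributive mul +%R.
Proof. by move=> x y z; apply: cmulDr. Qed.

HB.instance Definition _ :=
  GRing.Zmodule_isPzRing.Build (uca_ring A) mulA mul1 mulr1 mulDl mulDr.

End UcaRing.

Definition cmx (R : realType) (A : unital_cstar_algebra R) (k : nat) : Type :=
  'M[uca_ring A]_k.

Section Cmx.
Variables (R : realType) (A : unital_cstar_algebra R) (k : nat).
Local Notation C := R[i].
Local Notation M := (cmx A k).

HB.instance Definition _ := GRing.PzRing.copy M 'M[uca_ring A]_k.

Let scale (a : C) (X : M) : M := \matrix_(i, j) (a *: (X i j : A)).

Let scaleA a b X : scale a (scale b X) = scale (a * b) X.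
Proof. by apply/matrixP => i j; rewrite !mxE scalerA. Qed.
Let scale1 : left_id 1 scale.
Proof. by move=> X; apply/matrixP => i j; rewrite !mxE scale1r. Qed.
Let scaleDr : right_distributive scale +%R.
Proof. by move=> a X Y; apply/matrixP => i j; rewrite !mxE scalerDr. Qed.
Let scaleDl X : {morph scale^~ X : a b / a + b}.
Proof. by move=> a b; apply/matrixP => i j; rewrite !mxE scalerDl. Qed.

HB.instance Definition _ :=
  GRing.Zmodule_isLmodule.Build C M scaleA scale1 scaleDr scaleDl.

Implicit Types X Y Z : M.

Definition ent X i j : A := (X : 'M[uca_ring A]_k) i j.

Lemma cmxP X Y : (forall i j, ent X i j = ent Y i j) -> X = Y.
Proof. by move=> H; apply/matrixP. Qed.

Lemma entD X Y i j : ent (X + Y) i j = ent X i j + ent Y i j.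
Proof. by rewrite /ent mxE. Qed.
Lemma entN X i j : ent (- X) i j = - ent X i j.
Proof. by rewrite /ent mxE. Qed.
Lemma ent0 i j : ent 0 i j = 0.
Proof. by rewrite /ent mxE. Qed.
Lemma entZ a X i j : ent (a *: X) i j = a *: ent X i j.
Proof. by rewrite /ent mxE. Qed.
Lemma entM X Y i j : ent (X * Y) i j = \sum_l cmul (ent X i l) (ent Y l j).
Proof. by rewrite /ent mxE. Qed.
Lemma ent1 i j : ent 1 i j = if i == j then cone A else 0.
Proof. by rewrite /ent mxE; case: eqP. Qed.

Lemma cmx_scaleAl a X Y : a *: (X * Y) = (a *: X) * Y.
Proof.
apply: cmxP => i j; rewrite entZ !entM scaler_sumr.
by apply: eq_bigr => l _; rewrite entZ cmulZl.
Qed.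

Lemma cmx_scaleAr a X Y : a *: (X * Y) = X * (a *: Y).
Proof.
apply: cmxP => i j; rewrite entZ !entM scaler_sumr.
by apply: eq_bigr => l _; rewrite entZ cmulZr.
Qed.

Lemma cmx_scaleM a b X Y : (a *: X) * (b *: Y) = (a * b) *: (X * Y).
Proof. by rewrite -cmx_scaleAl -cmx_scaleAr scalerA. Qed.

Definition cadj X : M := \matrix_(i, j) (cstar (ent X j i) : uca_ring A).

Lemma ent_cadj X i j : ent (cadj X) i j = cstar (ent X j i).
Proof. by rewrite /ent mxE. Qed.

Lemma cadjD X Y : cadj (X + Y) = cadj X + cadj Y.
Proof. by apply: cmxP => i j; rewrite entD !ent_cadj entD cstarD. Qed.
Lemma cadjN X : cadj (- X) = - cadj X.
Proof. by apply: cmxP => i j; rewrite entN !ent_cadj entN cstarN. Qed.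
Lemma cadjB X Y : cadj (X - Y) = cadj X - cadj Y.
Proof. by rewrite cadjD cadjN. Qed.
Lemma cadjZ a X : cadj (a *: X) = a^* *: cadj X.
Proof. by apply: cmxP => i j; rewrite entZ !ent_cadj entZ cstarZ. Qed.
Lemma cadjK X : cadj (cadj X) = X.
Proof. by apply: cmxP => i j; rewrite !ent_cadj cstarK. Qed.
Lemma cadj1 : cadj 1 = 1.
Proof.
by apply: cmxP => i j; rewrite ent_cadj !ent1 eq_sym; case: eqP; rewrite ?cstar1 ?cstar0.
Qed.
Lemma cadj0 : cadj 0 = 0.
Proof. by apply: cmxP => i j; rewrite ent_cadj !ent0 cstar0. Qed.
Lemma cadjM X Y : cadj (X * Y) = cadj Y * cadj X.
Proof.
apply: cmxP => i j; rewrite ent_cadj !entM cstar_sum.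
by apply: eq_bigr => l _; rewrite cstarM !ent_cadj.
Qed.

(** Not the C*-norm, but equivalent to it and submultiplicative, so that it
    serves for limits.  Bounds by [1] for the C*-norm become bounds by a
    constant, hence the insistence on power boundedness below. *)
Definition cnm X : R := \sum_i \sum_j rnorm (ent X i j).

Lemma cnm_ge0 X : 0 <= cnm X.
Proof. by apply: sumr_ge0 => i _; apply: sumr_ge0 => j _; apply: rnorm_ge0. Qed.

Lemma cnm0 : cnm 0 = 0.
Proof. by rewrite /cnm big1 // => i _; rewrite big1 // => j _; rewrite ent0 rnorm0. Qed.

Lemma cnmD X Y : cnm (X + Y) <= cnm X + cnm Y.
Proof.
rewrite /cnm -big_split; apply: ler_sum => i _; rewrite -big_split /=.
by apply: ler_sum => j _; rewrite entD rnormD.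
Qed.

Lemma cnmZ a X : cnm (a *: X) = cabs a * cnm X.
Proof.
rewrite /cnm mulr_sumr; apply: eq_bigr => i _; rewrite mulr_sumr.
by apply: eq_bigr => j _; rewrite entZ rnormZ.
Qed.

Lemma cnmN X : cnm (- X) = cnm X.
Proof. by rewrite -scaleN1r cnmZ cabsN cabs1 mul1r. Qed.

Lemma cnmM X Y : cnm (X * Y) <= cnm X * cnm Y.
Proof.
rewrite /cnm mulr_suml; apply: ler_sum => i _.
apply: (@le_trans _ _ (\sum_j \sum_l rnorm (ent X i l) * rnorm (ent Y l j))).
  apply: ler_sum => j _; rewrite entM; apply: le_trans (rnorm_sum _ _ _) _.
  by apply: ler_sum => l _; apply: rnormM.
rewrite exchange_big /= mulr_suml; apply: ler_sum => l _.
rewrite -mulr_sumr ler_wpM2l ?rnorm_ge0 // [leRHS](bigD1 l) //= lerDl.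
by apply: sumr_ge0 => i' _; apply: sumr_ge0 => j _; apply: rnorm_ge0.
Qed.

Lemma cnm_ent X i j : rnorm (ent X i j) <= cnm X.
Proof.
rewrite /cnm (bigD1 i) //= (bigD1 j) //= -addrA lerDl addr_ge0 //.
  by apply: sumr_ge0 => l _; apply: rnorm_ge0.
by apply: sumr_ge0 => l _; apply: sumr_ge0 => j' _; apply: rnorm_ge0.
Qed.

Lemma cnm_adj X : cnm (cadj X) = cnm X.
Proof.
rewrite /cnm exchange_big; apply: eq_bigr => i _; apply: eq_bigr => j _.
by rewrite ent_cadj rnorm_star.
Qed.

Lemma cnm_eq0 X : cnm X = 0 -> X = 0.
Proof.
move=> X0; apply: cmxP => i j; rewrite ent0; apply: rnorm_eq0.
by apply/eqP; rewrite eq_le rnorm_ge0 andbT -X0 cnm_ent.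
Qed.

Lemma cmx_eq X Y : (forall e, 0 < e -> cnm (X - Y) <= e) -> X = Y.
Proof.
move=> H; apply/eqP; rewrite -subr_eq0; apply/eqP; apply: cnm_eq0; apply/eqP.
rewrite eq_le cnm_ge0 andbT; apply/ler_addgt0Pl => e e0.
by rewrite addr0 H.
Qed.

Lemma cmx_complete (x : nat -> M) : seq_cauchy cnm x -> exists l, seq_conv cnm x l.
Proof.
move=> cx.
have /choice [l Hl] (ij : 'I_k * 'I_k) :
    exists l, seq_conv (@rnorm R A) (fun m => ent (x m) ij.1 ij.2) l.
  apply: complete_seq_conv => e e0; have [N HN] := cx e e0; exists N => m /HN.
  by apply: le_trans; rewrite -entN -entD cnm_ent.
exists (\matrix_(i, j) (l (i, j) : uca_ring A)) => e e0.
have K0 : 0 < (k * k)%:R + 1 :> R by rewrite ltr_wpDl.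
have ev : \forall m \near \oo, forall ij : 'I_k * 'I_k,
    rnorm (ent (x m) ij.1 ij.2 - l ij) <= e / ((k * k)%:R + 1).
  apply: filter_forall => ij; have [N HN] := Hl ij _ (divr_gt0 e0 K0).
  by exists N => // m; apply: HN.
have [N _ HN] := ev; exists N => m /HN {}HN.
apply: (@le_trans _ _ (\sum_(i < k) \sum_(j < k) e / ((k * k)%:R + 1))).
  apply: ler_sum => i _; apply: ler_sum => j _.
  by have := HN (i, j); rewrite entD entN /ent mxE.
rewrite !sumr_const !card_ord -mulrnA -(mulr_natl (e / _)) mulrA ler_pdivrMr // mulrC.
by apply: ler_wpM2l; [apply: ltW|rewrite lerDl].
Qed.

End Cmx.

(** * Square roots and absolute values *)

Section SquareRoots.
Variables (R : realType) (A : unital_cstar_algebra R) (k : nat).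
Local Notation C := R[i].
Local Notation M := (cmx A k).
Local Notation cv := (seq_conv (@cnm R A k)).
Implicit Types X Y Z T : M.

Lemma cv_unique x X Y : cv x X -> cv x Y -> X = Y.
Proof.
move=> xX xY; apply: cmx_eq => e e0; have e2 : 0 < e / 2 by rewrite divr_gt0.
have [N HN] := xX _ e2; have [K HK] := xY _ e2.
have := HK _ (leq_maxr N K); have := HN _ (leq_maxl N K).
have := cnmD (- (x (maxn N K) - X)) (x (maxn N K) - Y).
rewrite cnmN opprB subrKA => H H1 H2.
exact: le_split2 H H1 H2.
Qed.

Lemma cv_const X : cv (fun=> X) X.
Proof. by move=> e e0; exists 0%N => m _; rewrite subrr cnm0 ltW. Qed.

Lemma cvS x X : cv x X -> cv (fun m => x m.+1) X.
Proof. by move=> xX e e0; have [N HN] := xX e e0; exists N => m Nm; apply: HN; rewrite leqW. Qed.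

Lemma cmx_cvD x y X Y : cv x X -> cv y Y -> cv (fun m => x m + y m) (X + Y).
Proof.
move=> xX yY e e0; have e2 : 0 < e / 2 by rewrite divr_gt0.
have [N HN] := xX _ e2; have [K HK] := yY _ e2.
exists (maxn N K) => m; rewrite geq_max => /andP[/HN H1 /HK H2].
rewrite opprD addrACA; exact: le_split2 (cnmD _ _) H1 H2.
Qed.

Lemma cmx_cvZ a x X : cv x X -> cv (fun m => a *: x m) (a *: X).
Proof.
move=> xX e e0; have a1 : 0 < cabs a + 1 by rewrite ltr_wpDl // cabs_ge0.
have [N HN] := xX _ (divr_gt0 e0 a1); exists N => m /HN.
rewrite -scalerBr cnmZ ler_pdivlMr // => H; apply: le_trans H.
by rewrite mulrC ler_wpM2l ?cnm_ge0 // lerDl.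
Qed.

Lemma cmx_cvM x y X Y : cv x X -> cv y Y -> cv (fun m => x m * y m) (X * Y).
Proof.
move=> xX yY e e0.
pose K := cnm X + cnm Y + 1; have K0 : 0 < K.
  by rewrite ltr_wpDl // addr_ge0 // cnm_ge0.
pose d := Num.min 1 (e / 2 / K); have e2 : 0 < e / 2 by rewrite divr_gt0.
have d0 : 0 < d by rewrite lt_min ltr01 divr_gt0.
have dK : d * K <= e / 2 by rewrite -ler_pdivlMr // ge_min lexx orbT.
have d1 : d <= 1 by rewrite ge_min lexx.
have [N HN] := xX _ d0; have [L HL] := yY _ d0.
exists (maxn N L) => m; rewrite geq_max => /andP[/HN H1 /HL H2].
have -> : x m * y m - X * Y = (x m - X) * y m + X * (y m - Y).
  by rewrite mulrBl mulrBr subrKA.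
have arith (a b c f : R) : 0 <= a -> f <= c + b -> c <= d -> f <= a + b + 1 by lra.
apply: le_split2 (cnmD _ _) _ _.
  apply: le_trans (cnmM _ _) (le_trans _ dK).
  apply: ler_pM (cnm_ge0 _) (cnm_ge0 _) H1 _.
  have := cnmD (y m - Y) Y; rewrite subrK => H.
  exact: arith (cnm_ge0 X) H H2.
apply: le_trans (cnmM _ _) (le_trans _ dK); rewrite mulrC.
apply: ler_pM (cnm_ge0 _) (cnm_ge0 _) H2 _.
by rewrite /K -addrA lerDl addr_ge0 // cnm_ge0.
Qed.

Lemma cmx_cvJ x X : cv x X -> cv (fun m => cadj (x m)) (cadj X).
Proof.
move=> xX e e0; have [N HN] := xX e e0; exists N => m /HN.
by rewrite -cadjB cnm_adj.
Qed.

Lemma cmx_cvX x X j : cv x X -> cv (fun m => x m ^+ j) (X ^+ j).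
Proof.
move=> xX; elim: j => [|j IH]; first exact: cv_const.
rewrite exprS; have := cmx_cvM xX IH.
by congr seq_conv; apply/funext => m; rewrite exprS.
Qed.

Lemma cv_bound x X c : cv x X -> (forall m, cnm (x m) <= c) -> cnm X <= c.
Proof.
move=> xX xc; apply/ler_addgt0Pl => e e0; have [N HN] := xX e e0.
have := cnmD (- (x N - X)) (x N); rewrite cnmN opprB subrK => H.
by apply: le_trans H (lerD (HN N (leqnn N)) (xc N)).
Qed.

(** The sum of the moduli of the coefficients is recorded because it bounds the
    norm of the linear combination once [P] is bounded, and because it is
    submultiplicative when [P] is closed under products. *)
Inductive hull (P : M -> Prop) : M -> R -> Prop :=
| hull_zero : hull P 0 0
| hull_in X : P X -> hull P X 1
| hull_add X Y a b : hull P X a -> hull P Y b -> hull P (X + Y) (a + b)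
| hull_scale c X a : hull P X a -> hull P (c *: X) (cabs c * a).

Section Hull.
Variable P : M -> Prop.

Lemma hull_ge0 X a : hull P X a -> 0 <= a.
Proof. by elim=> [||*|*] //; rewrite ?addr_ge0 ?mulr_ge0 ?cabs_ge0. Qed.

Lemma hull_norm K X a : (forall Y, P Y -> cnm Y <= K) -> hull P X a -> cnm X <= K * a.
Proof.
move=> PK; elim=> [|Y /PK|Y Z b c _ IHY _ IHZ|c Y b _ IH].
- by rewrite cnm0 mulr0.
- by rewrite mulr1.
- by apply: le_trans (cnmD _ _) _; rewrite mulrDr lerD.
- by rewrite cnmZ mulrCA ler_wpM2l ?cabs_ge0.
Qed.

Hypothesis PM : forall X Y, P X -> P Y -> P (X * Y).

Lemma hull_mul X Y a b : hull P X a -> hull P Y b -> hull P (X * Y) (a * b).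
Proof.
move=> HX HY; elim: HX => [|X' PX|X1 X2 a1 a2 _ IH1 _ IH2|c X' a' _ IH].
- by rewrite !mul0r; apply: hull_zero.
- rewrite mul1r; elim: HY => [|Y' PY|Y1 Y2 b1 b2 _ IH1 _ IH2|c Y' b' _ IH].
  + by rewrite mulr0; apply: hull_zero.
  + exact/hull_in/PM.
  + by rewrite mulrDr; apply: hull_add.
  + by rewrite -cmx_scaleAr; apply: hull_scale.
- by rewrite !mulrDl; apply: hull_add.
- by rewrite -cmx_scaleAl -mulrA; apply: hull_scale.
Qed.

Lemma hull_exp X j : P 1 -> hull P X 1 -> hull P (X ^+ j) 1.
Proof.
move=> P1 HX; elim: j => [|j IH]; first exact: hull_in.
by rewrite exprS -[1]mulr1; apply: hull_mul.
Qed.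

End Hull.

Lemma cabs_half : cabs (2^-1 : C) = 2^-1.
Proof.
have E : (2 : C) = toC 2 by rewrite -[2 : R]/(1 + 1) toCD.
have -> : (2^-1 : C) = toC 2^-1.
  apply: (@mulfI _ (2 : C)); first by rewrite pnatr_eq0.
  by rewrite divff ?pnatr_eq0 // E -toCM divff ?pnatr_eq0.
by rewrite cabs_toC ger0_norm // invr_ge0.
Qed.

(** [1 - sqrt (1 - T)] is the limit of [y_0 = 0, y_{m+1} = (T + y_m^2) / 2].
    The [y_m] and their increments are polynomials in [T] with nonnegative
    coefficients, so that for power bounded [T] their norms are controlled by
    the same iteration on the real number [1], which increases to [1]. *)
Section Iteration.
Variables (T : M) (K : R).
Hypothesis TK : forall j, cnm (T ^+ j) <= K.

Let powT X := exists j, X = T ^+ j.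

Let powT1 : powT 1. Proof. by exists 0%N. Qed.
Let powTM X Y : powT X -> powT Y -> powT (X * Y).
Proof. by move=> [i ->] [j ->]; exists (i + j)%N; rewrite exprD. Qed.
Let powT_le X : powT X -> cnm X <= K.
Proof. by move=> [j ->]. Qed.

Fixpoint sqrt_iter (m : nat) : M :=
  if m is m'.+1 then 2^-1 *: (T + sqrt_iter m' * sqrt_iter m') else 0.

Fixpoint real_iter (m : nat) : R :=
  if m is m'.+1 then 2^-1 * (1 + real_iter m' * real_iter m') else 0.

Lemma hull_sqrt_iter m : hull powT (sqrt_iter m) (real_iter m).
Proof.
elim: m => [|m IH] /=; first exact: hull_zero.
rewrite -cabs_half; apply: hull_scale; apply: hull_add; last exact: hull_mul.
by apply: hull_in; exists 1%N; rewrite expr1.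
Qed.

Lemma hull_sqrt_incr m :
  hull powT (sqrt_iter m.+1 - sqrt_iter m) (real_iter m.+1 - real_iter m).
Proof.
elim: m => [|m IH].
  by rewrite /= !subr0; apply: (hull_sqrt_iter 1).
set y := sqrt_iter m.+1 in IH *; set t := real_iter m.+1 in IH *.
have -> : sqrt_iter m.+2 - y =
    2^-1 *: (y * (y - sqrt_iter m) + (y - sqrt_iter m) * sqrt_iter m).
  rewrite mulrBl mulrBr addrA subrK /= -/y [in X in _ - X]/y /= -scalerBr.
  by rewrite opprD addrACA subrr add0r.
have -> : real_iter m.+2 - t =
    cabs (2^-1 : C) * (t * (t - real_iter m) + (t - real_iter m) * real_iter m).
  have tE : t = 2^-1 * (1 + real_iter m * real_iter m) by [].
  have -> : real_iter m.+2 = 2^-1 * (1 + t * t) by [].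
  rewrite cabs_half.
  apply/eqP; rewrite -subr_eq0; apply/eqP.
  transitivity (2^-1 * (1 + real_iter m * real_iter m) - t); last by rewrite -tE subrr.
  by clearbody t; field.
apply: hull_scale; apply: hull_add; apply: hull_mul => //; exact: hull_sqrt_iter.
Qed.

Lemma real_iter_le1 m : real_iter m <= 1.
Proof.
elim: m => [|m IH] //=; have := hull_ge0 (hull_sqrt_iter m); nra.
Qed.

Lemma sqrt_iter_dist m n : (m <= n)%N ->
  cnm (sqrt_iter n - sqrt_iter m) <= K * (real_iter n - real_iter m).
Proof.
move=> /subnK <-; elim: (n - m)%N => [|i IH].
  by rewrite !add0n !subrr cnm0 mulr0.
have H := hull_norm powT_le (hull_sqrt_incr (i + m)).
rewrite addSn -[sqrt_iter (i + m).+1 - _](subrKA (sqrt_iter (i + m))).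
apply: le_trans (cnmD _ _) _.
rewrite -[real_iter _ - real_iter m](subrKA (real_iter (i + m))) mulrDr.
exact: lerD.
Qed.

Lemma sqrt_exists : exists Y : M,
  [/\ (1 - Y) * (1 - Y) = 1 - T, forall j, cnm (Y ^+ j) <= K,
      cadj T = T -> cadj Y = Y & forall Z, Z * T = T * Z -> Z * Y = Y * Z].
Proof.
have K0 : 0 <= K by apply: le_trans (TK 0); apply: cnm_ge0.
have [Y cY] : exists Y, cv sqrt_iter Y.
  apply: cmx_complete => e e0.
  have K1 : 0 < K + 1 by rewrite ltr_wpDl.
  have ubt : has_sup (range real_iter).
    by split; [exists (real_iter 0), 0%N|exists 1 => _ [m _ <-]; apply: real_iter_le1].
  have [_ [N _ <-] HN] := sup_adherent (divr_gt0 e0 K1) ubt.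
  exists N => m Nm; apply: le_trans (sqrt_iter_dist Nm) _.
  have tm : real_iter m <= sup (range real_iter) by apply: (ub_le_sup ubt.2); exists m.
  have : real_iter m - real_iter N <= e / (K + 1) by lra.
  move/(ler_wpM2l K0) => H; apply: le_trans H _.
  rewrite mulrCA; apply: ler_piMr; first exact: ltW.
  by rewrite ler_pdivrMr // mul1r lerDl.
have Yeq : Y = 2^-1 *: (T + Y * Y).
  apply: (cv_unique (cvS cY)) => /=.
  exact/cmx_cvZ/cmx_cvD/cmx_cvM/cY/cY/cv_const.
exists Y; split.
- have Y2 : Y + Y = T + Y * Y.
    rewrite {1 2}Yeq -scalerDl [2^-1 + _](_ : _ = 1) ?scale1r //.
    by rewrite -[_^-1]mul1r -splitr.
  rewrite mulrBl mul1r mulrBr mulr1 opprB [Y * Y - Y]addrC addrA -(addrA 1) -opprD.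
  by rewrite Y2 opprD addrA subrK.
- move=> j; apply: (cv_bound (cmx_cvX j cY)) => m.
  have H : hull powT (sqrt_iter m ^+ j) (real_iter m ^+ j).
    elim: j => [|j IH]; first exact: hull_in.
    by rewrite !exprS; apply: hull_mul => //; apply: hull_sqrt_iter.
  apply: le_trans (hull_norm powT_le H) _; rewrite ler_piMr // exprn_ile1 //.
    exact: hull_ge0 (hull_sqrt_iter m).
  exact: real_iter_le1.
- move=> TJ; apply: (cv_unique (cmx_cvJ cY)).
  have -> // : (fun m => cadj (sqrt_iter m)) = sqrt_iter.
  apply/funext; elim=> [|m IH] /=; first exact: cadj0.
  rewrite cadjZ cadjD cadjM IH TJ; congr (_ *: _).
  by rewrite fmorphV rmorph_nat.
- move=> Z ZT; apply: (cv_unique (cmx_cvM (cv_const Z) cY)).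
  have -> : (fun m => Z * sqrt_iter m) = (fun m => sqrt_iter m * Z).
    apply/funext; elim=> [|m IH] /=; first by rewrite mul0r mulr0.
    rewrite -cmx_scaleAl -cmx_scaleAr mulrDr mulrDl ZT; congr (_ *: (_ + _)).
    by rewrite mulrA IH -mulrA IH mulrA.
  exact: cmx_cvM cY (cv_const Z).
Qed.

End Iteration.

(** In every C*-algebra [a_j^* a_j] is dominated by [\sum_i a_i^* a_i]; here
    only the norm inequality matters. *)
Hypothesis norm_sum_sqr : forall (a : 'I_k -> A) j,
  rnorm (a j) ^+ 2 <= rnorm (\sum_i cmul (cstar (a i)) (a i)).

Lemma rnorm_cone : rnorm (cone A) <= 1.
Proof.
have := rnorm_cstar (cone A); rewrite cstar1 cmul1x.
have := rnorm_ge0 (cone A); move: (rnorm _) => r; nra.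
Qed.

Let Kk : R := (k * k)%:R + 1.

Definition unitary_cmx X := cadj X * X = 1 /\ X * cadj X = 1.

Lemma unitary_cmx1 : unitary_cmx 1.
Proof. by rewrite /unitary_cmx cadj1 mulr1. Qed.

Lemma unitary_cmxM X Y : unitary_cmx X -> unitary_cmx Y -> unitary_cmx (X * Y).
Proof.
move=> [X1 X2] [Y1 Y2]; rewrite /unitary_cmx cadjM; split.
  by rewrite -mulrA (mulrA _ X) X1 mul1r.
by rewrite -mulrA (mulrA Y) Y2 mul1r.
Qed.

(** The entries of a unitary have norm at most [1], because the entries [a_i]
    of a column satisfy [\sum_i a_i^* a_i = 1]. *)
Lemma unitary_cmx_norm X : unitary_cmx X -> cnm X <= Kk.
Proof.
move=> [X1 _]; apply: (@le_trans _ _ (k * k)%:R); last by rewrite lerDl.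
apply: (@le_trans _ _ (\sum_(i < k) \sum_(j < k) 1)); last first.
  by rewrite !sumr_const !card_ord -mulrnA.
apply: ler_sum => i _; apply: ler_sum => j _.
rewrite -(@ler_pXn2r _ 2) // ?nnegrE ?rnorm_ge0 // expr1n.
apply: le_trans (norm_sum_sqr (fun l => ent X l j) i) _.
have := congr1 (fun Z : M => ent Z j j) X1; rewrite entM ent1 eqxx.
under eq_bigr => l _ do rewrite ent_cadj.
by move=> ->; apply: rnorm_cone.
Qed.

Lemma cabs_inv2i : cabs ((2 * 'i)^-1 : C) = 2^-1.
Proof.
rewrite invfM cabsM cabs_half -[RHS]mulr1; congr (_ * _).
by rewrite /cabs normfV normCi invr1.
Qed.

(** For small [X], the element [U = X + i sqrt (1 - X^2)] is unitary, and
    [sqrt (1 - X^2)], its imaginary part, is in the absolutely convex hull of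
    [U] and [U^*].  So [1 - X^2] is power bounded, [X^2] has a square root
    [|X|], and that has a square root as well. *)
Lemma abs_value_small X : cadj X = X -> cnm X <= 1 -> exists S,
  [/\ cadj S = S, (S * S) * (S * S) = X * X & S * X = X * S].
Proof.
move=> XJ X1.
have XX j : cnm ((X * X) ^+ j) <= cnm (1 : M) + 1.
  case: j => [|j]; first by rewrite expr0 lerDl.
  apply: (@le_trans _ _ 1); last by rewrite lerDr cnm_ge0.
  have x2 : cnm (X * X) <= 1.
    by apply: le_trans (cnmM _ _) _; rewrite mulr_ile1 ?cnm_ge0.
  elim: j => [|j IH]; first by rewrite expr1.
  by rewrite exprS; apply: le_trans (cnmM _ _) _; rewrite mulr_ile1 ?cnm_ge0.
have [Y1 [Y1sq _ Y1J Y1C]] := sqrt_exists XX.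
pose W := 1 - Y1; have WW : W * W = 1 - X * X by [].
have WJ : cadj W = W by rewrite /W cadjB cadj1 Y1J // cadjM XJ.
have WX : W * X = X * W.
  by rewrite /W mulrBl mulrBr mul1r mulr1 Y1C // mulrA.
pose U := X + 'i *: W; pose V := X - 'i *: W.
have UJ : cadj U = V by rewrite /U cadjD cadjZ XJ WJ conjCi scaleNr.
have ii : 'i * 'i = -1 :> C by rewrite -expr2 sqrCi.
have UV : U * V = 1.
  rewrite /U /V mulrDl !mulrBr -!cmx_scaleAl -!cmx_scaleAr WX WW scalerA.
  by rewrite ii scaleN1r opprK subrKA addrC subrK.
have VU : V * U = 1.
  rewrite /U /V mulrBl !mulrDr -!cmx_scaleAl -!cmx_scaleAr WX WW scalerA.
  by rewrite ii scaleN1r opprB addrACA subrr addr0 addrC subrK.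
have unU : unitary_cmx U by rewrite /unitary_cmx UJ.
have unV : unitary_cmx V by rewrite /unitary_cmx -UJ cadjK UJ.
have hW : hull unitary_cmx W 1.
  have -> : W = (2 * 'i)^-1 *: (U + (-1) *: V).
    rewrite /U /V scaleN1r opprB addrC subrKA -scalerDl scalerA.
    have -> : 'i + 'i = 2 * 'i :> C by rewrite mulr_natl mulr2n.
    by rewrite mulVf ?scale1r // mulf_neq0 ?neq0Ci ?pnatr_eq0.
  have -> : 1 = cabs ((2 * 'i)^-1 : C) * (1 + cabs (-1 : C) * 1).
    by rewrite cabs_inv2i cabsN cabs1 mulr1 mulVf.
  by apply: hull_scale; apply: hull_add; [|apply: hull_scale]; apply: hull_in.
have TK j : cnm ((W * W) ^+ j) <= Kk.
  have hWW : hull unitary_cmx (W * W) 1.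
    by have := hull_mul unitary_cmxM hW hW; rewrite mulr1.
  have := hull_norm unitary_cmx_norm (hull_exp unitary_cmxM j unitary_cmx1 hWW).
  by rewrite mulr1.
have [Y2 [Y2sq Y2K Y2J Y2C]] := sqrt_exists TK.
have [Y3 [Y3sq _ Y3J Y3C]] := sqrt_exists Y2K.
have cadjY2 : cadj Y2 = Y2 by rewrite Y2J // cadjM WJ.
exists (1 - Y3); split.
- by rewrite cadjB cadj1 Y3J.
- by rewrite Y3sq Y2sq WW opprB addrC subrK.
- have XW : X * (W * W) = (W * W) * X by rewrite -[RHS]mulrA WX !mulrA WX.
  by rewrite mulrBl mulrBr mul1r mulr1 -Y3C // -Y2C.
Qed.

Lemma abs_value X : cadj X = X -> exists S,
  [/\ cadj S = S, (S * S) * (S * S) = X * X & S * X = X * S].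
Proof.
move=> XJ; pose c := cnm X + 1; have c0 : 0 < c by rewrite ltr_wpDl ?cnm_ge0.
have [||S [SJ SS SX]] := @abs_value_small (toC c^-1 *: X).
- by rewrite cadjZ conj_toC XJ.
- rewrite cnmZ cabs_toC ger0_norm ?invr_ge0; last exact: ltW.
  rewrite mulrC ler_pdivrMr // mul1r.
  by rewrite lerDl.
have cc : toC c * toC c^-1 = 1 by rewrite -toCM divff ?gt_eqF.
pose r := toC (Num.sqrt c).
have rr : r * r = toC c by rewrite -toCM -expr2 sqr_sqrtr // ltW.
exists (r *: S); split.
- by rewrite cadjZ conj_toC SJ.
- rewrite !cmx_scaleM SS cmx_scaleM scalerA -[RHS]scale1r; congr (_ *: _).
  by rewrite !rr mulrACA cc mulr1.
- have {}SX : S * X = X * S.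
    have := congr1 (fun Z => toC c *: Z) SX.
    by rewrite -cmx_scaleAl -cmx_scaleAr !scalerA cc !scale1r.
  by rewrite -cmx_scaleAl -cmx_scaleAr SX.
Qed.

End SquareRoots.

(** * Positivity detected by finite-dimensional representations *)

Lemma mx_rep1 (R : realType) (G : groupType) n (sigma : G -> 'M[R[i]]_n) :
  mx_unitary_rep sigma -> sigma 1%g = 1%:M.
Proof.
move=> [sU sM]; have := congr1 (mulmx ((sigma 1%g)^t* )) (sM 1%g 1%g).
by rewrite mulg1 mulmxA unitarymx_adjl // mul1mx.
Qed.

Section Density.
Variables (R : realType) (G : groupType).
Local Notation C := R[i].
Variables (A : unital_cstar_algebra R) (u : G -> A).
Hypothesis fullA : is_full_group_cstar u.

Lemma full_approx (a : A) (e : R) : 0 < e -> exists s, rnorm (a - lc u s) <= e.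
Proof. by move=> e0; have [s /ltW] := full_dense fullA a e0; exists s. Qed.

(** Applied to the norm of the defect of an identity between continuous maps,
    this reduces the identity to elements of the group algebra. *)
Lemma dense_le0 (g : A -> R) (K : R) :
  (forall x p, g x <= K * rnorm (x - lc u p)) -> forall x, g x <= 0.
Proof.
move=> H x; apply/ler_addgt0Pl => e e0; rewrite addr0.
have K1 : 0 < `|K| + 1 by rewrite ltr_wpDl.
have [p Hp] := full_approx x (divr_gt0 e0 K1); apply: le_trans (H x p) _.
apply: (@le_trans _ _ (`|K| * (e / (`|K| + 1)))).
  apply: (@le_trans _ _ (`|K| * rnorm (x - lc u p))); last exact: ler_wpM2l.
  by apply: ler_wpM2r; rewrite ?rnorm_ge0 ?ler_norm.
rewrite mulrCA; apply: ler_piMr; first exact: ltW.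
by rewrite ler_pdivrMr // mul1r lerDl.
Qed.

Lemma full_norm_sum_sqr k (a : 'I_k -> A) j :
  rnorm (a j) ^+ 2 <= rnorm (\sum_i cmul (cstar (a i)) (a i)).
Proof.
apply/ler_addgt0Pl => d d0; rewrite addrC.
pose M := \sum_i rnorm (a i).
have aM i : rnorm (a i) <= M.
  by rewrite /M (bigD1 i) //= lerDl sumr_ge0 // => l _; apply: rnorm_ge0.
have M0 : 0 <= M by apply: sumr_ge0 => i _; apply: rnorm_ge0.
pose K := k%:R * (2 * M + 1) + (2 * M + 3).
have K0 : 0 < K by rewrite ltr_wpDl ?mulr_ge0 // ?addr_ge0 ?mulr_ge0 // ltr_wpDl // mulr_ge0.
pose e := Num.min 1 (d / K).
have e0 : 0 < e by rewrite lt_min ltr01 divr_gt0.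
have e1 : e <= 1 by rewrite ge_min lexx.
have eK : e * K <= d by rewrite -ler_pdivlMr // ge_min lexx orbT.
have /choice [s Hs] i : exists s, rnorm (a i - lc u s) <= e by apply: full_approx.
have sM i : rnorm (lc u (s i)) <= M + e.
  apply: le_trans (rnorm_le_dist _ (a i)) _; rewrite rnorm_dist.
  by rewrite lerD.
have sq i : rnorm (cmul (cstar (lc u (s i))) (lc u (s i)) - cmul (cstar (a i)) (a i))
    <= e * (2 * M + 1).
  have -> : cmul (cstar (lc u (s i))) (lc u (s i)) - cmul (cstar (a i)) (a i) =
    cmul (cstar (lc u (s i) - a i)) (lc u (s i)) + cmul (cstar (a i)) (lc u (s i) - a i).
    by rewrite cstarB cmulBl cmulBr subrKA.
  apply: le_trans (rnormD _ _) _.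
  have H1 := rnormM (cstar (lc u (s i) - a i)) (lc u (s i)).
  have H2 := rnormM (cstar (a i)) (lc u (s i) - a i).
  rewrite !rnorm_star (rnorm_dist (lc u _)) in H1 H2.
  move: (Hs i) (sM i) (aM i) (rnorm_ge0 (a i)) (rnorm_ge0 (a i - lc u (s i)))
    (rnorm_ge0 (lc u (s i))) H1 H2.
  move: (rnorm (a i)) (rnorm (lc u (s i))) (rnorm (a i - lc u (s i))).
  move: (rnorm (cmul _ _)) (rnorm (cmul _ _)) => r1 r2 x y z; nra.
have H1 := full_lc_norm_sum_sqr fullA s j.
have H2 : rnorm (\sum_i cmul (cstar (lc u (s i))) (lc u (s i))) <=
    rnorm (\sum_i cmul (cstar (a i)) (a i)) + k%:R * (e * (2 * M + 1)).
  apply: le_trans (rnorm_le_dist _ (\sum_i cmul (cstar (a i)) (a i))) _.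
  rewrite lerD2l -sumrB; apply: le_trans (rnorm_sum _ _ _) _.
  rewrite mulr_natl -[k in _ *+ k]card_ord -sumr_const.
  by apply: ler_sum => i _; apply: sq.
have H3 := rnorm_le_dist (a j) (lc u (s j)).
have arith (x y z v w c : R) : z <= e -> y <= M + e -> 0 <= x -> 0 <= y -> 
    y ^+ 2 <= v -> v <= w + c * (e * (2 * M + 1)) -> x <= y + z ->
    e * (c * (2 * M + 1) + (2 * M + 3)) <= d -> x ^+ 2 <= w + d.
  move=> ze yM x0 y0 yv vw xy cd; have xe : x <= y + e by lra.
  have H4 : x ^+ 2 <= (y + e) ^+ 2 by rewrite ler_pXn2r // nnegrE // addr_ge0 // ltW.
  have H5 : y * e <= (M + e) * e by rewrite ler_wpM2r // ltW.
  have H6 : e * e <= e * 1 by rewrite ler_wpM2l // ltW.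
  by move: H4; rewrite sqrrD; lra.
exact: arith (Hs j) (sM j) (rnorm_ge0 _) (rnorm_ge0 _) H1 H2 H3 eK.
Qed.

Section Extension.
Variables (n : nat) (sigma : G -> 'M[C]_n) (s : A -> 'M[C]_n).
Hypothesis sigmaU : mx_unitary_rep sigma.
Hypothesis sE : rep_extension u sigma s.

Lemma ext_linear a x y : s (a *: x + y) = a *: s x + s y.
Proof. by case: sE => + _ _; apply. Qed.

Lemma ext0 : s 0 = 0.
Proof. by have := ext_linear (-1) 0 0; rewrite scaler0 addr0 scaleN1r addNr. Qed.

Lemma extD x y : s (x + y) = s x + s y.
Proof. by have := ext_linear 1 x y; rewrite !scale1r. Qed.

Lemma extZ a x : s (a *: x) = a *: s x.
Proof. by have := ext_linear a x 0; rewrite !addr0 ext0 addr0. Qed.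

Lemma extB x y : s (x - y) = s x - s y.
Proof. by rewrite extD -scaleN1r extZ scaleN1r. Qed.

Lemma ext_sum (I : Type) (r : seq I) (P : pred I) (F : I -> A) :
  s (\sum_(i <- r | P i) F i) = \sum_(i <- r | P i) s (F i).
Proof. by elim/big_rec2: _ => [|i a b _ <-]; rewrite ?ext0 ?extD. Qed.

Lemma ext_lc p : s (lc u p) = lc sigma p.
Proof.
rewrite /lc ext_sum; apply: eq_bigr => q _; rewrite extZ.
by case: sE => _ _ ->.
Qed.

Lemma ext_norm x : mx_opnorm (s x) <= rnorm x.
Proof. by case: sE => _ + _; apply. Qed.

Lemma lc_mx_rep_mul p q : lc sigma (fs_mul p q) = lc sigma p *m lc sigma q.
Proof.
rewrite lc_mul /lc mulmx_suml; apply: eq_bigr => i _.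
rewrite mulmx_sumr; apply: eq_bigr => j _.
by rewrite -scalemxAl -scalemxAr scalerA; case: sigmaU => _ ->.
Qed.

Lemma mx_rep_adj g : sigma g^-1%g = (sigma g)^t*.
Proof.
have [sU sM] := sigmaU.
by rewrite -[LHS]mul1mx -(unitarymx_adjl (sU g)) -mulmxA -sM mulgV (mx_rep1 sigmaU) mulmx1.
Qed.

Lemma lc_mx_rep_star p : lc sigma (fs_star p) = (lc sigma p)^t*.
Proof.
rewrite /lc big_map; elim: p => [|q p IH]; first by rewrite !big_nil adjmx0.
by rewrite !big_cons IH adjmxD adjmxZ -mx_rep_adj.
Qed.

(** The defect [f] of multiplicativity is a bounded bilinear map, which
    vanishes when both arguments come from the group algebra. *)
Lemma extM x y : s (cmul x y) = s x *m s y.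
Proof.
pose f x y := s (cmul x y) - s x *m s y.
have fB x1 x2 y' : f x1 y' - f x2 y' = f (x1 - x2) y'.
  by rewrite /f cmulBl !extB mulmxBl !opprB addrACA [RHS]addrACA [- _ - _]addrC.
have fBr x' y1 y2 : f x' y1 - f x' y2 = f x' (y1 - y2).
  by rewrite /f cmulBr !extB mulmxBr !opprB addrACA [RHS]addrACA [- _ - _]addrC.
have fnorm x' y' : mx_opnorm (f x' y') <= 2 * rnorm x' * rnorm y'.
  apply: le_trans (opnormB _ _) _; rewrite -mulrA mulr2n mulrDl mul1r.
  apply: lerD; first exact: le_trans (ext_norm _) (rnormM _ _).
  apply: le_trans (opnormM _ _) _.
  exact: ler_pM (opnorm_ge0 _) (opnorm_ge0 _) (ext_norm _) (ext_norm _).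
have f0 p q : f (lc u p) (lc u q) = 0.
  rewrite /f -(lc_cmul (full_uM fullA)) !ext_lc lc_mx_rep_mul subrr //.
have f1 p y' : f (lc u p) y' = 0.
  apply: opnorm_eq0; apply/eqP; rewrite eq_le opnorm_ge0 andbT.
  apply: (@dense_le0 (fun y => mx_opnorm (f (lc u p) y)) (2 * rnorm (lc u p))) => z q.
  by rewrite -[f _ z]subr0 -(f0 p q) fBr.
apply/eqP; rewrite -subr_eq0 -/(f x y); apply/eqP.
apply: opnorm_eq0; apply/eqP; rewrite eq_le opnorm_ge0 andbT.
apply: (@dense_le0 (fun x => mx_opnorm (f x y)) (2 * rnorm y)) => z q.
by rewrite -[f z y]subr0 -(f1 q y) fB mulrAC.
Qed.

Lemma ext_star x : s (cstar x) = (s x)^t*.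
Proof.
apply/eqP; rewrite -subr_eq0; apply/eqP.
apply: opnorm_eq0; apply/eqP; rewrite eq_le opnorm_ge0 andbT.
apply: (@dense_le0 (fun x => mx_opnorm (s (cstar x) - (s x)^t* )) 2) => z p.
have -> : s (cstar z) - (s z)^t* = s (cstar (z - lc u p)) - (s (z - lc u p))^t*.
  rewrite cstarB !extB adjmxB -(lc_cstar (full_uV fullA)) !ext_lc lc_mx_rep_star.
  by rewrite opprB subrKA.
apply: le_trans (opnormB _ _) _; rewrite opnorm_adj mulr2n mulrDl mul1r.
apply: lerD; last exact: ext_norm.
by apply: le_trans (ext_norm _) _; rewrite rnorm_star.
Qed.

(** A positive functional on matrices over [A], which is zero at [X^* X] only
    if [s] kills all entries of [X]. *)
Definition ext_trace k (X : cmx A k) : C := \sum_i \tr (s (ent X i i)).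

Lemma ext_traceD k (X Y : cmx A k) : ext_trace (X + Y) = ext_trace X + ext_trace Y.
Proof.
rewrite /ext_trace -big_split; apply: eq_bigr => i _.
by rewrite entD extD mxtraceD.
Qed.

Lemma ext_trace0 k : ext_trace (0 : cmx A k) = 0.
Proof. by rewrite /ext_trace big1 // => i _; rewrite ent0 ext0 mxtrace0. Qed.

Lemma trace_adj_mul p m (Y : 'M[C]_(p, m)) : \tr (Y^t* *m Y) = \sum_i \sum_j Y j i * (Y j i)^*.
Proof.
apply: eq_bigr => i _; rewrite mxE; apply: eq_bigr => j _.
by rewrite !mxE mulrC.
Qed.

Lemma ext_trace_sqr k (X : cmx A k) :
  ext_trace (cadj X * X) = \sum_i \sum_l \tr ((s (ent X l i))^t* *m s (ent X l i)).
Proof.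
apply: eq_bigr => i _; rewrite entM ext_sum raddf_sum /=; apply: eq_bigr => l _.
by rewrite extM ent_cadj ext_star.
Qed.

Lemma trace_adj_mul_ge0 p m (Y : 'M[C]_(p, m)) : 0 <= \tr (Y^t* *m Y).
Proof.
rewrite trace_adj_mul; apply: sumr_ge0 => i _; apply: sumr_ge0 => j _.
exact: mul_conjC_ge0.
Qed.

Lemma trace_adj_mul_eq0 p m (Y : 'M[C]_(p, m)) : \tr (Y^t* *m Y) = 0 -> Y = 0.
Proof.
rewrite trace_adj_mul => /eqP; rewrite psumr_eq0 => [/allP H|i _]; last first.
  by apply: sumr_ge0 => j _; apply: mul_conjC_ge0.
apply/matrixP => j i; rewrite mxE; apply/eqP.
have := H i (mem_index_enum _); rewrite psumr_eq0 => [/allP /(_ j (mem_index_enum _))|l _].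
  by rewrite mul_conjC_eq0.
exact: mul_conjC_ge0.
Qed.

Lemma ext_trace_sqr_ge0 k (X : cmx A k) : 0 <= ext_trace (cadj X * X).
Proof.
rewrite ext_trace_sqr; apply: sumr_ge0 => i _; apply: sumr_ge0 => l _.
exact: trace_adj_mul_ge0.
Qed.

Lemma ext_trace_sqr_eq0 k (X : cmx A k) : ext_trace (cadj X * X) = 0 ->
  forall l i, s (ent X l i) = 0.
Proof.
rewrite ext_trace_sqr => /eqP; rewrite psumr_eq0 => [/allP H l i|i _]; last first.
  by apply: sumr_ge0 => j _; apply: trace_adj_mul_ge0.
have := H i (mem_index_enum _); rewrite psumr_eq0 => [/allP /(_ l (mem_index_enum _))|j _].
  by move=> /eqP /trace_adj_mul_eq0.
exact: trace_adj_mul_ge0.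
Qed.

End Extension.

Hypothesis rfd : forall a : A, a <> 0 ->
  exists (n : nat) (sigma : G -> 'M[C]_n) (s : A -> 'M[C]_n),
    [/\ mx_unitary_rep sigma, rep_extension u sigma s & s a <> 0].

Lemma rfd_separates k (X : cmx A k) :
  (forall n (sigma : G -> 'M[C]_n) s, mx_unitary_rep sigma -> rep_extension u sigma s ->
     ext_trace s (cadj X * X) = 0) -> X = 0.
Proof.
move=> H; apply: cmxP => i j; rewrite ent0; apply: contrapT => /rfd.
move=> [n [sigma [s [sU sE nz]]]]; apply: nz.
by have := ext_trace_sqr_eq0 sU sE (H n sigma s sU sE); apply.
Qed.

(** With [|X| = S^2] and [D = |X| - X], positivity of [X] in a
    finite-dimensional representation makes both terms of
    [0 = D (X + |X|) D = D X D + (S D)^* (S D)] positive there, hence zero;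
    this gives [S D = 0], and then [D = 0]. *)
Lemma rfd_positive k (X : cmx A k) : cadj X = X ->
  (forall n (sigma : G -> 'M[C]_n) s, mx_unitary_rep sigma -> rep_extension u sigma s ->
     forall Y : cmx A k, 0 <= ext_trace s (cadj Y * X * Y)) ->
  exists S, X = cadj S * S.
Proof.
move=> XJ Xpos; have [S [SJ SS SX]] := abs_value (@full_norm_sum_sqr k) XJ.
pose Q := S * S; pose D := Q - X.
have QX : Q * X = X * Q by rewrite /Q -mulrA SX mulrA SX mulrA.
have DJ : cadj D = D by rewrite /D cadjB XJ cadjM SJ.
have XQD : (X + Q) * D = 0.
  rewrite /D mulrDl !mulrBr -/Q -QX [Q * Q]SS.
  by rewrite addrA subrK subrr.
have split0 : D * X * D + cadj (S * D) * (S * D) = 0.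
  have -> : cadj (S * D) * (S * D) = D * Q * D by rewrite cadjM SJ DJ /Q !mulrA.
  by rewrite -mulrDl -mulrDr -mulrA XQD mulr0.
have SD : S * D = 0.
  apply: rfd_separates => n sigma s sU sE.
  have H1 := Xpos n sigma s sU sE D; rewrite DJ in H1.
  have H2 := ext_trace_sqr_ge0 sU sE (S * D).
  have := congr1 (@ext_trace n s k) split0; rewrite (ext_traceD sE) (ext_trace0 sE).
  by move=> /eqP; rewrite paddr_eq0 // => /andP[_ /eqP].
have QD : Q * D = 0 by rewrite /Q -mulrA SD mulr0.
have XD : X * D = 0 by move: XQD; rewrite mulrDl QD addr0.
have D0 : D = 0.
  apply: rfd_separates => n sigma s sU sE.
  by rewrite DJ {1}/D mulrBl QD XD subrr (ext_trace0 sE).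
by exists S; apply/eqP; rewrite SJ eq_sym -subr_eq0; apply/eqP.
Qed.

End Density.

(** * Independence of the completion *)

Section Transfer.
Variables (R : realType) (G : groupType).
Local Notation C := R[i].
Variables (A1 A2 : unital_cstar_algebra R) (u1 : G -> A1) (u2 : G -> A2).
Hypothesis full1 : is_full_group_cstar u1.
Hypothesis full2 : is_full_group_cstar u2.

Lemma full_norm_eq s : rnorm (lc u1 s) = rnorm (lc u2 s).
Proof.
have [a aE] := lc_fsfun s; rewrite -!aE.
by case: full1 => _ _ _ -> _; case: full2 => _ _ _ -> _.
Qed.

(** The graph of the isomorphism of [A2] with [A1]. *)
Definition corr (a : A2) (b : A1) := forall e, 0 < e -> exists p,
  rnorm (a - lc u2 p) <= e /\ rnorm (b - lc u1 p) <= e.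

Lemma corr_total a : exists b, corr a b.
Proof.
have /choice [s Hs] m : exists s, rnorm (a - lc u2 s) <= half_pow R m.+2.
  exact/(full_approx full2)/half_pow_gt0.
have [|b Hb] := @complete_seq_conv _ A1 (fun m => lc u1 (s m)).
  apply: (rapid_cauchy (@rnormD R A1) (@rnorm0 R A1)) => m.
  rewrite -lc_sub full_norm_eq lc_sub.
  have := rnormD (- (a - lc u2 (s m.+1))) (a - lc u2 (s m)).
  rewrite opprB subrKA -(rnormN (lc u2 _ - a)) opprB.
  move: (Hs m) (Hs m.+1) (half_powS R m) (half_powS R m.+1) (half_powS R m.+2)
    (half_pow_gt0 R m.+2).
  move: (rnorm _) (rnorm _) (rnorm _) => r1 r2 r3; lra.
exists b => e e0; have [M HM] := Hb e e0; have [K HK] := half_pow_small e0.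
exists (s (maxn M K)); split.
  apply: le_trans (Hs _) (le_trans _ HK); apply: half_pow_le.
  by do 2!apply: leqW; apply: leq_maxr.
by rewrite rnorm_dist; apply: HM; rewrite leq_maxl.
Qed.

Lemma corrD a a' b b' : corr a b -> corr a' b' -> corr (a + a') (b + b').
Proof.
move=> ab ab' e e0; have e2 : 0 < e / 2 by rewrite divr_gt0.
have [p [p1 p2]] := ab _ e2; have [q [q1 q2]] := ab' _ e2; exists (p ++ q).
rewrite !lc_cat !opprD !(addrACA _ _ (- _)); split.
  exact: le_split2 (rnormD _ _) p1 q1.
exact: le_split2 (rnormD _ _) p2 q2.
Qed.

Lemma corr0 : corr 0 0.
Proof. by move=> e e0; exists [::]; rewrite !lc_nil !subrr !rnorm0 ltW. Qed.

Lemma corr_sum (I : Type) (r : seq I) (F : I -> A2) (F' : I -> A1) :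
  (forall i, corr (F i) (F' i)) -> corr (\sum_(i <- r) F i) (\sum_(i <- r) F' i).
Proof.
move=> H; elim: r => [|i r IH]; first by rewrite !big_nil; apply: corr0.
by rewrite !big_cons; apply: corrD.
Qed.

Lemma corr_star a b : corr a b -> corr (cstar a) (cstar b).
Proof.
move=> ab e e0; have [p [p1 p2]] := ab e e0; exists (fs_star p).
rewrite (lc_cstar (full_uV full1)) (lc_cstar (full_uV full2)).
by rewrite -!cstarB !rnorm_star.
Qed.

Lemma cmul_near (A : unital_cstar_algebra R) (u : G -> A) x y p q (K d e : R) :
  is_full_group_cstar u -> 0 <= K -> rnorm x <= K -> rnorm y <= K -> 0 <= d ->
  d <= 1 -> d * (2 * K + 1) <= e -> rnorm (x - lc u p) <= d -> rnorm (y - lc u q) <= d ->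
  rnorm (cmul x y - lc u (fs_mul p q)) <= e.
Proof.
move=> fullA K0 xK yK d0 d1 dK Hp Hq.
apply: le_trans (pb_mul_bound K0 xK yK d0 d1 dK).
rewrite (lc_cmul (full_uM fullA)).
have -> : cmul x y - cmul (lc u p) (lc u q) =
  cmul x (y - lc u q) + cmul (x - lc u p) (lc u q) by rewrite cmulBr cmulBl subrKA.
apply: le_trans (rnormD _ _) _; apply: lerD.
  by apply: le_trans (rnormM _ _) _; rewrite ler_wpM2l ?rnorm_ge0.
apply: le_trans (rnormM _ _) _; apply: ler_pM; rewrite ?rnorm_ge0 //.
have := rnorm_le_dist (lc u q) y; rewrite rnorm_dist => H.
by apply: le_trans H _; rewrite lerD2l.
Qed.

Lemma corr_mul a a' b b' : corr a b -> corr a' b' -> corr (cmul a a') (cmul b b').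
Proof.
move=> ab ab' e e0.
pose K := rnorm a + rnorm a' + (rnorm b + rnorm b').
have [a0 a'0] := (rnorm_ge0 a, rnorm_ge0 a').
have [b0 b'0] := (rnorm_ge0 b, rnorm_ge0 b').
have K0 : 0 <= K by rewrite /K; lra.
have K1 : 0 < 2 * K + 1 by rewrite ltr_wpDl // mulr_ge0.
pose d := Num.min 1 (e / (2 * K + 1)).
have d0 : 0 < d by rewrite lt_min ltr01 divr_gt0.
have d1 : d <= 1 by rewrite ge_min lexx.
have dK : d * (2 * K + 1) <= e by rewrite -ler_pdivlMr // ge_min lexx orbT.
have [p [p1 p2]] := ab _ d0; have [q [q1 q2]] := ab' _ d0; exists (fs_mul p q).
by split; [apply: cmul_near full2 K0 _ _ (ltW d0) d1 dK p1 q1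
          |apply: cmul_near full1 K0 _ _ (ltW d0) d1 dK p2 q2]; rewrite /K; lra.
Qed.

Lemma corr_lc p b : corr (lc u2 p) b -> b = lc u1 p.
Proof.
move=> pb; apply/eqP; rewrite -subr_eq0; apply/eqP; apply: rnorm_small_eq0 => e e0.
have e2 : 0 < e / 2 by rewrite divr_gt0.
have [q [q2 q1]] := pb _ e2.
have := rnormD (b - lc u1 q) (- (lc u1 p - lc u1 q)).
rewrite opprB subrKA rnorm_dist -(rnorm_dist (lc u1 p)) -lc_sub full_norm_eq lc_sub.
rewrite rnorm_dist => H; apply: le_split2 H q1 q2.
Qed.

Lemma transfer_positive k (x : 'I_k -> 'I_k -> seq (C * G)) (S : cmx A2 k) :
  (forall i j, lc u2 (x i j) = ent (cadj S * S) i j) ->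
  mx_positive (\matrix_(i, j) lc u1 (x i j) : 'M[A1]_k).
Proof.
move=> xS.
have /choice [Y HY] (ij : 'I_k * 'I_k) : exists b, corr (ent S ij.1 ij.2) b.
  exact: corr_total.
exists (\matrix_(i, j) Y (i, j)); apply/matrixP => i j; rewrite !mxE.
apply/esym/corr_lc; rewrite xS entM; apply: corr_sum => l.
rewrite ent_cadj !mxE; apply: corr_mul; last exact: (HY (l, j)).
exact: (corr_star (HY (l, i))).
Qed.

End Transfer.

(** The completion with the lifting property and the one whose points are
    separated by finite-dimensional representations may differ; the square root
    found in the second is carried over to the first. *)
Lemma matrix_positive (R : realType) (G : groupType) (A : unital_cstar_algebra R)
    (u : G -> A) k (x : 'I_k -> 'I_k -> seq (R[i] * G)) :
  group_RFD R G -> is_full_group_cstar u ->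
  (forall (V : lmodType R[i]) (f : G -> V) i j, lc f (x j i) = lc f (fs_star (x i j))) ->
  (forall n (sigma : G -> 'M[R[i]]_n) (V : 'M[R[i]]_(n, k)), mx_unitary_rep sigma ->
     0 <= \sum_a \sum_b (V^t* *m lc sigma (x a b) *m V) a b) ->
  mx_positive (\matrix_(i, j) lc u (x i j) : 'M[A]_k).
Proof.
move=> [A2 [u2 [full2 rfd]]] fullA xJ xpos.
pose X : cmx A2 k := \matrix_(i, j) (lc u2 (x i j) : uca_ring A2).
have entX i j : ent X i j = lc u2 (x i j) by rewrite /ent mxE.
have [||S XS] := rfd_positive full2 rfd (X := X).
- by apply: cmxP => i j; rewrite ent_cadj !entX -(lc_cstar (full_uV full2)) xJ.
- move=> n sigma s sU sE Y.
  pose V i c : 'M[R[i]]_(n, k) := \matrix_(d, b) s (ent Y b i) d c.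
  suff -> : ext_trace s (cadj Y * X * Y) =
      \sum_i \sum_c \sum_a \sum_b ((V i c)^t* *m lc sigma (x a b) *m V i c) a b.
    by apply: sumr_ge0 => i _; apply: sumr_ge0 => c _; apply: xpos.
  apply: eq_bigr => i _; rewrite -mulrA entM (ext_sum sE) raddf_sum /=.
  rewrite [RHS]exchange_big; apply: eq_bigr => a _ /=.
  rewrite [RHS]exchange_big /= entM cmul_sumr (ext_sum sE) raddf_sum /=.
  apply: eq_bigr => b _; apply: eq_bigr => c _.
  rewrite !(extM full2 sU sE) ent_cadj (ext_star full2 sU sE) entX (ext_lc sE).
  rewrite mulmxA !mxE; apply: eq_bigr => d _; congr (_ * _); last by rewrite mxE.
  by rewrite !mxE; apply: eq_bigr => d' _; rewrite !mxE.
by apply: (transfer_positive fullA full2 (S := S)) => i j; rewrite -entX XS.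
Qed.

(** * Compressions of finite-dimensional representations *)

Lemma snorm_perturb (R : realType) (V : lmodType R[i]) (B : sip V) (x y : V) (t : R) :
  snorm B (x - toC t *: y) ^+ 2 =
  snorm B x ^+ 2 - 2 * t * complex.Re (B y x) + t ^+ 2 * snorm B y ^+ 2.
Proof.
rewrite !snorm_sqr ipBl !ipBr !ipZl !ipZr conj_toC !ReB !Re_toCM.
have -> : complex.Re (B x y) = complex.Re (B y x) by rewrite ip_conj ReJ.
ring.
Qed.

Section Compressions.
Variables (R : realType) (G : groupType).
Local Notation C := R[i].

Definition compression k d (pi : G -> 'M[C]_d) (v : 'M[C]_(d, k)) (g : G) : 'M[C]_k :=
  v^t* *m pi g *m v.

Lemma compression1 k d (pi : G -> 'M[C]_d) (v : 'M[C]_(d, k)) :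
  mx_unitary_rep pi -> compression pi v 1%g = v^t* *m v.
Proof. by move=> piU; rewrite /compression mx_rep1 // mulmx1. Qed.

Definition compressions k : set (G -> 'M[C]_k) := [set c |
  exists d (pi : G -> 'M[C]_d) (v : 'M[C]_(d, k)),
    mx_unitary_rep pi /\ c = compression pi v].

Lemma adjmx_col_mx k d e (v : 'M[C]_(d, k)) (w : 'M[C]_(e, k)) :
  (col_mx v w)^t* = row_mx (v^t* ) (w^t* ).
Proof. by rewrite tr_col_mx map_row_mx. Qed.

Lemma compressions_add k (c c' : G -> 'M[C]_k) :
  compressions c -> compressions c' -> compressions (fun g => c g + c' g).
Proof.
move=> [d [pi [v [[piU piM] ->]]]] [e [tau [w [[tauU tauM] ->]]]].
exists (d + e)%N, (fun g => block_mx (pi g) 0 0 (tau g)), (col_mx v w); split.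
  split=> [g|g h].
    apply/unitarymxP; rewrite tr_block_mx map_block_mx !trmx0 !map_mx0 mulmx_block.
    rewrite !mul0mx !mulmx0 !addr0 !add0r !(unitarymxP _) ?piU ?tauU //.
    by rewrite -scalar_mx_block.
  by rewrite mulmx_block !mul0mx !mulmx0 !addr0 !add0r piM tauM.
apply/funext => g; rewrite /compression adjmx_col_mx mul_row_block !mulmx0 addr0 add0r.
by rewrite mul_row_col.
Qed.

Lemma compressions_scale k (c : G -> 'M[C]_k) (t : R) : 0 <= t ->
  compressions c -> compressions (fun g => toC t *: c g).
Proof.
move=> t0 [d [pi [v [piU ->]]]]; exists d, pi, (toC (Num.sqrt t) *: v); split=> //.
apply/funext => g; rewrite /compression adjmxZ conj_toC -scalemxAr -!scalemxAl.
by rewrite scalerA -toCM -expr2 sqr_sqrtr.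
Qed.

Lemma trivial_rep_unitary k : mx_unitary_rep (fun _ : G => 1%:M : 'M[C]_k).
Proof.
split=> [g|g h]; last by rewrite mulmx1.
by apply/unitarymxP; rewrite adjmx1 mulmx1.
Qed.

Lemma compressions_const k (w : 'M[C]_k) : compressions (fun _ => w^t* *m w).
Proof.
exists k, (fun=> 1%:M), w; split; first exact: trivial_rep_unitary.
by apply/funext => g; rewrite /compression mulmx1.
Qed.

Lemma compressions0 k : compressions (fun _ => 0 : 'M[C]_k).
Proof.
have := compressions_const (0 : 'M[C]_k); congr compressions.
by apply/funext => g; rewrite mulmx0.
Qed.

(** * Approximation of a completely positive map on finitely many elements *)

Section Cone.
Variables (k m : nat) (F : 'I_m -> G).

Definition fam := 'I_m -> 'M[C]_k.

Definition fam_ip_fun (x y : fam) : C := \sum_i \sum_a \sum_b x i a b * (y i a b)^*.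

Definition fam_ip : @sip R ('I_m -> 'M[C]_k).
Proof.
apply: (@Sip _ _ fam_ip_fun).
- move=> c x y z; rewrite /fam_ip_fun mulr_sumr -big_split /=.
  apply: eq_bigr => i _; rewrite mulr_sumr -big_split /=.
  apply: eq_bigr => a _; rewrite mulr_sumr -big_split /=.
  by apply: eq_bigr => b _; rewrite !mxE mulrDl mulrA.
- move=> x y; rewrite /fam_ip_fun rmorph_sum; apply: eq_bigr => i _.
  rewrite rmorph_sum; apply: eq_bigr => a _; rewrite rmorph_sum; apply: eq_bigr => b _.
  by rewrite rmorphM /= conjCK mulrC.
- move=> x; do 3!(apply: sumr_ge0 => ? _); exact: mul_conjC_ge0.
Defined.

Local Notation fnorm := (snorm fam_ip).

Lemma fnorm_entry (x : fam) i a b : cabs (x i a b) <= fnorm x.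
Proof.
rewrite -(@ler_pXn2r _ 2) // ?nnegrE ?cabs_ge0 ?snorm_ge0 // snorm_sqr.
have pos i' a' b' : 0 <= complex.Re (x i' a' b' * (x i' a' b')^*).
  by rewrite Re_ge0 // mul_conjC_ge0.
rewrite -[fam_ip x x]/(fam_ip_fun x x) /fam_ip_fun.
rewrite Re_sum (bigD1 i) //= Re_sum (bigD1 a) //= Re_sum (bigD1 b) //= -cabs_sqr.
rewrite -!addrA lerDl !addr_ge0 //.
- by apply: sumr_ge0 => b' _; apply: pos.
- by apply: sumr_ge0 => a' _; rewrite Re_sum; apply: sumr_ge0 => b' _; apply: pos.
- apply: sumr_ge0 => i' _; rewrite Re_sum; apply: sumr_ge0 => a' _.
  by rewrite Re_sum; apply: sumr_ge0 => b' _; apply: pos.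
Qed.

Lemma compression_entry d (pi : G -> 'M[C]_d) (v : 'M[C]_(d, k)) g a b :
  compression pi v g a b = l2ip R d (pi g *m col b v) (col a v).
Proof.
rewrite -[RHS]/(l2ip_fun _ _) /l2ip_fun /compression -mulmxA mxE.
apply: eq_bigr => i _; rewrite !mxE mulrC; congr (_ * _).
by apply: eq_bigr => j _; rewrite !mxE.
Qed.

Lemma trace_l2norm d (v : 'M[C]_(d, k)) :
  complex.Re (\tr (v^t* *m v)) = \sum_a l2norm (col a v) ^+ 2.
Proof.
rewrite Re_sum; apply: eq_bigr => a _; rewrite l2norm_sqr; congr complex.Re.
rewrite mxE -[RHS]/(l2ip_fun _ _) /l2ip_fun; apply: eq_bigr => i _.
by rewrite !mxE mulrC.
Qed.

(** [|<pi(g) v_b, v_a>| <= |v_a| |v_b|], so compressions are controlled by their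
    value at [1]: a small multiple of the trace absorbs the error of an
    approximate separation. *)
Lemma fnorm_compression d (pi : G -> 'M[C]_d) (v : 'M[C]_(d, k)) :
  mx_unitary_rep pi ->
  fnorm (fun i => compression pi v (F i)) <= (m%:R + 1) * complex.Re (\tr (v^t* *m v)).
Proof.
move=> [piU _]; set t := complex.Re _.
have t0 : 0 <= t by rewrite /t trace_l2norm; apply: sumr_ge0 => a _; apply: exprn_ge0 (l2norm_ge0 _).
have m0 := ler0n R m.
rewrite -(@ler_pXn2r _ 2) // ?nnegrE ?snorm_ge0 ?mulr_ge0 ?addr_ge0 // snorm_sqr.
apply: (@le_trans _ _ (m%:R * t ^+ 2)); last first.
  by rewrite exprMn ler_wpM2r ?exprn_ge0 //; nra.
rewrite -[fam_ip _ _]/(fam_ip_fun _ _) /fam_ip_fun Re_sum mulr_natl.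
rewrite -[m in _ *+ m]card_ord -sumr_const; apply: ler_sum => i _.
rewrite expr2 {1}/t trace_l2norm mulr_suml Re_sum; apply: ler_sum => a _.
rewrite /t trace_l2norm mulr_sumr Re_sum; apply: ler_sum => b _.
rewrite -cabs_sqr -exprMn; rewrite ler_pXn2r // ?nnegrE ?cabs_ge0 ?mulr_ge0 ?l2norm_ge0 //.
rewrite compression_entry; apply: le_trans (cauchy_schwarz _ _ _) _.
by rewrite -!l2normE unitary_l2norm // mulrC.
Qed.

(** A near-minimizer [c] of the distance from [theta] to the cone of
    compressions is also close to the minimum in every direction of the cone,
    and in the direction [- c]; so [w = theta - c] defines a functional that
    is almost negative on the cone and almost vanishes at [c].  The
    hypothesis then bounds it at [theta], which gives [|w|^2]. *)
Lemma cone_approx (theta : fam) (M : R) :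
  (forall (w : fam) (kappa : R), 0 <= kappa ->
     (forall d (pi : G -> 'M[C]_d) (v : 'M[C]_(d, k)), mx_unitary_rep pi ->
        complex.Re (fam_ip (fun i => compression pi v (F i)) w) <=
        kappa * complex.Re (\tr (v^t* *m v))) ->
     complex.Re (fam_ip theta w) <= kappa * M) ->
  forall e, 0 < e -> exists2 c, @compressions k c & fnorm (theta - (fun i => c (F i)) : fam) <= e.
Proof.
move=> Hpos e e0.
pose dist2 := [set fnorm (theta - (fun i => c (F i)) : fam) ^+ 2 | c in @compressions k].
have lb0 : lbound dist2 0 by move=> _ [c _ <-]; rewrite exprn_ge0 // snorm_ge0.
have inf2 : has_inf dist2.
  split; last by exists 0.
  by exists (fnorm (theta - (fun i => 0) : fam) ^+ 2), (fun=> 0); first exact: compressions0.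
pose D := inf dist2.
have DL c : compressions c -> D <= fnorm (theta - (fun i => c (F i)) : fam) ^+ 2.
  by move=> cc; apply: ge_inf; [exact: inf2.2|exists c].
pose L : R := m%:R + 1; have L1 : 1 <= L by rewrite /L lerDr.
pose N : R := fnorm theta + fnorm theta + 1.
have th0 : 0 <= fnorm theta := snorm_ge0 _ _.
have N1 : 1 <= N by rewrite /N; lra.
pose K := L * `|M| + N; have K0 : 0 < K.
  by rewrite /K; have := normr_ge0 M; nra.
pose delta := Num.min 1 (e ^+ 2 / K).
have d0 : 0 < delta by rewrite lt_min ltr01 divr_gt0 // exprn_gt0.
have d1 : delta <= 1 by rewrite ge_min lexx.
have dK : delta * K <= e ^+ 2 by rewrite -ler_pdivlMr // ge_min lexx orbT.
have [_ [c cc <-] cD] := inf_adherent (exprn_gt0 2 d0) inf2.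
rewrite -/D in cD; pose w : fam := theta - (fun i => c (F i)).
exists c => //; rewrite -/w in cD *.
have w0 : 0 <= fnorm w := snorm_ge0 _ _.
have perturb (c' : fam) (t : R) :
    fnorm (w - toC t *: c') ^+ 2 =
    fnorm w ^+ 2 - 2 * t * complex.Re (fam_ip c' w) + t ^+ 2 * fnorm c' ^+ 2.
  exact: snorm_perturb.
have dir d (pi : G -> 'M[C]_d) (v : 'M[C]_(d, k)) : mx_unitary_rep pi ->
    complex.Re (fam_ip (fun i => compression pi v (F i)) w) <=
    delta * L * complex.Re (\tr (v^t* *m v)).
  move=> piU; set c' : fam := fun i => _; set T := complex.Re (\tr _).
  have HT : fnorm c' <= L * T by apply: fnorm_compression.
  have c'0 : 0 <= fnorm c' := snorm_ge0 _ _.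
  have [LT|LT] := leP (L * T) 0.
    apply: le_trans (Re_le_cabs _) _; apply: le_trans (cauchy_schwarz _ _ _) _.
    have -> : fnorm c' = 0 by lra.
    by rewrite mul0r -mulrA mulr_ge0 ?(ltW d0) // (le_trans c'0 HT).
  pose t := delta / (L * T); have t0 : 0 < t by rewrite divr_gt0.
  have tLT : t * (L * T) = delta by rewrite divfK // gt_eqF.
  have := DL (fun g => c g + toC t *: compression pi v g).
  have -> : theta - (fun i => c (F i) + toC t *: compression pi v (F i)) = w - toC t *: c'.
    by rewrite /w /c'; apply/funext => i; rewrite -[LHS]/(theta i - _) opprD addrA.
  rewrite perturb => H; have {}H := H _.
  have {}H : D <= fnorm w ^+ 2 - 2 * t * complex.Re (fam_ip c' w) + t ^+ 2 * fnorm c' ^+ 2.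
    apply: H; apply: compressions_add => //; apply: compressions_scale; first exact: ltW.
    by exists d, pi, v.
  have H2 : t ^+ 2 * fnorm c' ^+ 2 <= delta ^+ 2.
    rewrite -exprMn -tLT; apply: le_sqr; first exact: mulr_ge0 (ltW t0) c'0.
    exact: ler_wpM2l (ltW t0) _ _ HT.
  rewrite -mulrA -(ler_pM2l t0) [leRHS](_ : _ = delta * (t * (L * T))); last by ring.
  rewrite tLT; move: (complex.Re (fam_ip c' w)) H H2 cD => z; nra.
have H1 : complex.Re (fam_ip theta w) <= delta * L * M.
  by apply: Hpos dir; rewrite mulr_ge0 ?ltW //; apply: lt_le_trans L1.
have cN : fnorm (fun i => c (F i)) <= N.
  have H := snormB fam_ip theta w; have E : theta - w = (fun i => c (F i)) by rewrite /w subKr.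
  rewrite E in H; apply: le_trans H _; rewrite /N -addrA lerD2l.
  have D0 : D <= fnorm theta ^+ 2.
    have := DL _ (compressions0 k); have -> // : theta - (fun=> 0) = theta by apply: subr0.
  have : fnorm w ^+ 2 < (fnorm theta + 1) ^+ 2.
    by apply: lt_le_trans cD _; rewrite sqrrD; nra.
  by rewrite ltr_pXn2r ?nnegrE ?addr_ge0 // => /ltW.
have H2 : - (delta * N) <= complex.Re (fam_ip (fun i => c (F i)) w).
  pose t := delta / N; have N0 : 0 < N by apply: lt_le_trans N1.
  have t0 : 0 < t by rewrite divr_gt0.
  have tN : t * N = delta by rewrite divfK // gt_eqF.
  have t1 : t <= 1 by rewrite ler_pdivrMr // mul1r; apply: le_trans N1.
  have := DL (fun g => toC (1 - t) *: c g).
  have -> : theta - (fun i => toC (1 - t) *: c (F i)) = w - toC (- t) *: (fun i => c (F i)).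
    rewrite /w; apply/funext => i; rewrite -[LHS]/(theta i - _) -[RHS]/(theta i - c (F i) - _).
    by rewrite toCB toCN scalerBl scaleNr scale1r opprB opprK addrA addrAC.
  rewrite perturb => H.
  have {}H : D <= fnorm w ^+ 2 - 2 * - t * complex.Re (fam_ip (fun i => c (F i)) w) +
     (- t) ^+ 2 * fnorm (fun i => c (F i)) ^+ 2.
    by apply: H; apply: compressions_scale => //; rewrite subr_ge0.
  have H3 : (- t) ^+ 2 * fnorm (fun i => c (F i)) ^+ 2 <= delta ^+ 2.
    rewrite sqrrN -exprMn -tN; apply: le_sqr; first exact: mulr_ge0 (ltW t0) (snorm_ge0 _ _).
    exact: ler_wpM2l (ltW t0) _ _ cN.
  rewrite -(ler_pM2l t0) [leLHS](_ : _ = - (delta * (t * N))); last by ring.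
  rewrite tN; move: (complex.Re _) H H3 cD => z; nra.
have ww : fnorm w ^+ 2 <= e ^+ 2.
  apply: le_trans dK; rewrite snorm_sqr {1}/w ipBl ReB.
  have dL0 : 0 <= delta * L by rewrite mulr_ge0 ?(ltW d0) // (le_trans ler01 L1).
  have arith (x y p q r : R) : x <= p -> - q <= y -> p <= r -> x - y <= r + q by lra.
  by rewrite /K mulrDr mulrA; apply: arith H1 H2 (ler_wpM2l dL0 (ler_norm M)).
by move: ww; rewrite ler_pXn2r // nnegrE // ltW.
Qed.

End Cone.
End Compressions.

(** * Functionals as positive matrices over the group algebra *)

Section TestMatrix.
Variables (R : realType) (G : groupType) (k m : nat) (F : 'I_m -> G).
Local Notation C := R[i].
Variables (w : 'I_m -> 'M[C]_k) (kappa : R).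

(** The entry [(a, b)] of the self-adjoint matrix over the group algebra which
    represents the functional [x |-> kappa tr x(1) - Re <x, w>] on maps [x]
    with values in [M_k]. *)
Definition test_fsum (a b : 'I_k) : seq (C * G) :=
  [seq (- 2^-1 * (w i a b)^*, F i) | i <- index_enum 'I_m] ++
  [seq (- 2^-1 * w i b a, (F i)^-1%g) | i <- index_enum 'I_m] ++
  [:: (if a == b then toC kappa else 0, 1%g)].

Lemma lc_test (V : lmodType C) (f : G -> V) a b : lc f (test_fsum a b) =
  \sum_i (- 2^-1 * (w i a b)^* ) *: f (F i) +
  (\sum_i (- 2^-1 * w i b a) *: f (F i)^-1%g +
   (if a == b then toC kappa else 0) *: f 1%g).
Proof.
by rewrite /test_fsum !lc_cat /lc !big_map big_cons big_nil addr0.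
Qed.

Lemma lc_test_star (V : lmodType C) (f : G -> V) a b :
  lc f (test_fsum b a) = lc f (fs_star (test_fsum a b)).
Proof.
have halfJ : (- 2^-1 : C)^* = - 2^-1 by rewrite rmorphN fmorphV rmorph_nat.
have starE (I : Type) (r : seq I) (al : I -> C) (h : I -> G) :
    lc f (fs_star [seq (al i, h i) | i <- r]) = \sum_(i <- r) (al i)^* *: f (h i)^-1%g.
  by rewrite /lc /fs_star !big_map.
rewrite lc_test /test_fsum {1}/fs_star !map_cat !lc_cat -!/(fs_star _) !starE.
rewrite addrCA; congr (_ + (_ + _)).
- by apply: eq_bigr => i _; rewrite rmorphM /= halfJ conjCK.
- by apply: eq_bigr => i _; rewrite rmorphM /= halfJ invgK.
- rewrite /lc /fs_star big_map big_cons big_nil addr0 /fst /snd invg1 eq_sym.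
  by case: eqP => _; rewrite ?conj_toC ?conjC0.
Qed.

Lemma test_pairing (f : G -> 'M[C]_k) : (forall i, f (F i)^-1%g = (f (F i))^t* ) ->
  \sum_a \sum_b lc f (test_fsum a b) a b =
  toC kappa * \tr (f 1%g) - toC (complex.Re (@fam_ip R k m (fun i => f (F i)) w)).
Proof.
move=> fV; set z := fam_ip R k m _ _.
have zE : z = \sum_a \sum_b \sum_i f (F i) a b * (w i a b)^*.
  transitivity (\sum_i \sum_a \sum_b f (F i) a b * (w i a b)^* ); first by [].
  by rewrite exchange_big; apply: eq_bigr => a _; rewrite exchange_big.
have -> : toC (complex.Re z) = 2^-1 * z + 2^-1 * z^*.
  rewrite -mulrDr; apply: (@mulfI _ (2 : C)); first by rewrite pnatr_eq0.
  rewrite mulrA divff ?pnatr_eq0 // mul1r; case: (z) => p q.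
  by apply/eqP; rewrite eq_complex /=; apply/andP; split; apply/eqP; ring.
have entry a b : lc f (test_fsum a b) a b =
    - 2^-1 * (\sum_i f (F i) a b * (w i a b)^* ) +
    - 2^-1 * (\sum_i f (F i) b a * (w i b a)^* )^* +
    (if a == b then toC kappa * f 1%g a b else 0).
  rewrite lc_test !mxE !summxE addrA; congr (_ + _ + _).
  - by rewrite mulr_sumr; apply: eq_bigr => i _; rewrite mxE; ring.
  - rewrite rmorph_sum mulr_sumr; apply: eq_bigr => i _.
    by rewrite fV !mxE rmorphM /= conjCK; ring.
  - by case: eqP => _; rewrite ?mul0r.
under eq_bigr => a _ do (under eq_bigr => b _ do rewrite entry).
under eq_bigr => a _ do rewrite !big_split /=.
rewrite !big_split /= addrC opprD; congr (_ + (_ + _)).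
- rewrite /mxtrace mulr_sumr; apply: eq_bigr => a _.
  rewrite (bigD1 a) //= eqxx big1 ?addr0 // => b; rewrite eq_sym.
  by move=> /negbTE ->.
- rewrite zE -mulNr mulr_sumr; apply: eq_bigr => a _.
  by rewrite mulr_sumr.
- rewrite zE exchange_big /= rmorph_sum -mulNr mulr_sumr; apply: eq_bigr => b _.
  by rewrite rmorph_sum mulr_sumr.
Qed.

End TestMatrix.

Section CpApprox.
Variables (R : realType) (G : groupType).
Local Notation C := R[i].
Hypothesis G_RFD : group_RFD R G.

Lemma lc_compression d j (pi : G -> 'M[C]_d) (v : 'M[C]_(d, j)) s :
  v^t* *m lc pi s *m v = lc (compression pi v) s.
Proof.
rewrite /lc mulmx_sumr mulmx_suml; apply: eq_bigr => p _.
by rewrite -scalemxAr -scalemxAl.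
Qed.

Lemma compression_adj d j (pi : G -> 'M[C]_d) (v : 'M[C]_(d, j)) g :
  mx_unitary_rep pi -> compression pi v g^-1%g = (compression pi v g)^t*.
Proof. by move=> piU; rewrite /compression !adjmxM adjmxK (mx_rep_adj piU) mulmxA. Qed.

(** The pairing of the positive matrix [Y^* Y] over [M_j] with the vector
    [\sum_a e_a (x) e_a]. *)
Lemma sum_adj_mul_ge0 j (Y : 'I_j -> 'I_j -> 'M[C]_j) :
  0 <= \sum_a \sum_b (\sum_l (Y l a)^t* *m Y l b) a b.
Proof.
have -> : \sum_a \sum_b (\sum_l (Y l a)^t* *m Y l b) a b =
    \sum_l \sum_e (\sum_b Y l b e b) * (\sum_a Y l a e a)^*.
  under eq_bigr => a _ do (under eq_bigr => b _ do rewrite summxE).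
  under eq_bigr => a _ do rewrite exchange_big /=.
  rewrite exchange_big /=; apply: eq_bigr => l _.
  under [RHS]eq_bigr => e _ do rewrite rmorph_sum /= mulr_sumr.
  rewrite [RHS]exchange_big /=; apply: eq_bigr => a _.
  under [RHS]eq_bigr => e _ do rewrite mulr_suml.
  rewrite [RHS]exchange_big /=; apply: eq_bigr => b _.
  by rewrite mxE; apply: eq_bigr => e _; rewrite !mxE mulrC.
by apply: sumr_ge0 => l _; apply: sumr_ge0 => e _; apply: mul_conjC_ge0.
Qed.

(** The cone of compressions contains [psi o u] in its closure, for every map
    [psi] on the span of finitely many group elements that preserves positive
    matrices: a functional that is nonnegative on compressions is a positive
    matrix over the C*-algebra of [G], by residual finite-dimensionality. *)
Lemma cp_compression_approx (A : unital_cstar_algebra R) (u : G -> A) j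
    (psi : A -> 'M[C]_j) (L Fs : seq G) :
  is_full_group_cstar u ->
  1%g \in L -> (forall g, g \in L -> g^-1%g \in L) -> {subset Fs <= L} ->
  (forall a x y, fs_span u L x -> fs_span u L y -> psi (a *: x + y) = a *: psi x + psi y) ->
  (forall m (X : 'M[A]_m), (forall i l, fs_span u L (X i l)) -> mx_positive X ->
     exists Y : 'I_m -> 'I_m -> 'M[C]_j,
     forall i l, psi (X i l) = \sum_h (Y h i)^t* *m Y h l) ->
  forall e, 0 < e -> exists2 c, @compressions R G j c &
    forall g, g \in Fs -> mx_opnorm (psi (u g) - c g) <= e.
Proof.
move=> fullA L1 LV FL lin pos.
pose f g := psi (u g).
have psi0 : psi 0 = 0.
  have S0 : fs_span u L 0 by exists [::]; rewrite lc_nil.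
  by have := lin (-1) 0 0 S0 S0; rewrite scaler0 addr0 scaleN1r addNr.
have psi_lc s : all (fun p => p.2 \in L) s -> psi (lc u s) = lc f s.
  elim: s => [|p s IH] /=; first by rewrite !lc_nil.
  move=> /andP[pL sL]; rewrite !lc_cons lin ?IH //; first exact: fs_span_u.
  by exists s.
(* The positive matrix [1, u; u^*, 1] has a positive, so self-adjoint, image. *)
have fV g : g \in L -> f g^-1%g = (f g)^t*.
  move=> gL; pose gs (i : 'I_2) := if i == ord0 then 1%g else g.
  pose Z : 'M[A]_2 := \matrix_(i, l) (if i == ord0 then u (gs l) else 0).
  pose X := mx_cmul (mx_cstar Z) Z.
  have XE i l : X i l = u ((gs i)^-1 * gs l)%g.
    rewrite mxE big_ord_recl big_ord_recl big_ord0 !mxE /= cmul0r !addr0.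
    by rewrite (full_uM fullA) (full_uV fullA).
  have [i l|//|Y YE] := pos 2 X; last 1 first.
  - have := YE ord0 ord_max; have := YE ord_max ord0; rewrite !XE /gs /=.
    rewrite invg1 mulg1 mul1g -/(f g) -/(f g^-1%g) => -> ->.
    elim/big_rec2: _ => [|h x y _ ->]; first by rewrite adjmx0.
    by rewrite adjmxD adjmxM adjmxK.
  - rewrite XE; apply: fs_span_u; rewrite /gs.
    by case: ifP => _; case: ifP => _; rewrite ?invg1 ?mul1g ?mulg1 ?mulVg // LV.
  - by exists Z.
move=> e e0.
pose F (i : 'I_(size Fs)) := nth 1%g Fs i.
have FsL i : F i \in L by apply/FL/mem_nth.
pose theta : 'I_(size Fs) -> 'M[C]_j := fun i => f (F i).
pose M := complex.Re (\tr (f 1%g)).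
(* A functional nonnegative on compressions is represented by a matrix over [A]
   that is positive in all finite-dimensional representations. *)
have test_pos (w : 'I_(size Fs) -> 'M[C]_j) (kappa : R) : 0 <= kappa ->
    (forall d (pi : G -> 'M[C]_d) (v : 'M[C]_(d, j)), mx_unitary_rep pi ->
        complex.Re (@fam_ip R j (size Fs) (fun i => compression pi v (F i)) w) <=
        kappa * complex.Re (\tr (v^t* *m v))) ->
    complex.Re (fam_ip R j (size Fs) theta w) <= kappa * M.
  move=> k0 Hw; pose x := test_fsum F w kappa.
  have Xpos : mx_positive (\matrix_(a, b) lc u (x a b) : 'M[A]_j).
    apply: matrix_positive => //; first by move=> V h a b; apply: lc_test_star.
    move=> n sigma V sU.
    under eq_bigr => a _ do (under eq_bigr => b _ do rewrite lc_compression).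
    rewrite test_pairing => [|i]; last exact: compression_adj.
    rewrite compression1 // (ge0_toC (trace_adj_mul_ge0 V)) -toCM -toCB -toC0 le_toC subr_ge0.
    exact: Hw.
  have xL a b : all (fun p => p.2 \in L) (x a b).
    rewrite /x /test_fsum !all_cat !all_map /= L1 andbT; apply/andP; split.
      by apply/allP => i _ /=.
    by rewrite andbT; apply/allP => i _ /=; apply: LV.
  have [|Y YE] := pos j _ _ Xpos.
    by move=> a b; rewrite mxE; exists (x a b).
  have := sum_adj_mul_ge0 Y.
  under eq_bigr => a _ do (under eq_bigr => b _ do rewrite -YE mxE psi_lc //).
  rewrite test_pairing => [|i]; last exact: fV.
  by move=> /Re_ge0; rewrite ReB Re_toCM subr_ge0.
have K1 : 0 < (j * j)%:R + 1 :> R by rewrite ltr_wpDl.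
have [c cc Hc] := cone_approx test_pos (divr_gt0 e0 K1).
exists c => // g gF; apply: le_trans (opnorm_le_sum _) _.
apply: (@le_trans _ _ (\sum_(a < j) \sum_(b < j) e / ((j * j)%:R + 1))).
  apply: ler_sum => a _; apply: ler_sum => b _; apply: le_trans Hc.
  have iF : (index g Fs < size Fs)%N by rewrite index_mem.
  have := fnorm_entry (theta - (fun i => c (F i)) : fam R j (size Fs)) (Ordinal iF) a b.
  by rewrite -[(_ - _) _]/(f (F (Ordinal iF)) - c (F (Ordinal iF))) /F /= nth_index.
rewrite !sumr_const !card_ord -mulrnA -(mulr_natl (e / _)) mulrA ler_pdivrMr // mulrC.
by apply: ler_wpM2l; [apply: ltW|rewrite lerDl].
Qed.

End CpApprox.

(** * From compressions to isometric compressions *)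

Section Isometry.
Variables (R : realType) (G : groupType).
Local Notation C := R[i].

Lemma psd_factor k (P : 'M[C]_k) : P^t* = P -> (forall x, 0 <= l2ip R k (P *m x) x) ->
  exists w : 'M[C]_k, w^t* *m w = P.
Proof.
move=> PJ Ppos; have Pn : P \is normalmx by apply/normalmxP; rewrite PJ.
pose U := spectralmx P; have UU : U \is unitarymx := spectral_unitarymx P.
pose d := spectral_diag P.
have PE : P = U^t* *m diag_mx d *m U.
  by have /orthomx_spectralP := Pn; rewrite invmx_unitary.
have d0 i : 0 <= d 0 i.
  have := Ppos (U^t* *m delta_mx i 0); rewrite PE -l2ip_adj !mulmxA (unitarymxP _) //.
  rewrite mul1mx -(mulmxA _ U) (unitarymxP _) // mulmx1 -colE.
  rewrite -[l2ip _ _ _ _]/(l2ip_fun _ _) /l2ip_fun (bigD1 i) //= big1 => [|l li].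
    by rewrite !mxE !eqxx mulr1n conjC1 mulr1 addr0.
  by rewrite [delta_mx i 0 l 0]mxE (negbTE li) conjC0 mulr0.
exists (diag_mx (\row_i sqrtC (d 0 i)) *m U).
rewrite adjmxM [RHS]PE !mulmxA; congr (_ *m _); rewrite -mulmxA; congr (_ *m _).
apply/matrixP => i l; rewrite mul_mx_diag !mxE eq_sym.
case: eqP => [->|_]; last by rewrite !mulr0n conjC0 mul0r.
by rewrite !mulr1n geC0_conj ?sqrtC_ge0 // -expr2 sqrtCK.
Qed.

(** If [c(1) = h] is close to [1], then [h / r <= 1] for some [r] close to
    [1], and adding a multiple [1 - h / r] of the trivial representation to
    [c / r] makes it unital. *)
Lemma unital_compression k (c phi : G -> 'M[C]_k) (Fs : seq G) (e : R) :
  compressions c -> 0 < e -> e <= 1 ->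
  (forall g, mx_opnorm (phi g) <= 1) ->
  mx_opnorm (c 1%g - 1%:M) <= e ->
  (forall g, g \in Fs -> mx_opnorm (c g - phi g) <= e) ->
  exists2 c', @compressions R G k c' &
    c' 1%g = 1%:M /\ forall g, g \in Fs -> mx_opnorm (c' g - phi g) <= 5 * e.
Proof.
move=> cc e0 e1 phi1 c1 cF; have [d [pi [v [piU cE]]]] := cc.
have e4 : (e + e) + (e + e) <= 5 * e by clear -e0; lra.
set h := c 1%g in c1; have hE : h = v^t* *m v by rewrite /h cE compression1.
pose r := 1 + e; have r0 : 0 < r by rewrite ltr_pwDl // ltW.
have r1 : 1 <= r by rewrite lerDl ltW.
have rV0 : 0 <= r^-1 by rewrite invr_ge0 ltW.
have rV1 : r^-1 <= 1 by rewrite invf_le1.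
have rVe : 1 - r^-1 <= e.
  rewrite lerBlDr -lerBlDl -(ler_pM2r r0) mulVf ?gt_eqF // /r mulrDr mulr1 mulrBl mul1r.
  by have := sqr_ge0 e; rewrite expr2; lra.
have hr : mx_opnorm h <= r.
  have := opnormD (h - 1%:M) 1%:M; rewrite subrK => H.
  by rewrite /r addrC; exact: le_trans H (lerD c1 (opnorm1_le _ _)).
pose P := 1%:M - toC r^-1 *: h.
have [w wE] : exists w : 'M[C]_k, w^t* *m w = P.
  apply: psd_factor.
    by rewrite /P adjmxB adjmx1 adjmxZ conj_toC hE adjmxM adjmxK.
  move=> x; rewrite /P mulmxBl mul1mx -scalemxAl ipBl ipZl hE -mulmxA l2ip_adj.
  rewrite adjmxK !ip_snorm -toCM -toCB -toC0 le_toC subr_ge0 -!l2normE.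
  rewrite mulrC ler_pdivrMr // l2norm_sqr l2ip_adj mulmxA -hE.
  apply: le_trans (Re_l2ip _ _) _; rewrite expr2 -mulrA.
  apply: ler_wpM2l; first exact: l2norm_ge0.
  apply: le_trans (l2norm_mulmx _ _) _; rewrite mulrC.
  by apply: ler_wpM2l; first exact: l2norm_ge0.
exists (fun g => toC r^-1 *: c g + w^t* *m w).
  by apply: compressions_add; [apply: compressions_scale|apply: compressions_const].
split; first by rewrite wE /P -/h addrC subrK.
move=> g gF; rewrite wE.
have Pe : mx_opnorm P <= e + e.
  have -> : P = toC (1 - r^-1) *: 1%:M - toC r^-1 *: (h - 1%:M).
    by rewrite toCB scalerBl scale1r scalerBr opprB addrA subrK.
  apply: le_trans (opnormB _ _) _; rewrite !opnormZ !cabs_toC.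
  rewrite !ger0_norm ?subr_ge0 //; apply: lerD.
    apply: (@le_trans _ _ ((1 - r^-1) * 1)).
      by apply: ler_wpM2l; [rewrite subr_ge0|apply: opnorm1_le].
    by rewrite mulr1.
  apply: le_trans (ler_wpM2l rV0 c1) _.
  by rewrite -[leRHS]mul1r; apply: ler_wpM2r; first exact: ltW.
have -> : toC r^-1 *: c g + P - phi g =
    toC r^-1 *: (c g - phi g) - toC (1 - r^-1) *: phi g + P.
  by rewrite toCB scalerBr scalerBl scale1r opprB subrKA addrAC.
apply: le_trans e4.
apply: le_trans (opnormD _ _) (lerD _ Pe).
apply: le_trans (opnormB _ _) _; rewrite !opnormZ !cabs_toC.
rewrite !ger0_norm ?subr_ge0 //; apply: lerD.
  apply: le_trans (ler_wpM2l rV0 (cF g gF)) _.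
  by rewrite -[leRHS]mul1r; apply: ler_wpM2r; first exact: ltW.
apply: (@le_trans _ _ ((1 - r^-1) * 1)).
  by apply: ler_wpM2l; rewrite ?subr_ge0.
by rewrite mulr1.
Qed.

Record isometric_rep (k : nat) := IsometricRep {
  ir_dim : nat;
  ir_rep : G -> 'M[C]_ir_dim;
  ir_iso : 'M[C]_(ir_dim, k);
  ir_repP : mx_unitary_rep ir_rep;
  ir_isoP : ir_iso^t* *m ir_iso = 1%:M
}.

Definition trivial_ir k : isometric_rep k.
Proof.
apply: (@IsometricRep k k (fun=> 1%:M) 1%:M); first exact: trivial_rep_unitary.
by rewrite adjmx1 mulmx1.
Defined.

Lemma unital_compression_ir k (c : G -> 'M[C]_k) : compressions c -> c 1%g = 1%:M ->
  exists x : isometric_rep k, c = compression (ir_rep x) (ir_iso x).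
Proof.
move=> [d [pi [v [piU ->]]]]; rewrite compression1 // => vv.
by exists (IsometricRep piU vv).
Qed.

End Isometry.

(** * The theorem *)

Section Main.
Variables (R : realType) (G : groupType) (k : nat -> nat).
Local Notation C := R[i].
Variable phi : forall n, G -> 'M[C]_(k n).
Arguments phi : clear implicits.
Hypothesis phi_asymp : asymptotic_rep phi.
Hypothesis G_LLP : group_LLP R G.
Hypothesis G_RFD : group_RFD R G.

Lemma negl_all (x : G -> forall n, 'M[C]_(k n)) (Fs : seq G) (e : R) :
  (forall g, g \in Fs -> negl (x g)) -> 0 < e ->
  \forall n \near \oo, forall g, g \in Fs -> mx_opnorm (x g n) <= e.
Proof.
move=> H e0; elim: Fs H => [|g Fs IH] H; first exact: nearW.
have H1 := H g (mem_head _ _) e e0.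
have H2 := IH (fun g' g'F => H g' (mem_behead (s := g :: Fs) g'F)).
by apply: filterS2 H1 H2 => n gn Hn g'; rewrite inE => /orP[/eqP ->|/Hn].
Qed.

Lemma asymptotic_rep_local (Fs : seq G) (e : R) : 0 < e ->
  \forall n \near \oo, exists x : isometric_rep R G (k n), forall g, g \in Fs ->
    mx_opnorm (compression (ir_rep x) (ir_iso x) g - phi n g) <= e.
Proof.
move=> e0; have [A [u [fullA llp]]] := G_LLP.
pose F1 := 1%g :: Fs; pose L := F1 ++ [seq g^-1%g | g <- F1].
have L1 : 1%g \in L by rewrite mem_cat mem_head.
have FL : {subset F1 <= L} by move=> g gF; rewrite mem_cat gF.
have LV g : g \in L -> g^-1%g \in L.
  rewrite mem_cat => /orP[gF|/mapP [h hF ->]]; first by rewrite mem_cat map_f ?orbT.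
  by rewrite invgK FL.
have [psi [lin pos asy]] := asymptotic_cp_lift phi_asymp fullA llp L1 LV.
(* The correction to an isometry multiplies the error by [5]; the error [d] is
   the sum of those of the compression, of the lift, and of [phi n 1] as an
   approximation of [1]. *)
pose d := Num.min 1 (e / 5).
have d0 : 0 < d by rewrite lt_min ltr01 divr_gt0.
have d1 : d <= 1 by rewrite ge_min lexx.
have d5 : 5 * d <= e by rewrite mulrC -ler_pdivlMr // ge_min lexx orbT.
have d3 : 0 < d / 3 by rewrite divr_gt0.
have d23 : d / 3 + d / 3 <= d by lra.
have arith3 (x y z : R) : x <= y + z -> y <= d / 3 -> z <= d / 3 -> x <= d / 3 + d / 3.
  lra.
have arith (x y z : R) : x <= y + z -> y <= d / 3 + d / 3 -> z <= d / 3 -> x <= d by lra.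
have nF := negl_all (fun g gF => asy g (FL g gF)) d3.
apply: filterS2 nF (phi1_negl phi_asymp d3) => n Hn H1.
have [c cc cF] := cp_compression_approx G_RFD fullA L1 LV FL (lin n)
  (fun m X LX Xpos => pos m X LX Xpos n) d3.
have cphi g : g \in F1 -> mx_opnorm (c g - phi n g) <= d / 3 + d / 3.
  move=> gF; have := opnormD (- (psi (u g) n - c g)) (psi (u g) n - phi n g).
  rewrite opnormN opprB subrKA => H; exact: arith3 H (cF g gF) (Hn g gF).
have [|||g||g gF|c' cc' [c'1 c'F]] := @unital_compression R G (k n) c (phi n) F1 d.
- by [].
- by [].
- by [].
- exact: phi_opnorm.
- have := opnormD (c 1%g - phi n 1%g) (phi n 1%g - 1%:M); rewrite subrKA => H.
  exact: arith H (cphi 1%g (mem_head _ _)) H1.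
- by apply: le_trans (cphi g gF) d23.
have [x xE] := unital_compression_ir cc' c'1.
exists x => h hF; rewrite -xE; apply: le_trans (c'F h _) d5.
by rewrite in_cons hF orbT.
Qed.

End Main.

Theorem theorem1p1 (R : realType) (G : groupType)
    (G_countable : countable [set: G])
    (G_LLP : group_LLP R G) (G_RFD : group_RFD R G)
    (k : nat -> nat) (phi : forall n, G -> 'M[R[i]]_(k n))
    (phi_asymp : asymptotic_rep phi) :
  exists (m : nat -> nat) (pi : forall n, G -> 'M[R[i]]_(m n))
         (v : forall n, 'M[R[i]]_(m n, k n)),
    [/\ forall n, mx_unitary_rep (pi n),
        forall n, (v n)^t* *m v n = 1%:M &
        forall g, (fun n => mx_opnorm ((v n)^t* *m pi n g *m v n - phi n g))
                    @ \oo --> (0 : R)].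
Proof.
have /countable_injP [f finj] := G_countable.
(* The default [1] only fills the gaps in the range of [f]. *)
pose enum_G i : G := xget 1%g [set g | f g = i].
have enumK g : enum_G (f g) = g.
  apply: finj; rewrite ?in_setT //.
  exact: (@xgetPex _ 1%g [set h | f h = f g] (ex_intro _ g erefl)).
pose Q j n (x : isometric_rep R G (k n)) := forall i, (i <= j)%N ->
  mx_opnorm (compression (ir_rep x) (ir_iso x) (enum_G i) - phi n (enum_G i)) <= half_pow R j.
have [||x Hx] := diagonal_choice _ nbhs_infty_ge (fun n => trivial_ir R G (k n)) (Q := Q).
- move=> j n x Hx i ij; apply: le_trans (Hx i (leqW ij)) _.
  exact: half_pow_le.
- move=> j.
  have := asymptotic_rep_local phi_asymp G_LLP G_RFD [seq enum_G i | i <- iota 0 j.+1]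
    (half_pow_gt0 R j).
  apply: filterS => n [x Hx]; exists x => i ij; apply: Hx.
  by apply: map_f; rewrite mem_iota.
exists (fun n => ir_dim (x n)), (fun n => ir_rep (x n)), (fun n => ir_iso (x n)).
split=> [n|n|g]; [exact: ir_repP|exact: ir_isoP|].
apply/cvgrPdist_le => e e0; have [j Hj] := half_pow_small e0.
apply: filterS (Hx (maxn j (f g))) => n /(_ (f g) (leq_maxr _ _)).
rewrite enumK => H; rewrite sub0r normrN ger0_norm ?opnorm_ge0 //.
by apply: le_trans H (le_trans _ Hj); apply: half_pow_le; apply: leq_maxl.
Qed.
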